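(* Every commensurability class of non-arithmetic lattices in ${\rm PU}(2,1)$ known at the time of the paper, that is, the commensurability class of each of the groups $\langle R_1,R_2,R_3\rangle$ in the list (1)--(5) of the context, contains the monodromy group of a third order hypergeometric equation.
   Context: **Reflection groups.** For an integer $p$ with $|p|\ge 2$ and $\rho,\sigma,\tau\in\mathbb{C}$ let $$R_1=\begin{pmatrix} e^{2\pi i/p}&\rho&-\bar\tau\\0&1&0\\0&0&1\end{pmatrix},\quad R_2=\begin{pmatrix}1&0&0\\-e^{2\pi i/p}\bar\rho&e^{2\pi i/p}&\sigma\\0&0&1\end{pmatrix},\quad R_3=\begin{pmatrix}1&0&0\\0&1&0\\ e^{2\pi i/p}\tau&-e^{2\pi i/p}\bar\sigma&e^{2\pi i/p}\end{pmatrix}.$$ These are complex reflections preserving the Hermitian form $$H=\begin{pmatrix}2\sin(\pi/p)&-ie^{-i\pi/p}\rho&ie^{-i\pi/p}\bar\tau\\ ie^{i\pi/p}\bar\rho&2\sin(\pi/p)&-ie^{-i\pi/p}\sigma\\-ie^{i\pi/p}\tau&ie^{i\pi/p}\bar\sigma&2\sin(\pi/p)\end{pmatrix}.$$ The group $\langle R_1,R_2,R_3\rangle$ is regarded as a subgroup of ${\rm PGL}(3,\mathbb{C})$; in the cases listed below, ${\rm PU}(H)$ is identified with ${\rm PU}(2,1)$ and the group is a non-arithmetic lattice in it. **The list of known non-arithmetic lattices** (every non-arithmetic lattice in ${\rm PU}(2,1)$ known at the time of the paper is commensurable to one of these; repetitions up to commensurability occur; $(a,b,c;d)$ records the braid lengths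 of the pairs $(R_2,R_3)$, $(R_3,R_1)$, $(R_1,R_2)$, $(R_1,R_3^{-1}R_2R_3)$). (1) Family $(n,n,n;m)$, with $\rho=\sigma=\tau$: - $n=3$: $\tau=-e^{-2\pi i/(3m)}$, with: $m=2$, $p=9$; $m=3$, $p\in\{7,8,10\}$; $m=4$, $p\in\{5,6\}$; $m=5$, $p=4$; $m=6$, $p\in\{4,6\}$; $m=7$, $p=3$. - $(n,m)=(4,3)$: $\tau=(-1-i\sqrt7)/2$, $p\in\{4,5,6,8,12\}$. - $(4,4)$: $\tau=e^{i\pi/3}+e^{-i\pi/6}$, $p\in\{5,6\}$. - $(4,5)$: $\tau=e^{-i\pi/9}(\sqrt5+i\sqrt3)/2$, $p\in\{3,4\}$. - $(5,5)$: $\tau=e^{4\pi i/15}+e^{-2\pi i/15}$, $p=4$. - $(6,4)$: $\tau=-1+i\sqrt2$, $p\in\{3,4,6\}$. (2) Family $(n,n,m;m)$, with $\sigma=\tau=\sqrt{\rho+\bar\rho}=2\cos(\pi/n)$: - $(n,m)=(3,3)$: $\rho=e^{i\pi/3}$, $p\in\{7,8,10\}$. - $(3,4)$: $\rho=(1+i\sqrt7)/2$, $p\in\{4,5,6,8,12\}$. - $(3,5)$: $\rho=-e^{-2\pi i/5}-e^{-4\pi i/5}$, $p=3$. - $(4,4)$: $\rho=1+i$, $p\in\{5,6\}$. - $(5,4)$: $\rho=e^{i\pi/3}(\sqrt5-i\sqrt3)/2$, $p\in\{4,5\}$. - $(5,5)$: $\rho=e^{2\pi i/5}+1$, $p=4$.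 (3) Family $(3,3,4;n)$, with $\sigma=\tau=1$: - $n=3$: $\rho=1+i$, $p\in\{5,6\}$. - $n=4$: $\rho=(1+i\sqrt7)/2$, $p\in\{4,5,6,8,12\}$. - $n=5$: $\rho=e^{2\pi i/3}(\sqrt5-i\sqrt3)/2$, $p\in\{4,5\}$. - $n=6$: $\rho=i\sqrt2$, $p\in\{3,4,6\}$. (4) Family $(2,3,n;n)$, with $\sigma=0$, $\tau=1$, $\rho=2\cos(\pi/n)$: $n=3$, $p=9$. (5) Family $(3,4,4;4)$, with $\rho=\tau=\sqrt2$, $\sigma=e^{i\pi/3}$: $p=4$. **Hypergeometric groups.** With $\theta=z\frac{d}{dz}$, the third order hypergeometric equation with parameters $\alpha_j,\beta_j\in\mathbb{C}$ is $$\bigl[(\theta+\beta_1-1)(\theta+\beta_2-1)(\theta+\beta_3-1)-z(\theta+\alpha_1)(\theta+\alpha_2)(\theta+\alpha_3)\bigr]w=0 .$$ Put $a_j=e^{2\pi i\alpha_j}$, $b_j=e^{2\pi i\beta_j}$ and assume $a_j\ne b_k$ for all $j,k$. By results of Levelt and Beukers--Heckman, its monodromy group is, up to conjugation in ${\rm GL}(3,\mathbb{C})$, the hypergeometric group $H(a;b)$: the subgroup of ${\rm GL}(3,\mathbb{C})$ generated by $A,B$ with characteristic polynomials $\prod_j(t-a_j)$ and $\prod_j(t-b_j)$ and such that $BA^{-1}-I$ has rank one (the pair $(A,B)$ is unique up to simultaneous conjugation). Monodromy groups are regarded projectively here, i.e. through their images in ${\rm PGL}(3,\mathbb{C})$.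 **Commensurability.** Two subgroups of ${\rm PGL}(3,\mathbb{C})$ are commensurable if, after conjugating one of them, their intersection has finite index in each. *)

(* Defs.v *)
From HB Require Import structures.
From mathcomp Require Import all_boot all_order all_algebra.
From mathcomp Require Import all_classical all_reals all_analysis.
From mathcomp Require Import complex.
Set Implicit Arguments.
Unset Strict Implicit.
Unset Printing Implicit Defensive.
Import Order.TTheory GRing.Theory Num.Theory numFieldNormedType.Exports.
Local Open Scope classical_set_scope.
Local Open Scope ring_scope.

(* [R[i]] itself carries no topology in the library; seen as an abstract
   numClosedFieldType it gets the one given by its absolute value. *)
Definition Cplx (R : realType) : numClosedFieldType := R[i].

Definition cplx (R : realType) (x y : R) : Cplx R := Complex x y.
Notation "x +i* y" := (cplx x y) : ring_scope.

Definition ofR (R : realType) (x : R) : Cplx R := x +i* 0.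

Definition expi (R : realType) (t : R) : Cplx R := cos t +i* sin t.

Definition cexp (R : realType) (z : Cplx R) : Cplx R :=
  ofR (expR (complex.Re z)) * expi (complex.Im z).

Definition exp2pi (R : realType) (z : Cplx R) : Cplx R :=
  cexp ((0 +i* (2 * pi)) * z).

Section Projective.
Variable K : fieldType.
Implicit Types (G H : set 'M[K]_3) (S : set 'M[K]_3).

Inductive generated S : set 'M[K]_3 :=
| generated1 : generated S 1%:M
| generatedM g h : S g -> generated S h -> generated S (g *m h)
| generatedV g h : S g -> generated S h -> generated S (invmx g *m h).

(* A subgroup of PGL(3,K) is represented by its full preimage in GL(3,K), a
   subgroup containing the nonzero scalars; this respects conjugation,
   intersection and index. [projective G] is the preimage of the image of G. *)
Definition projective G : set 'M[K]_3 :=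
  [set c *: g | c in [set c : K | c != 0] & g in G].

Definition conjugate_set (P : 'M[K]_3) G : set 'M[K]_3 :=
  [set P *m g *m invmx P | g in G].

(* finitely many left cosets x H with x in G cover G *)
Definition finite_index H G : Prop :=
  exists2 s : seq 'M[K]_3, (forall x, x \in s -> G x) &
    forall g, G g -> exists2 x, x \in s & H (invmx x *m g).

Definition commensurable G1 G2 : Prop :=
  exists2 P : 'M[K]_3, P \in unitmx &
    let H1 := projective G1 in
    let H2 := conjugate_set P (projective G2) in
    finite_index (H1 `&` H2) H1 /\ finite_index (H1 `&` H2) H2.

Definition mx3 (rows : seq (seq K)) : 'M[K]_3 :=
  \matrix_(i < 3, j < 3) (nth [::] rows i)`_j.

End Projective.

Section Reflections.
Variables (R : realType) (p : int) (rho sigma tau : Cplx R).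

Let e : Cplx R := expi (2 * pi / p%:~R).

Definition refl1 : 'M[Cplx R]_3 := mx3
  [:: [:: e; rho; - tau^*];
      [:: 0; 1; 0];
      [:: 0; 0; 1]].

Definition refl2 : 'M[Cplx R]_3 := mx3
  [:: [:: 1; 0; 0];
      [:: - (e * rho^*); e; sigma];
      [:: 0; 0; 1]].

Definition refl3 : 'M[Cplx R]_3 := mx3
  [:: [:: 1; 0; 0];
      [:: 0; 1; 0];
      [:: e * tau; - (e * sigma^*); e]].

Definition refl_group : set 'M[Cplx R]_3 :=
  generated [set M | [\/ M = refl1, M = refl2 | M = refl3]].

End Reflections.

(* The families (n,n,n;m), (n,n,m;m) and (3,3,4;n); the comment on a
   constructor gives the values of (n,m), respectively n. *)
Variant family_nnnm (R : realType) : int -> Cplx R -> Prop :=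
| nnnm_3 (m : nat) (p : int) : (* (3,m) *)
    (m, p) \in [:: (2%N, 9); (3%N, 7); (3%N, 8); (3%N, 10); (4%N, 5); (4%N, 6);
                   (5%N, 4); (6%N, 4); (6%N, 6); (7%N, 3)] ->
    family_nnnm p (- expi (- (2 * pi) / (3 * m%:R)))
| nnnm_43 (p : int) : (* (4,3) *)
    p \in [:: 4; 5; 6; 8; 12] ->
    family_nnnm p ((-1 +i* - Num.sqrt 7) / 2)
| nnnm_44 (p : int) : (* (4,4) *)
    p \in [:: 5; 6] ->
    family_nnnm p (expi (pi / 3) + expi (- pi / 6))
| nnnm_45 (p : int) : (* (4,5) *)
    p \in [:: 3; 4] ->
    family_nnnm p (expi (- pi / 9) * (Num.sqrt 5 +i* Num.sqrt 3) / 2)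
| nnnm_55 (p : int) : (* (5,5) *)
    p = 4 ->
    family_nnnm p (expi (4 * pi / 15) + expi (- (2 * pi) / 15))
| nnnm_64 (p : int) : (* (6,4) *)
    p \in [:: 3; 4; 6] ->
    family_nnnm p (-1 +i* Num.sqrt 2).

Variant family_nnmm (R : realType) : nat -> int -> Cplx R -> Prop :=
| nnmm_33 (p : int) : (* (3,3) *)
    p \in [:: 7; 8; 10] ->
    family_nnmm 3 p (expi (pi / 3))
| nnmm_34 (p : int) : (* (3,4) *)
    p \in [:: 4; 5; 6; 8; 12] ->
    family_nnmm 3 p ((1 +i* Num.sqrt 7) / 2)
| nnmm_35 (p : int) : (* (3,5) *)
    p = 3 ->
    family_nnmm 3 p (- expi (- (2 * pi) / 5) - expi (- (4 * pi) / 5))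
| nnmm_44 (p : int) : (* (4,4) *)
    p \in [:: 5; 6] ->
    family_nnmm 4 p (1 +i* 1)
| nnmm_54 (p : int) : (* (5,4) *)
    p \in [:: 4; 5] ->
    family_nnmm 5 p (expi (pi / 3) * (Num.sqrt 5 +i* - Num.sqrt 3) / 2)
| nnmm_55 (p : int) : (* (5,5) *)
    p = 4 ->
    family_nnmm 5 p (expi (2 * pi / 5) + 1).

Variant family_334n (R : realType) : int -> Cplx R -> Prop :=
| f334n_3 (p : int) : (* 3 *)
    p \in [:: 5; 6] ->
    family_334n p (1 +i* 1)
| f334n_4 (p : int) : (* 4 *)
    p \in [:: 4; 5; 6; 8; 12] ->
    family_334n p ((1 +i* Num.sqrt 7) / 2)
| f334n_5 (p : int) : (* 5 *)
    p \in [:: 4; 5] ->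
    family_334n p (expi (2 * pi / 3) * (Num.sqrt 5 +i* - Num.sqrt 3) / 2)
| f334n_6 (p : int) : (* 6 *)
    p \in [:: 3; 4; 6] ->
    family_334n p (0 +i* Num.sqrt 2).

(* The parameters (p, rho, sigma, tau) of the known non-arithmetic lattices. *)
Variant known_lattice (R : realType) :
    int -> Cplx R -> Cplx R -> Cplx R -> Prop :=
| known_nnnm p tau :
    family_nnnm p tau -> known_lattice p tau tau tau
| known_nnmm n p rho (s := ofR (2 * cos (pi / n%:R))) :
    family_nnmm n p rho -> known_lattice p rho s s
| known_334n p rho :
    family_334n p rho -> known_lattice p rho 1 1
| known_23nn :
    known_lattice 9 (ofR (2 * cos (pi / 3))) 0 1
| known_3444 :
    known_lattice 4 (ofR (Num.sqrt 2)) (expi (pi / 3)) (ofR (Num.sqrt 2)).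

Section Hypergeometric.
Variables (R : realType) (alpha beta : 'I_3 -> Cplx R).
Implicit Types (f g w : Cplx R -> Cplx R) (gamma : R -> Cplx R) (z : Cplx R).

Definition theta w : Cplx R -> Cplx R := fun z => z * derive1 w z.

Definition thetaD (c : Cplx R) w : Cplx R -> Cplx R :=
  fun z => theta w z + c * w z.

Definition hypergeometric_op w : Cplx R -> Cplx R := fun z =>
  thetaD (beta 0 - 1) (thetaD (beta 1 - 1) (thetaD (beta 2 - 1) w)) z
  - z * thetaD (alpha 0) (thetaD (alpha 1) (thetaD (alpha 2) w)) z.

(* w represents a germ at z of a holomorphic solution. By Goursat's theorem the
   last two derivability conditions follow from the first. *)
Definition solution_at w z : Prop :=
  \forall y \near z,
    [/\ derivable w y 1, derivable (theta w) y 1,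
        derivable (theta (theta w)) y 1 & hypergeometric_op w y = 0].

Definition eq_germ z f g : Prop := \forall y \near z, f y = g y.

(* g is the analytic continuation along gamma : [0,1] -> C of the solution f *)
Definition continuation gamma f g : Prop :=
  exists w : R -> Cplx R -> Cplx R,
    [/\ eq_germ (gamma 0) (w 0) f,
        eq_germ (gamma 1) (w 1) g,
        forall t : R, 0 <= t <= 1 -> solution_at (w t) (gamma t) &
        forall t : R, 0 <= t <= 1 -> \forall s \near t, 0 <= s <= 1 ->
          eq_germ (gamma s) (w s) (w t)].

Definition is_loop z0 gamma : Prop :=
  [/\ {within `[0, 1], continuous gamma}, gamma 0 = z0, gamma 1 = z0 &
      forall t : R, 0 <= t <= 1 -> gamma t != 0 /\ gamma t != 1].

(* a basis of the space of germs of solutions at z0 *)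
Definition fundamental_system z0 (f : 'I_3 -> Cplx R -> Cplx R) : Prop :=
  (forall j, solution_at (f j) z0) /\
  forall w, solution_at w z0 -> exists! c : 'cV[Cplx R]_3,
    eq_germ z0 w (fun z => \sum_j c j 0 * f j z).

Definition monodromy z0 (f : 'I_3 -> Cplx R -> Cplx R) : set 'M[Cplx R]_3 :=
  [set M | exists2 gamma, is_loop z0 gamma & forall j,
     continuation gamma (f j) (fun z => \sum_i M i j * f i z)].

(* well defined up to conjugation in GL(3,C): another base point or another
   fundamental system gives a conjugate group *)
Definition monodromy_group (G : set 'M[Cplx R]_3) : Prop :=
  exists z0 (f : 'I_3 -> Cplx R -> Cplx R),
    [/\ z0 != 0, z0 != 1, fundamental_system z0 f & G = monodromy z0 f].

End Hypergeometric.

(* Main.v *)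
Require Import Defs.
From mathcomp Require Import all_boot all_order all_algebra.
From mathcomp Require Import all_classical all_reals all_analysis.
From mathcomp Require Import complex ring lra zify.

(** Why the theorem is true.

A pair of matrices A, B in GL(3,C) with disjoint spectra and with A - B of rank
at most one is determined up to simultaneous conjugation by its two spectra
([levelt]): a vector v with Av = Bv and A^2 v = B^2 v is cyclic, and in the basis
v, Av, A^2 v both matrices are companion matrices. The proof therefore has an
analytic half, which computes the monodromy of the hypergeometric equation, and
an algebraic half, which finds such a pair in the commensurability class of each
lattice.

Analytic half. Written for the vector of w, theta w and theta^2 w, the equation
is the Fuchsian system Y' = (C0/z + C1/(1 - z)) Y with C1 of rank one. Power
series give invertible matrix solutions F0, F1, F2 on three regions: the plane
without the half-lines z <= 0 and z >= 1, the half-plane re z < 0 and the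
half-plane re z > 1 ([charts]). They can be normalized so that F1 and F2 agree
with F0 above the real axis; below it they are F0 M0 and F0 M1. A continuation
along a loop only ever passes between these three solutions, so the monodromy
group lies in the group generated by M0 and M1, and two circles realize both
generators. Frobenius' method at 0 and at infinity, carried out in the
coordinate log z, produces eigenvectors: M0 has the eigenvalues exp(-2 pi i
beta_j), and M0^-1 M1 has the eigenvalues exp(2 pi i alpha_j). At z = 1 the
kernel of C1 gives a plane of holomorphic solutions, so M1 - 1 has rank at most
one. All of this is [hypergeometric_monodromy]. By Levelt's argument the pair
M0^-1 M1, M0^-1 is conjugate to any prescribed pair with these spectra
([realize_hypergeometric]); the exclusion of resonances is harmless because
alpha_0 may be moved by an integer.

Algebraic half. If T normalizes a group G up to scalars, has a power in G, and G
together with T is generated by A and B, then G has finite index in the group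
generated by A and B ([commensurable_extension]).
 - For a triple (t,t,t) the map T = J that permutes R1, R2, R3 cyclically
   satisfies J^3 = e^2; take A = J/e and B = R1 A. The eigenvalues of A are the
   cube roots of 1/e, those of B the roots of u^3 - t u^2 + t^* u - 1.
 - For a triple (r,s,s) with s real and r + r^* = s^2 the reflection R3 has, up
   to a scalar, a square root T = Q which conjugates R1 to R2; take A = Q and
   B = R1 Q. The eigenvalues of A are 1 and the square roots of 1/e, those of B
   the roots of u^3 - (1 - r) u^2 + (r^* - 1) u + 1.
 - For the triple of (3,4,4;4) an element T with T^3 scalar commutes with R1 and
   conjugates R2 to R3; take A = R1 T and B = R2 A.
For the listed parameters all eigenvalues are explicit roots of unity, so that
distinctness and disjointness of the spectra become statements on rational
numbers. The family (n,n,n;m) is of the first type and (n,n,m;m) of the second.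
The other triples are of one of these types or are brought to it by three operations
that preserve the group up to conjugation: the cyclic shift [param_cyclic], the
Hurwitz move [param_hurwitz] and diagonal conjugation [param_rescale]. *)

Set Implicit Arguments.
Unset Strict Implicit.
Unset Printing Implicit Defensive.
Import Order.TTheory GRing.Theory Num.Theory.
Import numFieldNormedType.Exports.
Local Open Scope classical_set_scope.
Local Open Scope ring_scope.

(** * Complex numbers by real and imaginary parts *)

Section ComplexBasics.
Variable R : realType.
Implicit Types (x y : R) (z w : Cplx R).

Definition re z : R := complex.Re z.
Definition im z : R := complex.Im z.
Definition cabs z : R := Num.sqrt (re z ^+ 2 + im z ^+ 2).

Lemma cplx_eq z w : re z = re w -> im z = im w -> z = w.
Proof. by case: z w => [a b] [c d]; rewrite /re /im /= => -> ->. Qed.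

Lemma reD z w : re (z + w) = re z + re w. Proof. by case: z w => [? ?] [? ?]. Qed.
Lemma imD z w : im (z + w) = im z + im w. Proof. by case: z w => [? ?] [? ?]. Qed.
Lemma reN z : re (- z) = - re z. Proof. by case: z. Qed.
Lemma imN z : im (- z) = - im z. Proof. by case: z. Qed.
Lemma reB z w : re (z - w) = re z - re w. Proof. by rewrite reD reN. Qed.
Lemma imB z w : im (z - w) = im z - im w. Proof. by rewrite imD imN. Qed.
Lemma reM z w : re (z * w) = re z * re w - im z * im w.
Proof. by case: z w => [? ?] [? ?]. Qed.
Lemma imM z w : im (z * w) = re z * im w + im z * re w.
Proof. by case: z w => [? ?] [? ?]; rewrite /im /re /= addrC. Qed.
Lemma re0 : re 0 = 0. Proof. by []. Qed.
Lemma im0 : im 0 = 0. Proof. by []. Qed.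
Lemma re1 : re 1 = 1. Proof. by []. Qed.
Lemma im1 : im 1 = 0. Proof. by []. Qed.
Lemma re_ofR x : re (ofR x) = x. Proof. by []. Qed.
Lemma im_ofR x : im (ofR x) = 0. Proof. by []. Qed.
Lemma re_cplx x y : re (x +i* y) = x. Proof. by []. Qed.
Lemma im_cplx x y : im (x +i* y) = y. Proof. by []. Qed.
Lemma re_expi x : re (expi x) = cos x. Proof. by []. Qed.
Lemma im_expi x : im (expi x) = sin x. Proof. by []. Qed.
Lemma conjcE z : z^* = (re z) +i* (- im z).
Proof. by case: z. Qed.

Lemma normE z : `|z| = ofR (cabs z).
Proof. by rewrite /cabs -[LHS]/(Num.norm (z : R[i])) normc_def. Qed.

Lemma ofRD x y : ofR (x + y) = ofR x + ofR y. 
Proof. by apply: cplx_eq; rewrite ?(reD, imD, re_ofR, im_ofR, addr0). Qed.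
Lemma ofRM x y : ofR (x * y) = ofR x * ofR y.
Proof. by apply: cplx_eq; rewrite ?(reM, imM, re_ofR, im_ofR, mulr0, mul0r, subr0, addr0). Qed.
Lemma ofRN x : ofR (- x) = - ofR x.
Proof. by apply: cplx_eq; rewrite ?(reN, imN, re_ofR, im_ofR, oppr0). Qed.
Lemma ofRB x y : ofR (x - y) = ofR x - ofR y. Proof. by rewrite ofRD ofRN. Qed.
Lemma ofR0 : ofR (0 : R) = 0. Proof. by []. Qed.
Lemma ofR1 : ofR (1 : R) = 1. Proof. by []. Qed.
Lemma ofR_inj : injective (@ofR R). Proof. by move=> x y []. Qed.
Lemma ofR_lt x y : (ofR x < ofR y) = (x < y). Proof. exact: ltcR. Qed.
Lemma ofR_le x y : (ofR x <= ofR y) = (x <= y). Proof. exact: lecR. Qed.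
Lemma ofR_nat n : ofR (n%:R : R) = n%:R.
Proof. by elim: n => [|n IH] //; rewrite !mulrS ofRD IH. Qed.
Lemma re_nat n : re (n%:R) = n%:R. Proof. by rewrite -ofR_nat. Qed.
Lemma ofRV x : ofR (x^-1) = (ofR x)^-1.
Proof.
have [->|x0] := eqVneq x 0; first by rewrite invr0 ofR0 invr0.
have h : ofR x != 0 by rewrite -ofR0 (inj_eq ofR_inj).
by apply: (mulfI h); rewrite -ofRM mulfV // mulfV.
Qed.

Lemma cabs_ge0 z : 0 <= cabs z. Proof. exact: sqrtr_ge0. Qed.
Lemma cabsM z w : cabs (z * w) = cabs z * cabs w.
Proof. by apply: ofR_inj; rewrite ofRM -!normE normrM. Qed.
Lemma cabsD z w : cabs (z + w) <= cabs z + cabs w.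
Proof. by rewrite -ofR_le ofRD -!normE ler_normD. Qed.
Lemma cabsN z : cabs (- z) = cabs z.
Proof. by apply: ofR_inj; rewrite -!normE normrN. Qed.
Lemma cabsB z w : cabs (z - w) <= cabs z + cabs w.
Proof. by rewrite -(cabsN w) cabsD. Qed.
Lemma cabsC z w : cabs (z - w) = cabs (w - z).
Proof. by rewrite -cabsN opprB. Qed.
Lemma cabs0 : cabs 0 = 0. Proof. by apply: ofR_inj; rewrite -normE normr0. Qed.
Lemma cabs1 : cabs 1 = 1. Proof. by apply: ofR_inj; rewrite -normE normr1. Qed.
Lemma cabs_eq0 z : (cabs z == 0) = (z == 0).
Proof. by rewrite -(inj_eq ofR_inj) -normE normr_eq0. Qed.
Lemma cabs_gt0 z : (0 < cabs z) = (z != 0).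
Proof. by rewrite lt_def cabs_eq0 cabs_ge0 andbT. Qed.
Lemma cabsX z n : cabs (z ^+ n) = cabs z ^+ n.
Proof. by elim: n => [|n IH]; rewrite ?expr0 ?cabs1 // !exprS cabsM IH. Qed.
Lemma cabsV z : cabs (z^-1) = (cabs z)^-1.
Proof. by apply: ofR_inj; rewrite ofRV -!normE normfV. Qed.
Lemma cabs_ofR x : cabs (ofR x) = `|x|.
Proof. by rewrite /cabs re_ofR im_ofR expr0n addr0 sqrtr_sqr. Qed.
Lemma cabs_nat n : cabs n%:R = n%:R.
Proof. by rewrite -ofR_nat cabs_ofR normr_nat. Qed.
Lemma cabs_re z : `|re z| <= cabs z.
Proof. by rewrite -sqrtr_sqr ler_wsqrtr // lerDl sqr_ge0. Qed.
Lemma cabs_im z : `|im z| <= cabs z.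
Proof. by rewrite -sqrtr_sqr ler_wsqrtr // lerDr sqr_ge0. Qed.
Lemma cabs_reim z : cabs z <= `|re z| + `|im z|.
Proof.
have -> : z = ofR (re z) + (0 +i* 1) * ofR (im z).
  by apply: cplx_eq; rewrite ?reD ?imD ?reM ?imM re_cplx im_cplx !re_ofR !im_ofR; ring.
apply: le_trans (cabsD _ _) _; rewrite cabsM !cabs_ofR.
rewrite {1}/cabs re_cplx im_cplx expr0n expr1n add0r sqrtr1 mul1r.
by rewrite !reD !imD !reM !imM re_cplx im_cplx !re_ofR !im_ofR; rewrite !(mul0r,mul1r,mulr0,subr0,addr0,add0r,subrr).
Qed.
Lemma cabs_sum n (F : 'I_n -> Cplx R) : cabs (\sum_i F i) <= \sum_i cabs (F i).
Proof.
elim/big_ind2: _ => [|a b c d h1 h2|//]; first by rewrite cabs0.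
by apply: le_trans (cabsD _ _) _; exact: lerD.
Qed.
Lemma cabs_sq z : cabs z ^+ 2 = re z ^+ 2 + im z ^+ 2.
Proof. by rewrite sqr_sqrtr // addr_ge0 ?sqr_ge0. Qed.
Lemma nbhs_cabs z (A : set (Cplx R)) :
  nbhs z A <-> exists2 d : R, 0 < d & forall w, cabs (w - z) < d -> A w.
Proof.
split.
  move/nbhs_ballP=> [e /= e0 H].
  have [d de] : exists d, e = ofR d.
    by exists (re e); rewrite -[RHS]/((complex.Re e)%:C%C) RRe_real // gtr0_real.
  exists d; first by rewrite -ofR_lt -de.
  move=> y hy; apply: H; rewrite -ball_normE /ball_ /= distrC normE de.
  by rewrite ofR_lt.
move=> [d d0 H]; apply/nbhs_ballP; exists (ofR d); first by rewrite /= -ofR0 ofR_lt.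
move=> y; rewrite -ball_normE /ball_ /= distrC normE ofR_lt; exact: H.
Qed.

End ComplexBasics.

(** * Complex derivatives *)

Section Calculus.
Variable R : realType.
Local Notation C := (Cplx R).
Implicit Types (e : R) (z w d : C) (f g : C -> C).

(** Continuity at a point, with the metric quantifiers explicit: all the estimates
below are made with [cabs], which is real valued. *)
Definition cont f z := forall e, 0 < e ->
  exists2 r : R, 0 < r & forall w, cabs (w - z) < r -> cabs (f w - f z) < e.

(** Caratheodory's form of the complex derivative. No quotient occurs, so the rules
for products, sums and compositions are algebraic identities between the
continuous slopes. *)
Definition hasd f z d := exists phi,
  [/\ forall w, f w = f z + (w - z) * phi w, cont phi z & phi z = d].

Lemma cont_cst c z : cont (fun=> c) z.
Proof. by move=> e e0; exists 1 => // w _; rewrite subrr cabs0. Qed.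

Lemma cont_id z : cont id z.
Proof. by move=> e e0; exists e. Qed.

Lemma contD f g z : cont f z -> cont g z -> cont (fun w => f w + g w) z.
Proof.
move=> cf cg e e0.
have e2 : 0 < e / 2 by rewrite divr_gt0.
have [r r0 hr] := cf _ e2; have [s s0 hs] := cg _ e2.
exists (Num.min r s); first by rewrite lt_min r0 s0.
move=> w; rewrite lt_min => /andP[/hr h1 /hs h2].
have -> : f w + g w - (f z + g z) = (f w - f z) + (g w - g z) by ring.
by have := cabsD (f w - f z) (g w - g z); lra.
Qed.

Lemma contM f g z : cont f z -> cont g z -> cont (fun w => f w * g w) z.
Proof.
move=> cf cg e e0.
pose A := cabs (f z) + 1; pose B := cabs (g z) + 1.
have A0 : 0 < A by rewrite /A; have := cabs_ge0 (f z); lra.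
have B0 : 0 < B by rewrite /B; have := cabs_ge0 (g z); lra.
have e1 : 0 < Num.min 1 (e / 2 / B) by rewrite lt_min ltr01 !divr_gt0.
have e2 : 0 < e / 2 / A by rewrite !divr_gt0.
have [r r0 hr] := cf _ e1; have [s s0 hs] := cg _ e2.
exists (Num.min r s); first by rewrite lt_min r0 s0.
move=> w; rewrite lt_min => /andP[/hr + /hs h2]; rewrite lt_min => /andP[h1 h3].
have -> : f w * g w - f z * g z = f w * (g w - g z) + (f w - f z) * g z by ring.
apply: le_lt_trans (cabsD _ _) _; rewrite !cabsM.
have fA : cabs (f w) < A.
  have -> : f w = (f w - f z) + f z by ring.
  by apply: le_lt_trans (cabsD _ _) _; rewrite /A; lra.
have k1 : cabs (f w) * cabs (g w - g z) <= A * (e / 2 / A).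
  by apply: ler_pM; rewrite ?cabs_ge0 // ltW.
have k2 : cabs (f w - f z) * cabs (g z) < e / 2 / B * B.
  apply: le_lt_trans (_ : e / 2 / B * cabs (g z) < _).
    by apply: ler_wpM2r; rewrite ?cabs_ge0 // ltW.
  by rewrite ltr_pM2l ?divr_gt0 // /B; lra.
move: k1 k2; rewrite [A * _]mulrC !divfK ?gt_eqF // => k1 k2; lra.
Qed.

Lemma cont_comp f g z : cont g z -> cont f (g z) -> cont (fun w => f (g w)) z.
Proof.
move=> cg cf e e0; have [r r0 hr] := cf _ e0; have [s s0 hs] := cg _ r0.
by exists s => // w /hs /hr.
Qed.

Lemma cont_near f g z :
  (exists2 r : R, 0 < r & forall w, cabs (w - z) < r -> f w = g w) ->
  cont f z -> cont g z.
Proof.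
move=> [r r0 hr] cf e e0; have [s s0 hs] := cf _ e0.
exists (Num.min r s); first by rewrite lt_min r0 s0.
move=> w; rewrite lt_min => /andP[h1 h2].
by rewrite -hr // -hr ?subrr ?cabs0 //; apply: hs.
Qed.

Lemma hasdP f z d : hasd f z d <-> forall e, 0 < e ->
  exists2 r : R, 0 < r & forall h, cabs h < r ->
    cabs (f (z + h) - f z - h * d) <= e * cabs h.
Proof.
split=> [[phi [hf cphi hd]] e e0|H].
  have [r r0 hr] := cphi _ e0; exists r => // h hh.
  rewrite (hf (z + h)) (_ : _ - _ = h * (phi (z + h) - phi z)); last by rewrite hd; ring.
  rewrite cabsM mulrC ler_wpM2r ?cabs_ge0 // ltW // hr //.
  by rewrite (_ : _ - z = h) //; ring.
exists (fun w => if w == z then d else (f w - f z) / (w - z)); split; last by rewrite eqxx.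
  move=> w; have [->|wz] := eqVneq w z; first by rewrite subrr mul0r addr0.
  by rewrite mulrC divfK ?subr_eq0 // addrC subrK.
move=> e e0.
have e2 : 0 < e / 2 by rewrite divr_gt0.
have [r r0 hr] := H _ e2; exists r => // w hw; rewrite eqxx.
have [_|wz] := eqVneq w z; first by rewrite subrr cabs0.
have wz' : w - z != 0 by rewrite subr_eq0.
have := hr _ hw; rewrite (_ : z + (w - z) = w); last by ring.
have p0 : 0 < cabs (w - z) by rewrite cabs_gt0.
rewrite (_ : f w - f z - _ = ((f w - f z) / (w - z) - d) * (w - z)); last first.
  by rewrite [RHS]mulrBl divfK //; ring.
by rewrite cabsM ler_pM2r // => h; lra.
Qed.

Lemma hasd_near f g z d :
  (exists2 r : R, 0 < r & forall w, cabs (w - z) < r -> f w = g w) ->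
  hasd f z d -> hasd g z d.
Proof.
move=> [r r0 hr] /hasdP H; apply/hasdP => e e0; have [s s0 hs] := H _ e0.
exists (Num.min r s); first by rewrite lt_min r0 s0.
move=> h; rewrite lt_min => /andP[h1 h2].
rewrite -!hr ?subrr ?cabs0 //; first exact: hs.
by rewrite (_ : z + h - z = h) //; ring.
Qed.

Lemma hasd_ext f g z d : f =1 g -> hasd f z d -> hasd g z d.
Proof. by move=> fg; apply: hasd_near; exists 1. Qed.

Lemma hasd_cst c z : hasd (fun=> c) z 0.
Proof. by exists (fun=> 0); split=> [w||//]; [rewrite mulr0 addr0 | exact: cont_cst]. Qed.

Lemma hasd_id z : hasd id z 1.
Proof. by exists (fun=> 1); split=> [w||//]; [rewrite mulr1 /=; ring | exact: cont_cst]. Qed.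

Lemma hasdD f g z d d' : hasd f z d -> hasd g z d' ->
  hasd (fun w => f w + g w) z (d + d').
Proof.
move=> [p [hp cp <-]] [q [hq cq <-]]; exists (fun w => p w + q w); split=> //.
  by move=> w; rewrite (hp w) (hq w); ring.
exact: contD.
Qed.

Lemma hasdM f g z d d' : hasd f z d -> hasd g z d' ->
  hasd (fun w => f w * g w) z (d * g z + f z * d').
Proof.
move=> [p [hp cp <-]] [q [hq cq <-]].
exists (fun w => p w * g z + f z * q w + (w - z) * (p w * q w)); split=> //.
- by move=> w; rewrite (hp w) (hq w); ring.
- apply: contD.
    by apply: contD; apply: contM => //; exact: cont_cst.
  apply: contM; last exact: contM.
  by apply: contD; [exact: cont_id | exact: cont_cst].
- by rewrite subrr mul0r addr0.
Qed.

Lemma hasdZ c f z d : hasd f z d -> hasd (fun w => c * f w) z (c * d).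
Proof.
move=> h; have := hasdM (hasd_cst c z) h; by rewrite mul0r add0r.
Qed.

Lemma hasd_cont f z d : hasd f z d -> cont f z.
Proof.
move=> [p [hp cp _]].
apply: (@cont_near (fun w => f z + (w - z) * p w)); first by exists 1 => // w _; rewrite (hp w).
apply: contD; first exact: cont_cst.
apply: contM => //; apply: contD; [exact: cont_id | exact: cont_cst].
Qed.

Lemma hasd_comp f g z d d' : hasd g z d' -> hasd f (g z) d ->
  hasd (fun w => f (g w)) z (d' * d).
Proof.
move=> hg [p [hp cp <-]]; have cg := hasd_cont hg; case: hg => [q [hq cq <-]].
exists (fun w => q w * p (g w)); split=> //.
  by move=> w; rewrite (hp (g w)) {1}(hq w); ring.
by apply: contM => //; exact: cont_comp.
Qed.

Lemma hasd_sum n (F : 'I_n -> C -> C) (d : 'I_n -> C) z :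
  (forall i, hasd (F i) z (d i)) ->
  hasd (fun w => \sum_i F i w) z (\sum_i d i).
Proof.
elim: n F d => [|n IH] F d h.
  rewrite big_ord0; apply: hasd_ext (hasd_cst 0 z) => w; by rewrite big_ord0.
rewrite big_ord_recl.
apply: hasd_ext (hasdD (h ord0) (IH _ _ (fun i => h (lift ord0 i)))) => w.
by rewrite big_ord_recl.
Qed.

Lemma cont_sum n (F : 'I_n -> C -> C) z :
  (forall i, cont (F i) z) -> cont (fun w => \sum_i F i w) z.
Proof.
elim: n F => [|n IH] F h.
  by apply: (@cont_near (fun=> 0)); [exists 1 => // w _; rewrite big_ord0 | exact: cont_cst].
apply: (@cont_near (fun w => F ord0 w + \sum_(i < n) F (lift ord0 i) w)).
  by exists 1 => // w _; rewrite big_ord_recl.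
by apply: contD => //; apply: IH.
Qed.

(** The link with [derive1], in terms of which the hypergeometric operator is defined. *)
Lemma hasd_derive f z d : hasd f z d <-> derivable f z 1 /\ derive1 f z = d.
Proof.
have key l : hasd f z l <->
    (fun h : C => h^-1 *: (f (h + z) - f z)) @ (0 : C)^' --> l.
  split=> [/hasdP H|H].
    move=> A /nbhs_cabs[e e0 hA].
    have e2 : 0 < e / 2 by rewrite divr_gt0.
    have [r r0 hr] := H _ e2.
    apply/nbhs_cabs; exists r => // h; rewrite subr0 => hh h0 /=; apply: hA.
    have p0 : 0 < cabs h by rewrite cabs_gt0.
    have := hr _ hh; rewrite [z + h]addrC => k.
    have {}k : cabs (h^-1 * (f (h + z) - f z) - l) <= e / 2.
      rewrite -(ler_pM2r p0) -cabsM; apply: le_trans k.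
      by rewrite mulrBl mulrAC mulVf // mul1r [l * h]mulrC.
    by apply: le_lt_trans k _; lra.
  apply/hasdP => e e0.
  have /nbhs_cabs[r r0 hr] : nbhs 0 (fun h : C => h != 0 ->
      cabs (h^-1 *: (f (h + z) - f z) - l) < e).
    by apply: (H [set w | cabs (w - l) < e]); apply/nbhs_cabs; exists e.
  exists r => // h hh; have [->|h0] := eqVneq h 0.
    by rewrite addr0 subrr mul0r subrr cabs0 mulr0.
  have := hr h; rewrite subr0 => /(_ hh h0) /ltW k.
  have p0 : 0 < cabs h by rewrite cabs_gt0.
  move: k; rewrite -(ler_pM2r p0) -cabsM; congr (cabs _ <= _).
  rewrite mulrBl [z + h]addrC -[_ *: _]/(h^-1 * _) mulrAC mulVf // mul1r.
  by rewrite [l * h]mulrC.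
have der1 : derivable f z 1 <-> cvg ((fun h : C => h^-1 *: (f (h + z) - f z)) @ (0 : C)^').
  rewrite /derivable.
  by have -> : (fun h : C => h^-1 *: ((f \o shift z) (h *: 1) - f z))
    = (fun h : C => h^-1 *: (f (h + z) - f z)) by apply/funext => h /=; rewrite -[h *: 1]/(h * 1) mulr1.
split.
  move/key => H; split; first by apply/der1; apply/cvg_ex; exists d.
  apply: (cvg_lim _ H); exact: norm_hausdorff.
by case=> /der1 H <-; apply/key.
Qed.

End Calculus.

(** * Uniqueness for linear differential systems *)

Section RealInduction.
Variable R : realType.

(** Induction along [0,1]: the supremum of the initial segments on which the property
holds is attained and cannot be smaller than 1. *)
Lemma real_induction (Q : R -> Prop) : Q 0 ->
  (forall t, 0 <= t <= 1 -> exists2 d, 0 < d & forall s s', 0 <= s -> s' <= 1 ->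
     t - d < s -> s <= t -> t <= s' -> s' < t + d -> Q s -> Q s') ->
  forall t, 0 <= t <= 1 -> Q t.
Proof.
move=> Q0 step.
pose A := [set t : R | 0 <= t <= 1 /\ forall s, 0 <= s <= t -> Q s].
have A0 : A 0 by split=> [|s hs]; [lra | have -> : s = 0 by lra].
have hA : has_sup A by split; [exists 0 | exists 1 => t [ht _]; lra].
have x0 : 0 <= sup A by apply: ub_le_sup A0; exact: hA.2.
have x1 : sup A <= 1 by apply: ge_sup; [exists 0 | move=> t [ht _]; lra].
have hx : 0 <= sup A <= 1 by rewrite x0 x1.
have [d d0 hd] := step _ hx.
have near_sup e : 0 < e -> exists2 a, A a & sup A - e < a by move=> /(sup_adherent)/(_ hA).
have below s : 0 <= s -> s < sup A -> Q s.
  move=> s0 sx; have [a [ha Ha] ] := near_sup (sup A - s) ltac:(lra).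
  by move=> h; apply: Ha; lra.
have above s : 0 <= s -> sup A <= s -> s < sup A + d -> s <= 1 -> Q s.
  move=> s0 xs sd s1; have [a [ha Ha] h] := near_sup _ d0.
  have ax : a <= sup A by apply: ub_le_sup; [exact: hA.2 | split].
  by apply: (hd a s) => //; [lra | apply: Ha; lra].
pose y := Num.min 1 (sup A + d / 2).
have yle : y <= 1 /\ y <= sup A + d / 2 by rewrite /y !ge_min !lexx /= orbT.
have Ay : A y.
  have y0 : 0 <= y by rewrite /y le_min; lra.
  split; first by rewrite y0 yle.1.
  move=> s hs; case: (ltP s (sup A)) => h; first by apply: below => //; lra.
  by apply: above => //; lra.
have yx : y <= sup A by apply: ub_le_sup; [exact: hA.2 | exact: Ay].
have {yx} x1' : sup A = 1.
  move: yx; rewrite /y ge_min; case/orP; lra.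
move=> t ht; case: (ltP t (sup A)) => h; first by apply: below => //; lra.
by apply: above => //; lra.
Qed.

(** The form in which compactness of a path is used: a property that propagates
between nearby parameters propagates to the whole interval. *)
Lemma locally_constant (Q : R -> Prop) : Q 0 ->
  (forall t, 0 <= t <= 1 -> exists2 d, 0 < d & forall s s', 0 <= s <= 1 ->
     0 <= s' <= 1 -> `|s - t| < d -> `|s' - t| < d -> Q s -> Q s') ->
  forall t, 0 <= t <= 1 -> Q t.
Proof.
move=> Q0 H; apply: real_induction => // t ht.
have [d d0 hd] := H _ ht; exists d => // s s' s0 s1 h1 h2 h3 h4.
by apply: hd; rewrite ?ltr_norml; lra.
Qed.

End RealInduction.

Section MeanValue.
Variable R : realType.
Local Notation C := (Cplx R).

Definition seg (z w : C) (t : R) : C := z + ofR t * (w - z).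

Lemma seg0 z w : seg z w 0 = z. Proof. by rewrite /seg ofR0 mul0r addr0. Qed.
Lemma seg1 z w : seg z w 1 = w. Proof. by rewrite /seg ofR1 mul1r addrC subrK. Qed.

Lemma segB z w s t : cabs (seg z w s - seg z w t) = `|s - t| * cabs (w - z).
Proof.
by rewrite -cabs_ofR -cabsM ofRB; congr cabs; rewrite /seg; ring.
Qed.

(** The bound holds with M + e in place of M for all e > 0 by real induction along the
segment: near each point the difference is controlled by the derivative there up
to e. *)
Lemma mean_value (f df : C -> C) (z w : C) (M : R) :
  (forall t, 0 <= t <= 1 -> hasd f (seg z w t) (df (seg z w t))) ->
  (forall t, 0 <= t <= 1 -> cabs (df (seg z w t)) <= M) ->
  cabs (f w - f z) <= M * cabs (w - z).
Proof.
move=> hf hM.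
have M0 : 0 <= M by apply: le_trans (cabs_ge0 _) (hM 0 _); lra.
set L := cabs (w - z); have L0 : 0 <= L by exact: cabs_ge0.
apply/ler_addgt0Pr => e0 he0.
pose e := e0 / (L + 1).
have e_gt0 : 0 < e by rewrite divr_gt0 //; lra.
suff H : cabs (f w - f z) <= (M + e) * 1 * L.
  apply: le_trans H _; rewrite mulr1 mulrDl lerD2l /e mulrAC ler_pdivrMr; last lra.
  by rewrite ler_pM2l //; lra.
have := @real_induction R (fun t => cabs (f (seg z w t) - f z) <= (M + e) * t * L).
rewrite /= => /(_ _ _ 1 _); rewrite seg1; apply; last lra.
  by rewrite seg0 subrr cabs0 mulr0 mul0r.
move=> t ht; have /hasdP/(_ _ e_gt0)[r r0 hr] := hf _ ht.
have close s : 0 <= s <= 1 -> `|s - t| < r / (L + 1) ->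
    cabs (f (seg z w s) - f (seg z w t)) <= (M + e) * `|s - t| * L.
  move=> hs hst.
  have hd : cabs (seg z w s - seg z w t) < r.
    rewrite segB -/L; apply: le_lt_trans (_ : `|s - t| * (L + 1) < _).
      by rewrite ler_wpM2l //; lra.
    by rewrite -ltr_pdivlMr //; lra.
  have := hr _ hd; rewrite (_ : seg z w t + _ = seg z w s); last by ring.
  move=> h; rewrite -[X in cabs X](subrK ((seg z w s - seg z w t) * df (seg z w t))).
  apply: le_trans (cabsD _ _) _.
  have -> : (M + e) * `|s - t| * L = e * (`|s - t| * L) + `|s - t| * L * M by ring.
  apply: lerD; first by rewrite -segB.
  rewrite cabsM segB -/L; apply: ler_wpM2l; last exact: hM.
  by rewrite mulr_ge0.
exists (r / (L + 1)); first by rewrite divr_gt0 //; lra.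
move=> s s' s0 s1 h1 h2 h3 h4 hs.
have ts' : `|s' - t| = s' - t by rewrite ger0_norm; lra.
have ts : `|s - t| = t - s by rewrite ler0_norm; lra.
have k1 := close s' ltac:(lra) ltac:(rewrite ts'; lra).
have k2 := close s ltac:(lra) ltac:(rewrite ts; lra).
move: k1 k2; rewrite ts ts' cabsC => k1 k2.
rewrite (_ : f (seg z w s') - f z = (f (seg z w s') - f (seg z w t)) +
  (f (seg z w t) - f (seg z w s)) + (f (seg z w s) - f z)); last by ring.
apply: le_trans (cabsD _ _) _.
have := cabsD (f (seg z w s') - f (seg z w t)) (f (seg z w t) - f (seg z w s)).
rewrite [cabs (f (seg z w s') - _)]cabsC.
move: k1 k2 hs; rewrite [cabs (f (seg z w s) - f (seg z w t))]cabsC.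
have -> : (M + e) * s' * L = (M + e) * (s' - t) * L + (M + e) * (t - s) * L + (M + e) * s * L by ring.
lra.
Qed.

End MeanValue.

Section LinearSystems.
Variable R : realType.
Local Notation C := (Cplx R).

(** Open and convex regions are predicates with explicit radii, like [cont]. *)
Definition openC (D : C -> Prop) := forall z, D z ->
  exists2 r : R, 0 < r & forall w, cabs (w - z) < r -> D w.
Definition convexC (D : C -> Prop) := forall z w, D z -> D w ->
  forall t, 0 <= t <= 1 -> D (seg z w t).

(** Matrix solutions on D of the linear system Y' = a Y, columns being vector
solutions. *)
Definition sol (a : C -> 'M[C]_3) k (D : C -> Prop) (Y : C -> 'M[C]_(3, k)) :=
  forall z, D z -> forall i j, hasd (fun w => Y w i j) z ((a z *m Y z) i j).
Definition contmx (a : C -> 'M[C]_3) (D : C -> Prop) :=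
  forall z, D z -> forall i j, cont (fun w => a w i j) z.

Lemma sol_sub a k (D D' : C -> Prop) (Y : C -> 'M[C]_(3, k)) :
  (forall z, D' z -> D z) -> sol a D Y -> sol a D' Y.
Proof. by move=> s h z /s /h. Qed.

Lemma sol_mulr a k l D (Y : C -> 'M[C]_(3, k)) (c : 'M[C]_(k, l)) :
  sol a D Y -> sol a D (fun z => Y z *m c).
Proof.
move=> h z Dz i j; rewrite mulmxA mxE.
apply: (@hasd_ext _ (fun w => \sum_m Y w i m * c m j)) => [w|]; first by rewrite mxE.
apply: hasd_sum => m; apply: (@hasd_ext _ (fun w => c m j * Y w i m)) => [w|].
  by rewrite mulrC.
by rewrite mulrC; apply: hasdZ; exact: (h z Dz).
Qed.

Lemma sol_sub_mx a k D (Y Y' : C -> 'M[C]_(3, k)) :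
  sol a D Y -> sol a D Y' -> sol a D (fun z => Y z - Y' z).
Proof.
move=> h h' z Dz i j; rewrite mulmxBr mxE.
apply: (@hasd_ext _ (fun w => Y w i j + -1 * Y' w i j)) => [w|]; first by rewrite !mxE mulN1r.
rewrite (_ : (- (a z *m Y' z)) i j = -1 * (a z *m Y' z) i j); last by rewrite mxE mulN1r.
apply: hasdD; [exact: (h z Dz) | apply: hasdZ; exact: (h' z Dz)].
Qed.

Lemma eventually_forall (T : finType) (P : T -> C -> Prop) z :
  (forall i, exists2 r : R, 0 < r & forall w, cabs (w - z) < r -> P i w) ->
  exists2 r : R, 0 < r & forall w, cabs (w - z) < r -> forall i, P i w.
Proof.
move=> h; suff [r r0 hr] : exists2 r : R, 0 < r & forall w, cabs (w - z) < r ->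
    forall i, i \in enum T -> P i w.
  by exists r => // w hw i; apply: hr; rewrite ?mem_enum.
elim: (enum T) => [|i s [r r0 hr]]; first by exists 1.
have [r' r'0 hr'] := h i; exists (Num.min r r'); first by rewrite lt_min r0 r'0.
move=> w; rewrite lt_min => /andP[h1 h2] j; rewrite inE => /orP[/eqP ->|hj]; first exact: hr'.
exact: hr.
Qed.

(** Picard's argument read backwards: on a ball of radius 1/(6(K+1)), where K bounds the
coefficients, the mean value inequality improves a bound on a solution that
vanishes at the centre by a factor 1/2, hence by all powers of 1/2. *)
Lemma uniq_local a k D (Y : C -> 'M[C]_(3, k)) z0 :
  openC D -> contmx a D -> sol a D Y -> D z0 -> Y z0 = 0 ->
  exists2 r : R, 0 < r & forall w, cabs (w - z0) < r -> Y w = 0.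
Proof.
move=> oD ca sY Dz0 Y0.
(* a bound for the coefficients near z0, by continuity *)
pose K : R := \sum_i \sum_j (cabs (a z0 i j) + 1).
have K0 : 0 <= K by apply: sumr_ge0 => i _; apply: sumr_ge0 => j _; have := cabs_ge0 (a z0 i j); lra.
have [r1 r10 hr1] := oD _ Dz0.
have [r2 r20 hr2] : exists2 r : R, 0 < r & forall w, cabs (w - z0) < r ->
    forall ij : 'I_3 * 'I_3, cabs (a w ij.1 ij.2) <= K.
  apply: eventually_forall => -[i j] /=.
  have [r r0 hr] := ca _ Dz0 i j _ ltr01; exists r => // w /hr h.
  have -> : a w i j = (a w i j - a z0 i j) + a z0 i j by ring.
  apply: le_trans (cabsD _ _) _.
  apply: le_trans (_ : cabs (a z0 i j) + 1 <= _); first lra.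
  rewrite /K (bigD1 i) //= (bigD1 j) //= -addrA lerDl addr_ge0 //; apply: sumr_ge0 => m _.
    by have := cabs_ge0 (a z0 i m); lra.
  by apply: sumr_ge0 => l _; have := cabs_ge0 (a z0 m l); lra.
have [r3 r30 hr3] : exists2 r : R, 0 < r & forall w, cabs (w - z0) < r ->
    forall ij : 'I_3 * 'I_k, cabs (Y w ij.1 ij.2) <= 1.
  apply: eventually_forall => -[i j] /=.
  have [r r0 hr] := hasd_cont (sY _ Dz0 i j) ltr01; exists r => // w /hr.
  by rewrite Y0 mxE subr0 => /ltW.
pose r := Num.min (Num.min r1 r2) (Num.min r3 ((6 * (K + 1))^-1)).
have r0 : 0 < r by rewrite /r !lt_min r10 r20 r30 invr_gt0 /=; lra.
have rlt w : cabs (w - z0) < r -> [/\ cabs (w - z0) < r1, cabs (w - z0) < r2,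
    cabs (w - z0) < r3 & cabs (w - z0) < (6 * (K + 1))^-1].
  by rewrite /r !lt_min => /andP[/andP[-> ->] /andP[-> ->]].
exists r => //.
have bound n : forall w, cabs (w - z0) < r -> forall i j, cabs (Y w i j) <= (2^-1) ^+ n.
  elim: n => [|n IH] w hw i j.
    by rewrite expr0; have [_ _ h _] := rlt _ hw; apply: (hr3 _ h (i, j)).
  have inr t : 0 <= t <= 1 -> cabs (seg z0 w t - z0) < r.
    move=> ht; rewrite -[X in _ - X](seg0 z0 w) segB subr0 ger0_norm; last lra.
    by apply: le_lt_trans hw; rewrite ler_piMl ?cabs_ge0 //; lra.
  have -> : Y w i j = Y w i j - Y z0 i j by rewrite Y0 mxE subr0.
  apply: le_trans (@mean_value _ (fun w => Y w i j) (fun w => (a w *m Y w) i j) z0 w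
     (3 * (K * 2^-1 ^+ n)) _ _) _.
  - by move=> t /inr/rlt[h _ _ _]; apply: (sY _ (hr1 _ h)).
  - move=> t ht; rewrite mxE; apply: le_trans (cabs_sum _) _.
    have [_ h2 _ _] := rlt _ (inr _ ht).
    apply: le_trans (_ : \sum_(l < 3) K * 2^-1 ^+ n <= _); last first.
      by rewrite sumr_const card_ord mulr_natl.
    apply: ler_sum => l _; rewrite cabsM; apply: ler_pM; rewrite ?cabs_ge0 //.
      exact: (hr2 _ h2 (i, l)).
    by apply: IH; exact: inr.
  have [_ _ _ h4] := rlt _ hw.
  have p0 : 0 <= (2^-1 : R) ^+ n by rewrite exprn_ge0 // invr_ge0.
  apply: le_trans (_ : 3 * (K * 2^-1 ^+ n) * (6 * (K + 1))^-1 <= _).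
    by apply: ler_wpM2l; [rewrite !mulr_ge0 | exact: ltW].
  rewrite ler_pdivrMr; last lra.
  rewrite exprS (_ : 2^-1 * _ * _ = (3 * (K + 1)) * 2^-1 ^+ n); last by field.
  by rewrite mulrA ler_wpM2r //; lra.
move=> w hw; apply/matrixP => i j; rewrite mxE; apply/eqP; rewrite -cabs_eq0.
have := cabs_ge0 (Y w i j); rewrite le_eqVlt => /orP[/eqP <- //|p].
have : (fun n : nat => (2^-1 : R) ^+ n) @ \oo --> (0 : R).
  by apply: cvg_expr; rewrite ger0_norm ?invr_ge0 //; rewrite invf_lt1 //; lra.
move/cvgrPdist_lt/(_ _ p) => -[n _ /(_ n (leqnn n))] /=.
rewrite sub0r normrN ger0_norm ?exprn_ge0 ?invr_ge0 // => h.
by have := bound n w hw i j; rewrite leNgt h.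
Qed.

(** The vanishing propagates from the initial point along the segment to z, by
convexity and local uniqueness. *)
Lemma uniq_zero a k D (Y : C -> 'M[C]_(3, k)) z0 z :
  openC D -> convexC D -> contmx a D -> sol a D Y -> D z0 -> Y z0 = 0 ->
  D z -> Y z = 0.
Proof.
move=> oD cD ca sY Dz0 Y0 Dz.
have := @locally_constant R (fun t => Y (seg z0 z t) = 0).
rewrite /= => /(_ _ _ 1 _); rewrite seg1; apply; [by rewrite seg0 | | lra].
move=> t ht; have Dt := cD _ _ Dz0 Dz _ ht.
pose L := cabs (z - z0).
have L0 : 0 <= L by exact: cabs_ge0.
suff [r r0 hr] : exists2 r : R, 0 < r & forall w w', cabs (w - seg z0 z t) < r ->
    cabs (w' - seg z0 z t) < r -> Y w = 0 -> Y w' = 0.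
  exists (r / (L + 1)); first by rewrite divr_gt0 //; lra.
  have close u : `|u - t| < r / (L + 1) -> cabs (seg z0 z u - seg z0 z t) < r.
    move=> h; rewrite segB -/L; apply: le_lt_trans (_ : `|u - t| * (L + 1) < _).
      by rewrite ler_wpM2l //; lra.
    by rewrite -ltr_pdivlMr //; lra.
  by move=> s s' _ _ /close h /close h'; exact: hr.
have [Yt|/eqP] := eqVneq (Y (seg z0 z t)) 0.
  have [r r0 hr] := uniq_local oD ca sY Dt Yt.
  by exists r => // w w' _ /hr.
move=> Yt; have [i [j hij]] : exists i, exists j, Y (seg z0 z t) i j != 0.
  apply: contrapT => H; apply: Yt; apply/matrixP => i j; rewrite mxE.
  by apply: contrapT => /eqP h; apply: H; exists i, j.
have p : 0 < cabs (Y (seg z0 z t) i j) by rewrite cabs_gt0.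
have [r r0 hr] := hasd_cont (sY _ Dt i j) p.
exists r => // w w' /hr + _ Yw; by rewrite Yw mxE sub0r cabsN ltxx.
Qed.

Lemma uniq_sol a k D (Y Y' : C -> 'M[C]_(3, k)) z0 z :
  openC D -> convexC D -> contmx a D -> sol a D Y -> sol a D Y' ->
  D z0 -> Y z0 = Y' z0 -> D z -> Y z = Y' z.
Proof.
move=> oD cD ca sY sY' D0 e0 Dz; apply/eqP; rewrite -subr_eq0; apply/eqP.
apply: (uniq_zero oD cD ca (sol_sub_mx sY sY') D0 _ Dz).
by rewrite e0 subrr.
Qed.

End LinearSystems.

(** * Power series *)

Section PowerSeries.
Variable R : realType.
Local Notation C := (Cplx R).
Implicit Types (x y c d : nat -> C) (u : C) (r s : R).

Lemma half_gt0 (e : R) : 0 < e -> 0 < e / 2.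
Proof. by move=> e0; rewrite divr_gt0. Qed.

Definition tends x (l : C) := forall e : R, 0 < e ->
  exists N, forall n, (N <= n)%N -> cabs (x n - l) < e.

Lemma tends_uniq x l l' : tends x l -> tends x l' -> l = l'.
Proof.
move=> h h'; apply/eqP; rewrite -subr_eq0 -cabs_eq0 eq_le cabs_ge0 andbT.
apply/ler_addgt0Pr => e e0; rewrite add0r.
have [N hN] := h _ (half_gt0 e0).
have [N' hN'] := h' _ (half_gt0 e0).
have := hN _ (leq_maxl N N'); have := hN' _ (leq_maxr N N').
set m := maxn N N'; have -> : l - l' = (x m - l') - (x m - l) by ring.
by have := cabsB (x m - l') (x m - l); lra.
Qed.

Lemma tends_cst (l : C) : tends (fun=> l) l.
Proof. by move=> e e0; exists 0 => n _; rewrite subrr cabs0. Qed.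

Lemma tendsD x y l l' : tends x l -> tends y l' -> tends (fun n => x n + y n) (l + l').
Proof.
move=> h h' e e0.
have [N hN] := h _ (half_gt0 e0).
have [N' hN'] := h' _ (half_gt0 e0).
exists (maxn N N') => n; rewrite geq_max => /andP[/hN h1 /hN' h2].
have -> : x n + y n - (l + l') = (x n - l) + (y n - l') by ring.
by have := cabsD (x n - l) (y n - l'); lra.
Qed.

Lemma tendsZ (a : C) x l : tends x l -> tends (fun n => a * x n) (a * l).
Proof.
move=> h e e0.
have p : 0 < cabs a + 1 by have := cabs_ge0 a; lra.
have [N hN] := h _ (divr_gt0 e0 p); exists N => n /hN k.
rewrite -mulrBr cabsM; apply: le_lt_trans (_ : (cabs a + 1) * cabs (x n - l) < _).
  by rewrite ler_wpM2r ?cabs_ge0 //; lra.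
by rewrite mulrC -ltr_pdivlMr.
Qed.

Lemma tendsS x l : tends x l -> tends (fun n => x n.+1) l.
Proof. by move=> h e /h[N hN]; exists N => n hn; apply: hN; exact: leqW. Qed.

Lemma tendsS_inv x l : tends (fun n => x n.+1) l -> tends x l.
Proof. by move=> h e /h[N hN]; exists N.+1 => -[|n] // hn; apply: hN. Qed.

Lemma tends_ext x y l : x =1 y -> tends x l -> tends y l.
Proof. by move=> xy h e /h[N hN]; exists N => n /hN; rewrite xy. Qed.

Lemma tends_bound x l (B : R) : (forall n, cabs (x n) <= B) -> tends x l -> cabs l <= B.
Proof.
move=> hB h; apply/ler_addgt0Pr => e /h[N /(_ _ (leqnn N)) hN].
have -> : l = x N - (x N - l) by ring.
by have := cabsB (x N) (x N - l); have := hB N; lra.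
Qed.

(** The radius of convergence of the series with coefficients c is at least r: the
terms are bounded on every smaller circle. *)
Definition pbound r c := forall s, 0 <= s -> s < r ->
  exists M : R, forall n, cabs (c n) * s ^+ n <= M.

Definition psum c u n := \sum_(k < n) c k * u ^+ k.
(** The real and imaginary parts are summed separately, which reduces convergence to
that of real series. *)
Definition ps c u : C :=
  limn (fun n => re (psum c u n)) +i* limn (fun n => im (psum c u n)).

Lemma geom_sum (a : R) n : 0 <= a < 1 -> \sum_(k < n) a ^+ k <= (1 - a)^-1.
Proof.
move=> ha; have p : 0 < 1 - a by lra.
suff -> : \sum_(k < n) a ^+ k = (1 - a ^+ n) / (1 - a).
  by rewrite ler_pdivrMr // mulVf ?gt_eqF // lerBlDr lerDl exprn_ge0; lra.
apply: (mulIf (lt0r_neq0 p)); rewrite divfK ?gt_eqF //.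
elim: n => [|n IH]; first by rewrite big_ord0 expr0 mul0r subrr.
by rewrite big_ord_recr /= mulrDl IH exprS; ring.
Qed.

(** Comparison with a geometric series: on the circle of radius s the terms are
dominated by those on a circle half way to r. *)
Lemma pbound_sum r c s : pbound r c -> 0 <= s -> s < r ->
  exists B : R, forall n, \sum_(k < n) cabs (c k) * s ^+ k <= B.
Proof.
move=> hc s0 sr; pose t := (s + r) / 2.
have [M hM] := hc t ltac:(rewrite /t; lra) ltac:(rewrite /t; lra).
have t0 : 0 < t by rewrite /t; lra.
pose a := s / t; have ha : 0 <= a < 1.
  by rewrite /a divr_ge0 ?(ltW t0) //= ltr_pdivrMr // mul1r /t; lra.
exists (M * (1 - a)^-1) => n.
apply: le_trans (_ : M * \sum_(k < n) a ^+ k <= _); last first.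
  apply: ler_wpM2l; last exact: geom_sum.
  by apply: le_trans (hM 0); rewrite mulr_ge0 ?cabs_ge0 ?exprn_ge0 // ltW.
rewrite mulr_sumr; apply: ler_sum => k _.
have -> : s = t * a by rewrite /a mulrC divfK // gt_eqF.
rewrite exprMn mulrA; apply: ler_wpM2r; last exact: hM.
by rewrite exprn_ge0 //; lra.
Qed.

Lemma real_abs_cvg (f : nat -> R) (B : R) :
  (forall n, \sum_(k < n) `|f k| <= B) -> cvgn (fun n => \sum_(k < n) f k).
Proof.
move=> hB.
have -> : (fun n => \sum_(k < n) f k) = series f.
  by rewrite seriesEord.
have E n : [normed series f] n = \sum_(k < n) `|f k|.
  by rewrite -[LHS]/(\sum_(0 <= k < n) `|f k|) big_mkord.
apply: normed_cvg; apply: nondecreasing_is_cvgn.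
  apply/nondecreasing_seqP => n; rewrite !E big_ord_recr /= lerDl.
  exact: normr_ge0.
by exists B => _ [n _ <-]; rewrite E.
Qed.

(** Absolute convergence of the real and of the imaginary parts. *)
Lemma ps_tends r c u : pbound r c -> cabs u < r -> tends (psum c u) (ps c u).
Proof.
move=> hc hu e e0.
have [B hB] := pbound_sum hc (cabs_ge0 u) hu.
have cre : cvgn (fun n => re (psum c u n)).
  have -> : (fun n => re (psum c u n)) = (fun n => \sum_(k < n) re (c k * u ^+ k)).
    apply/funext => n; rewrite /psum; elim/big_ind2: _ => // a b a' b' <- <-; exact: reD.
  apply: (@real_abs_cvg (fun k => re (c k * u ^+ k)) B) => n; apply: le_trans (hB n); apply: ler_sum => k _.
  by rewrite -cabsX -cabsM cabs_re.
have cim : cvgn (fun n => im (psum c u n)).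
  have -> : (fun n => im (psum c u n)) = (fun n => \sum_(k < n) im (c k * u ^+ k)).
    apply/funext => n; rewrite /psum; elim/big_ind2: _ => // a b a' b' <- <-; exact: imD.
  apply: (@real_abs_cvg (fun k => im (c k * u ^+ k)) B) => n; apply: le_trans (hB n); apply: ler_sum => k _.
  by rewrite -cabsX -cabsM cabs_im.
have e2 : 0 < e / 2 by rewrite divr_gt0.
have /cvgrPdist_lt/(_ _ e2)[N1 _ h1] := cre.
have /cvgrPdist_lt/(_ _ e2)[N2 _ h2] := cim.
exists (maxn N1 N2) => n; rewrite geq_max => /andP[/h1 /= k1 /h2 /= k2].
rewrite cabsC; apply: le_lt_trans (cabs_reim _) _.
rewrite reB imB /ps re_cplx im_cplx; lra.
Qed.

Lemma psD r c d u : pbound r c -> pbound r d -> cabs u < r ->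
  ps (fun n => c n + d n) u = ps c u + ps d u.
Proof.
move=> hc hd hu.
have hcd : pbound r (fun n => c n + d n).
  move=> s s0 sr; have [M hM] := hc _ s0 sr; have [M' hM'] := hd _ s0 sr.
  exists (M + M') => n; apply: le_trans (lerD (hM n) (hM' n)).
  by rewrite -mulrDl ler_wpM2r ?cabsD ?exprn_ge0.
apply: tends_uniq (ps_tends hcd hu) _.
apply: tends_ext (tendsD (ps_tends hc hu) (ps_tends hd hu)) => n.
by rewrite /psum -big_split; apply: eq_bigr => k _ /=; rewrite mulrDl.
Qed.

Lemma pboundD r c d : pbound r c -> pbound r d -> pbound r (fun n => c n + d n).
Proof.
move=> hc hd s s0 sr; have [M hM] := hc _ s0 sr; have [M' hM'] := hd _ s0 sr.
exists (M + M') => n; apply: le_trans (lerD (hM n) (hM' n)).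
by rewrite -mulrDl ler_wpM2r ?cabsD ?exprn_ge0.
Qed.

Lemma pboundZ r (a : C) c : pbound r c -> pbound r (fun n => a * c n).
Proof.
move=> hc s s0 sr; have [M hM] := hc _ s0 sr.
by exists (cabs a * M) => n; rewrite cabsM -mulrA ler_wpM2l ?cabs_ge0.
Qed.

Lemma pbound0 r : pbound r (fun=> 0).
Proof. by move=> s s0 sr; exists 0 => n; rewrite cabs0 mul0r. Qed.

Lemma pbound_sumf r m (F : 'I_m -> nat -> C) :
  (forall i, pbound r (F i)) -> pbound r (fun n => \sum_i F i n).
Proof.
elim: m F => [|m IH] F h.
  by rewrite (_ : (fun n => _) = fun=> 0); [exact: pbound0 | apply/funext => n; rewrite big_ord0].
rewrite (_ : (fun n => _) = fun n => F ord0 n + \sum_(i < m) F (lift ord0 i) n).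
  by apply: pboundD => //; exact: IH.
by apply/funext => n; rewrite big_ord_recl.
Qed.

Lemma psZ r (a : C) c u : pbound r c -> cabs u < r -> ps (fun n => a * c n) u = a * ps c u.
Proof.
move=> hc hu; apply: tends_uniq (ps_tends (pboundZ a hc) hu) _.
apply: tends_ext (tendsZ a (ps_tends hc hu)) => n.
by rewrite /psum mulr_sumr; apply: eq_bigr => k _ /=; rewrite mulrA.
Qed.

Lemma ps0 u : ps (fun=> 0) u = 0.
Proof.
apply: (tends_uniq (ps_tends (pbound0 (r := cabs u + 1)) _)); first lra.
by apply: tends_ext (tends_cst 0) => n; rewrite /psum big1 // => k _; rewrite mul0r.
Qed.

Lemma ps_sum r m (F : 'I_m -> nat -> C) u : (forall i, pbound r (F i)) -> cabs u < r ->
  ps (fun n => \sum_i F i n) u = \sum_i ps (F i) u.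
Proof.
move=> + hu; elim: m F => [|m IH] F h.
  by rewrite big_ord0 -[RHS](ps0 u); congr (ps _ u); apply/funext => n; rewrite big_ord0.
rewrite big_ord_recl -IH // -(psD (h ord0) _ hu); last by apply: pbound_sumf.
by congr (ps _ u); apply/funext => n; rewrite big_ord_recl.
Qed.

Lemma pboundS r c : pbound r c -> pbound r (fun n => c n.+1).
Proof.
move=> hc s s0 sr; pose t := (s + r) / 2.
have [M hM] := hc t ltac:(rewrite /t; lra) ltac:(rewrite /t; lra).
have t0 : 0 < t by rewrite /t; lra.
exists (M / t) => n; rewrite ler_pdivlMr // -mulrA; apply: le_trans (hM n.+1).
rewrite exprSr; apply: ler_wpM2l; first exact: cabs_ge0.
apply: ler_wpM2r; first exact: ltW.
by apply: lerXn2r; rewrite ?nnegrE ?(ltW t0) //; rewrite /t; lra.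
Qed.

Lemma ps_shift r c u : pbound r c -> cabs u < r ->
  ps c u = c 0 + u * ps (fun n => c n.+1) u.
Proof.
move=> hc hu; apply: tends_uniq (tendsS (ps_tends hc hu)) _.
apply: tends_ext (tendsD (tends_cst (c 0)) (tendsZ u (ps_tends (pboundS hc) hu))) => n.
rewrite /psum big_ord_recl expr0 mulr1 mulr_sumr; congr (_ + _).
by apply: eq_bigr => k _ /=; rewrite exprS; ring.
Qed.

Lemma ps_at0 r c : 0 < r -> pbound r c -> ps c 0 = c 0.
Proof. by move=> r0 hc; rewrite (ps_shift hc) ?cabs0 // mul0r addr0. Qed.

Lemma nat_geom (a : R) n : 0 <= a < 1 -> n%:R * a ^+ n <= (1 - a)^-1.
Proof.
move=> ha; apply: le_trans (geom_sum n ha).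
rewrite -[n in n%:R]card_ord mulr_natl -sumr_const; apply: ler_sum => k _.
by rewrite ler_wiXn2l //; [lra | lra | exact: ltnW].
Qed.

Lemma pbound_nat r c : pbound r c -> pbound r (fun n => n%:R * c n).
Proof.
move=> hc s s0 sr; pose t := (s + r) / 2.
have [M hM] := hc t ltac:(rewrite /t; lra) ltac:(rewrite /t; lra).
have t0 : 0 < t by rewrite /t; lra.
pose a := s / t; have ha : 0 <= a < 1.
  by rewrite /a divr_ge0 ?(ltW t0) //= ltr_pdivrMr // mul1r /t; lra.
exists (M * (1 - a)^-1) => n.
have -> : s = t * a by rewrite /a mulrC divfK // gt_eqF.
rewrite cabsM cabs_nat exprMn (_ : _ * _ = (cabs (c n) * t ^+ n) * (n%:R * a ^+ n)); last ring.
apply: ler_pM => //; last exact: nat_geom.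
- by rewrite mulr_ge0 ?cabs_ge0 ?exprn_ge0 // ltW.
- by rewrite mulr_ge0 ?exprn_ge0 //; lra.
Qed.

Definition pderiv c := fun n => n.+1%:R * c n.+1.

Lemma pbound_deriv r c : pbound r c -> pbound r (pderiv c).
Proof. by move=> /pbound_nat/pboundS. Qed.

Lemma ps_euler r c u : pbound r c -> cabs u < r ->
  u * ps (pderiv c) u = ps (fun n => n%:R * c n) u.
Proof.
by move=> hc hu; rewrite [RHS](ps_shift (pbound_nat hc) hu) mul0r add0r.
Qed.

(** The quadratic Taylor remainder of a power. The factor s^2 on the left replaces the
exponent n - 2 on the right, which would be truncated. *)
Lemma taylor_rem (u h : C) (s : R) n : 0 < s -> cabs u <= s -> cabs (u + h) <= s ->
  cabs ((u + h) ^+ n - u ^+ n - h * (n%:R * u ^+ n.-1)) * s ^+ 2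
    <= n%:R ^+ 2 * cabs h ^+ 2 * s ^+ n.
Proof.
move=> s0 us uhs; elim: n => [|n IH].
  by rewrite !expr0 mul0r mulr0 subrr subr0 cabs0 mul0r expr0n /= !mul0r.
have -> : (u + h) ^+ n.+1 - u ^+ n.+1 - h * (n.+1%:R * u ^+ n.+1.-1) =
  (u + h) * ((u + h) ^+ n - u ^+ n - h * (n%:R * u ^+ n.-1)) + n%:R * h ^+ 2 * u ^+ n.-1.
  rewrite succnK -natr1; case: n {IH} => [|n]; first by rewrite !expr0 !expr1; ring.
  by rewrite succnK !exprS; ring.
have h1 : cabs (n%:R * h ^+ 2 * u ^+ n.-1) * s ^+ 2 <= n%:R * cabs h ^+ 2 * s ^+ n.+1.
  case: n {IH} => [|n]; first by rewrite !mul0r cabs0 mul0r.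
  rewrite succnK 2!cabsM cabs_nat !cabsX (_ : s ^+ n.+2 = s ^+ n * s ^+ 2); last by rewrite -exprD addn2.
  rewrite mulrA ler_wpM2r ?exprn_ge0 ?(ltW s0) // ler_wpM2l ?mulr_ge0 ?exprn_ge0 ?cabs_ge0 //.
  by apply: lerXn2r; rewrite ?nnegrE ?cabs_ge0 // ltW.
apply: le_trans (_ : cabs (u + h) * (cabs ((u + h) ^+ n - u ^+ n - h * (n%:R * u ^+ n.-1)) * s ^+ 2)
   + n%:R * cabs h ^+ 2 * s ^+ n.+1 <= _).
  apply: le_trans (lerD (lexx _) h1).
  by rewrite [cabs (u + h) * (_ * _)]mulrA -cabsM -mulrDl ler_wpM2r ?cabsD // exprn_ge0 // ltW.
apply: le_trans (_ : s * (n%:R ^+ 2 * cabs h ^+ 2 * s ^+ n) + n%:R * cabs h ^+ 2 * s ^+ n.+1 <= _).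
  by rewrite lerD2r ler_pM // ?cabs_ge0 // mulr_ge0 ?cabs_ge0 // exprn_ge0 // ltW.
have q : 0 <= cabs h ^+ 2 * s ^+ n.+1 by rewrite mulr_ge0 ?exprn_ge0 ?cabs_ge0 // ltW.
have -> : s * (n%:R ^+ 2 * cabs h ^+ 2 * s ^+ n) + n%:R * cabs h ^+ 2 * s ^+ n.+1 =
  (n%:R ^+ 2 + n%:R) * (cabs h ^+ 2 * s ^+ n.+1) by rewrite [s ^+ n.+1]exprS; ring.
rewrite -[X in _ <= X]mulrA; apply: ler_wpM2r => //.
by rewrite -natr1; have : (0 : R) <= n%:R by []; nra.
Qed.

(** Termwise differentiation: the Taylor remainders of the monomials sum to a multiple
of h^2, the coefficients n^2 being absorbed by a slightly larger radius. *)
Lemma ps_hasd r c u : pbound r c -> cabs u < r -> hasd (ps c) u (ps (pderiv c) u).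
Proof.
move=> hc hu; pose s := (cabs u + r) / 2.
have us : cabs u < s by rewrite /s; lra.
have sr : s < r by rewrite /s; lra.
have s0 : 0 < s by apply: le_lt_trans us; exact: cabs_ge0.
have [B hB] := pbound_sum (pbound_nat (pbound_nat hc)) (ltW s0) sr.
have B0 : 0 <= B by have := hB 0%N; rewrite big_ord0.
have key h : cabs h < s - cabs u ->
    cabs (ps c (u + h) - ps c u - h * ps (pderiv c) u) * s ^+ 2 <= cabs h ^+ 2 * B.
  move=> hh.
  have uhs : cabs (u + h) < s by have := cabsD u h; lra.
  rewrite -ler_pdivlMr ?exprn_gt0 //.
  apply: (@tends_bound (fun n => \sum_(k < n) c k * ((u + h) ^+ k - u ^+ k - h * (k%:R * u ^+ k.-1)))).
    move=> n; rewrite ler_pdivlMr ?exprn_gt0 //.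
    apply: le_trans (_ : (\sum_(k < n) cabs (c k) *
       cabs ((u + h) ^+ k - u ^+ k - h * (k%:R * u ^+ k.-1))) * s ^+ 2 <= _).
      rewrite ler_wpM2r ?exprn_ge0 ?(ltW s0) //; apply: le_trans (cabs_sum _) _.
      by apply: ler_sum => k _; rewrite cabsM.
    apply: le_trans (_ : cabs h ^+ 2 * \sum_(k < n) cabs (k%:R * (k%:R * c k)) * s ^+ k <= _); last first.
      by apply: ler_wpM2l; rewrite ?exprn_ge0 ?cabs_ge0.
    rewrite mulr_suml mulr_sumr; apply: ler_sum => k _.
    rewrite 2!cabsM cabs_nat -mulrA.
    apply: le_trans (ler_wpM2l (cabs_ge0 _) (taylor_rem k s0 (ltW us) (ltW uhs))) _.
    by rewrite le_eqVlt; apply/orP; left; apply/eqP; ring.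
  have td : tends (fun n => \sum_(k < n) c k * (k%:R * u ^+ k.-1)) (ps (pderiv c) u).
    apply: tendsS_inv; apply: tends_ext (ps_tends (pbound_deriv hc) hu) => n.
    rewrite /psum big_ord_recl /= mul0r mulr0 add0r; apply: eq_bigr => k _.
    by rewrite /pderiv /bump /= add1n; ring.
  have E (a b k l : C) : a - b - k * l = a + -1 * b + - k * l by ring.
  rewrite E.
  have := tendsD (tendsD (ps_tends hc (lt_trans uhs sr)) (tendsZ (-1) (ps_tends hc hu)))
     (tendsZ (- h) td).
  apply: tends_ext => n; rewrite /psum !mulr_sumr -!big_split /=.
  by apply: eq_bigr => k _; ring.
apply/hasdP => e e0.
exists (Num.min (s - cabs u) (e * s ^+ 2 / (B + 1))).
  have B1 : 0 < B + 1 by lra.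
  by rewrite lt_min subr_gt0 us /= divr_gt0 // mulr_gt0 // exprn_gt0.
move=> h; rewrite lt_min => /andP[/key k1 k2].
rewrite -(ler_pM2r (exprn_gt0 2 s0)); apply: le_trans k1 _.
rewrite ltr_pdivlMr in k2; last lra.
have := ler_wpM2l (cabs_ge0 h) (ltW k2); have := sqr_ge0 (cabs h).
rewrite !expr2; lra.
Qed.

End PowerSeries.

(** * Frobenius' method *)

Section MatrixNorm.
Variable R : realType.
Local Notation C := (Cplx R).

(** Any norm compatible with products serves here; the sum of the absolute values of
the entries is the simplest one. *)
Definition nrm m n (A : 'M[C]_(m, n)) : R := \sum_i \sum_j cabs (A i j).

Lemma nrm_ge0 m n (A : 'M[C]_(m, n)) : 0 <= nrm A.
Proof. by do 2! (apply: sumr_ge0 => ? _); exact: cabs_ge0. Qed.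

Lemma cabs_nrm m n (A : 'M[C]_(m, n)) i j : cabs (A i j) <= nrm A.
Proof.
rewrite /nrm (bigD1 i) //= (bigD1 j) //= -addrA lerDl addr_ge0 //.
  by apply: sumr_ge0 => ? _; exact: cabs_ge0.
by do 2! (apply: sumr_ge0 => ? _); exact: cabs_ge0.
Qed.

Lemma nrmD m n (A B : 'M[C]_(m, n)) : nrm (A + B) <= nrm A + nrm B.
Proof.
rewrite /nrm -big_split; apply: ler_sum => i _; rewrite -big_split; apply: ler_sum => j _.
by rewrite mxE cabsD.
Qed.

Lemma nrmZ m n a (A : 'M[C]_(m, n)) : nrm (a *: A) = cabs a * nrm A.
Proof.
rewrite /nrm mulr_sumr; apply: eq_bigr => i _; rewrite mulr_sumr; apply: eq_bigr => j _.
by rewrite mxE cabsM.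
Qed.

Lemma nrmM m n p (A : 'M[C]_(m, n)) (B : 'M[C]_(n, p)) : nrm (A *m B) <= nrm A * nrm B.
Proof.
rewrite {1 2}/nrm mulr_suml; apply: ler_sum => i _.
apply: le_trans (_ : \sum_j \sum_l cabs (A i l) * cabs (B l j) <= _).
  by apply: ler_sum => j _; rewrite mxE; apply: le_trans (cabs_sum _) _;
     apply: ler_sum => l _; rewrite cabsM.
rewrite exchange_big mulr_suml; apply: ler_sum => l _ /=.
rewrite -mulr_sumr ler_wpM2l ?cabs_ge0 // /nrm (bigD1 l) //= lerDl.
by do 2! (apply: sumr_ge0 => ? _); exact: cabs_ge0.
Qed.

End MatrixNorm.

Section Frobenius.
Variable R : realType.
Local Notation C := (Cplx R).
Variable k : nat.
Implicit Types (F G : nat -> 'M[C]_(3, k)) (r : R) (u : C).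

Definition pbm r F := forall i j, pbound r (fun n => F n i j).
Definition psm F u : 'M[C]_(3, k) := \matrix_(i, j) ps (fun n => F n i j) u.

Lemma pbmM r F (A : 'M[C]_3) : pbm r F -> pbm r (fun n => A *m F n).
Proof.
move=> h i j; rewrite (_ : (fun n => _) = fun n => \sum_l A i l * F n l j).
  by apply: pbound_sumf => l; apply: pboundZ.
by apply/funext => n; rewrite mxE.
Qed.

Lemma pbmD r F G : pbm r F -> pbm r G -> pbm r (fun n => F n + G n).
Proof.
move=> h h' i j; rewrite (_ : (fun n => _) = fun n => F n i j + G n i j).
  exact: pboundD.
by apply/funext => n; rewrite mxE.
Qed.

Lemma psmM r F (A : 'M[C]_3) u : pbm r F -> cabs u < r ->
  psm (fun n => A *m F n) u = A *m psm F u.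
Proof.
move=> h hu; apply/matrixP => i j; rewrite !mxE.
rewrite (_ : (fun n => _) = fun n => \sum_l A i l * F n l j); last first.
  by apply/funext => n; rewrite mxE.
rewrite (@ps_sum _ r) //; last by move=> l; exact: pboundZ.
by apply: eq_bigr => l _; rewrite (psZ _ (h l j)) // mxE.
Qed.

Lemma psmD r F G u : pbm r F -> pbm r G -> cabs u < r ->
  psm (fun n => F n + G n) u = psm F u + psm G u.
Proof.
move=> h h' hu; apply/matrixP => i j; rewrite !mxE.
rewrite (_ : (fun n => _) = fun n => F n i j + G n i j); last first.
  by apply/funext => n; rewrite mxE.
exact: psD (h i j) (h' i j) hu.
Qed.

Lemma psm_shift r F u : pbm r F -> cabs u < r ->
  psm F u = F 0%N + u *: psm (fun n => F n.+1) u.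
Proof.
move=> h hu; apply/matrixP => i j; rewrite !mxE.
exact: ps_shift (h i j) hu.
Qed.

Variables (N0 A1 A2 : 'M[C]_3) (q1 q2 : C) (r : R) (Y0 : 'M[C]_(3, k)).
Hypotheses (r0 : 0 < r) (hq1 : cabs q1 * r <= 1) (hq2 : cabs q2 * r <= 1).
Hypothesis NY0 : N0 *m Y0 = 0.
Hypothesis nonres : forall n, (n.+1%:R%:M - N0) \in unitmx.

(** The coefficients of a solution Y of u Y' = (N0 + q1 u/(1 - q1 u) A1 +
q2 u/(1 - q2 u) A2) Y. The convolutions of the coefficients of Y with the two
geometric series are carried along as the states U and V, which makes the
recursion first order. *)
Fixpoint frob n : 'M[C]_(3, k) * 'M[C]_(3, k) * 'M[C]_(3, k) :=
  if n is m.+1 then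
    let: (Y, U, V) := frob m in
    let U' := q1 *: (U + Y) in let V' := q2 *: (V + Y) in
    (invmx (m.+1%:R%:M - N0) *m (A1 *m U' + A2 *m V'), U', V')
  else (Y0, 0, 0).

Let Y n := (frob n).1.1.
Let U n := (frob n).1.2.
Let V n := (frob n).2.

Lemma frobU n : U n.+1 = q1 *: (U n + Y n).
Proof. by rewrite /U /Y /=; case: (frob n) => [[]]. Qed.
Lemma frobV n : V n.+1 = q2 *: (V n + Y n).
Proof. by rewrite /V /Y /=; case: (frob n) => [[]]. Qed.
Lemma frobY n : n%:R *: Y n = N0 *m Y n + (A1 *m U n + A2 *m V n).
Proof.
case: n => [|n]; first by rewrite scale0r NY0 /U /V /= !mulmx0 !addr0.
have E : (n.+1%:R%:M - N0) *m Y n.+1 = A1 *m U n.+1 + A2 *m V n.+1.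
  rewrite frobU frobV /Y /U /V /=; case: (frob n) => [[y u] v] /=.
  by rewrite mulKVmx.
by rewrite -E mulmxBl mul_scalar_mx addrC subrK.
Qed.

(** From some index on, n - N0 is large and dividing by it compensates the norms of A1
and A2. Before that index there are finitely many terms. The bound on Y is kept
smaller than that on U and V by a factor ep, so that U and V, which are multiplied
by a ratio at most 1 - ep, absorb it. *)
Lemma frob_bound s : 0 <= s -> s < r -> exists M : R, forall n,
  [/\ nrm (U n) * s ^+ n <= M, nrm (V n) * s ^+ n <= M & nrm (Y n) * s ^+ n <= M].
Proof.
(* th is the common bound of the ratios |q1| s and |q2| s, and ep = 1 - th *)
move=> s0 sr; pose th := s / r.
have th0 : 0 <= th by rewrite divr_ge0 // ltW.
have th1 : th < 1 by rewrite ltr_pdivrMr // mul1r.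
pose ep := 1 - th; have ep0 : 0 < ep by rewrite /ep; lra.
pose a0 := nrm N0; pose a1 := nrm A1; pose a2 := nrm A2.
have [a00 a10 a20] : [/\ 0 <= a0, 0 <= a1 & 0 <= a2] by split; exact: nrm_ge0.
have c0 : 0 <= a0 + (a1 + a2) / ep by apply: addr_ge0 => //; apply: divr_ge0 (ltW ep0); exact: addr_ge0.
pose n0 := Num.truncn (a0 + (a1 + a2) / ep).
pose w n := (nrm (U n) + nrm (V n) + nrm (Y n) / ep) * s ^+ n.
pose M := \sum_(i < n0.+1) w i.
have w0 n : 0 <= w n.
  by rewrite mulr_ge0 ?exprn_ge0 // !addr_ge0 ?nrm_ge0 // divr_ge0 ?nrm_ge0 // ltW.
have M0 : 0 <= M by apply: sumr_ge0 => i _.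
exists M.
suff H n : [/\ nrm (U n) * s ^+ n <= M, nrm (V n) * s ^+ n <= M & nrm (Y n) * s ^+ n <= ep * M].
  move=> n; have [h1 h2 h3] := H n; split=> //; apply: le_trans h3 _.
  by rewrite ler_piMl // /ep; lra.
have small m : (m <= n0)%N ->
   [/\ nrm (U m) * s ^+ m <= M, nrm (V m) * s ^+ m <= M & nrm (Y m) * s ^+ m <= ep * M].
  move=> hm.
  have wM : w m <= M.
    by rewrite /M (bigD1 (Ordinal (hm : (m < n0.+1)%N))) //= lerDl sumr_ge0.
  have sm : 0 <= s ^+ m by exact: exprn_ge0.
  have := mulr_ge0 (nrm_ge0 (U m)) sm; have := mulr_ge0 (nrm_ge0 (V m)) sm.
  have := mulr_ge0 (divr_ge0 (nrm_ge0 (Y m)) (ltW ep0)) sm.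
  have -> : nrm (Y m) * s ^+ m = ep * (nrm (Y m) / ep * s ^+ m).
    by field; exact: lt0r_neq0.
  move: wM; have -> : w m = nrm (U m) * s ^+ m + nrm (V m) * s ^+ m + nrm (Y m) / ep * s ^+ m.
    by rewrite /w; ring.
  move=> h1 h2 h3 h4; split; [lra | lra |].
  by rewrite ler_pM2l //; lra.
have qs (q : C) : cabs q * r <= 1 -> cabs q * s <= th.
  move=> hq; rewrite /th ler_pdivlMr // mulrAC.
  by rewrite ler_piMl.
elim: n => [|n [h1 h2 h3]]; first exact: small.
case: (leqP n.+1 n0) => hn; first exact: small.
have sn : 0 <= s ^+ n.+1 by exact: exprn_ge0.
have stepb (q : C) (X X' : 'M[C]_(3, k)) : cabs q * r <= 1 ->
    X' = q *: (X + Y n) -> nrm X * s ^+ n <= M -> nrm X' * s ^+ n.+1 <= M.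
  move=> /qs hq -> hX; rewrite nrmZ exprS.
  rewrite (_ : _ * _ = (cabs q * s) * (nrm (X + Y n) * s ^+ n)); last by ring.
  apply: le_trans (_ : th * (M + ep * M) <= _).
    apply: ler_pM => //; rewrite ?mulr_ge0 ?cabs_ge0 ?nrm_ge0 ?exprn_ge0 //.
    apply: le_trans (lerD hX h3); rewrite -mulrDl ler_wpM2r ?exprn_ge0 //.
    exact: nrmD.
  rewrite (_ : th * _ = (1 - ep ^+ 2) * M); last by rewrite /ep; ring.
  by rewrite ler_piMl // lerBlDr lerDl sqr_ge0.
have hU := stepb _ _ _ hq1 (frobU n) h1.
have hV := stepb _ _ _ hq2 (frobV n) h2.
split=> //.
have := congr1 (@nrm _ _ _) (frobY n.+1); rewrite nrmZ cabs_nat => E.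
have E1 : n.+1%:R * nrm (Y n.+1) <= a0 * nrm (Y n.+1) + (a1 * nrm (U n.+1) + a2 * nrm (V n.+1)).
  rewrite E; apply: le_trans (nrmD _ _) _; apply: lerD; first exact: nrmM.
  by apply: le_trans (nrmD _ _) _; apply: lerD; exact: nrmM.
have big : a0 + (a1 + a2) / ep <= n.+1%:R.
  have /andP[_ /ltW h] : (n0%:R <= a0 + (a1 + a2) / ep < n0.+1%:R).
    exact: truncn_itv.
  by apply: le_trans h _; rewrite ler_nat.
have y0 := mulr_ge0 (nrm_ge0 (Y n.+1)) sn.
have E2 : (n.+1%:R - a0) * (nrm (Y n.+1) * s ^+ n.+1) <= (a1 + a2) * M.
  apply: le_trans (_ : a1 * (nrm (U n.+1) * s ^+ n.+1) + a2 * (nrm (V n.+1) * s ^+ n.+1) <= _).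
    have := ler_wpM2r sn E1; lra.
  by have := ler_wpM2l a10 hU; have := ler_wpM2l a20 hV; lra.
have [a12|a12] := eqVneq (a1 + a2) 0.
  have U0 : nrm (Y n.+1) * s ^+ n.+1 = 0 \/ n.+1%:R = a0.
    move: E2 big; rewrite a12 !mul0r addr0 => e2 b.
    have [->|ne] := eqVneq (n.+1%:R : R) a0; first by right.
    left; apply/eqP; rewrite eq_le y0 andbT -(ler_pM2l (_ : 0 < n.+1%:R - a0)) ?mulr0 //.
    by rewrite subr_gt0 lt_def ne.
  case: U0 => [->|na]; first by rewrite mulr_ge0 // ltW.
  have := truncn_itv c0; rewrite -/n0 => /andP[_].
  by rewrite a12 mul0r addr0 -na ltr_nat ltnS leqNgt hn.
have a12' : 0 < a1 + a2 by rewrite lt_def a12 addr_ge0.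
rewrite -(ler_pM2l a12'); apply: le_trans (_ : ep * ((a1 + a2) * M) <= _); last by lra.
rewrite -ler_pdivrMl //; apply: le_trans E2.
rewrite mulrA; apply: ler_wpM2r => //; rewrite mulrC; lra.
Qed.

Lemma frob_pb : [/\ pbm r Y, pbm r U & pbm r V].
Proof.
by split=> i j s s0 sr; have [M hM] := frob_bound s0 sr; exists M => n;
  have [h1 h2 h3] := hM n; [apply: le_trans h3 | apply: le_trans h1 | apply: le_trans h2];
  apply: ler_wpM2r; rewrite ?exprn_ge0 ?cabs_nrm.
Qed.

Lemma frobenius_aux u : cabs u < r ->
  exists Y' : 'M[C]_(3, k), [/\ forall i j, hasd (fun w => psm Y w i j) u (Y' i j),
    u *: Y' = (N0 + (u * q1 / (1 - u * q1)) *: A1 + (u * q2 / (1 - u * q2)) *: A2) *m psm Y u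
    & u = 0 -> (1%:M - N0) *m Y' = (q1 *: A1 + q2 *: A2) *m Y0].
Proof.
move=> hu; have [pY pU pV] := frob_pb.
exists (\matrix_(i, j) ps (pderiv (fun n => Y n i j)) u); split.
- move=> i j; rewrite [X in hasd _ _ X]mxE; apply: hasd_ext (ps_hasd (pY i j) hu) => w.
  by rewrite mxE.
- have geo (q : C) (X : nat -> 'M[C]_(3, k)) : cabs q * r <= 1 -> pbm r X -> X 0%N = 0 ->
      (forall n, X n.+1 = q *: (X n + Y n)) -> psm X u = (u * q / (1 - u * q)) *: psm Y u.
    move=> hq pX X0 XS.
    have n1 : 1 - u * q != 0.
      apply/eqP => /eqP; rewrite subr_eq0 => /eqP h.
      have := cabs1 R; rewrite h cabsM; have := cabs_ge0 q; have := cabs_ge0 u.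
      by move=> h1 h2 h3; nra.
    have E : psm X u = u *: (q *: (psm X u + psm Y u)).
      rewrite {1}(psm_shift pX hu) X0 add0r -(psmD pX pY hu).
      rewrite -[q *: psm _ _]mul_scalar_mx -(psmM _ (pbmD pX pY) hu); congr (_ *: psm _ u).
      by apply/funext => n; rewrite XS mul_scalar_mx.
    apply: (scalerI n1); rewrite scalerA [_ * (_ / _)]mulrC divfK // scalerBl scale1r {1}E.
    by rewrite !scalerA scalerDr addrC addKr.
  rewrite 2!mulmxDl -!scalemxAl !scalemxAr.
  rewrite -(geo q1 U hq1 pU erefl frobU) -(geo q2 V hq2 pV erefl frobV).
  rewrite -(psmM _ pY hu) -(psmM _ pU hu) -(psmM _ pV hu).
  rewrite -(psmD (pbmM _ pY) (pbmM _ pU) hu) -(psmD (pbmD (pbmM _ pY) (pbmM _ pU)) (pbmM _ pV) hu).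
  apply/matrixP => i j; rewrite !mxE (ps_euler (pY i j) hu); congr (ps _ u).
  by apply/funext => n; have := congr1 (fun M : 'M[C]_(3, k) => M i j) (frobY n); rewrite addrA !mxE.
- move=> u0; have E : \matrix_(i, j) ps (pderiv (fun n => Y n i j)) u = Y 1%N.
    apply/matrixP => i j; rewrite mxE u0 (ps_at0 r0 (pbound_deriv (pY i j))).
    by rewrite /pderiv mul1r.
  have Y1 : Y 1%N = N0 *m Y 1%N + (A1 *m (q1 *: Y0) + A2 *m (q2 *: Y0)).
    by rewrite -[LHS]scale1r (frobY 1) frobU frobV /U /V /= !add0r.
  by rewrite E mulmxBl mul1mx {1}Y1 addrAC subrr add0r mulmxDl -!scalemxAl !scalemxAr.
Qed.

End Frobenius.

(** Frobenius' method for the system u Y' = (N0 + u ...) Y when Y0 lies in the kernel of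
the residue N0 and no positive integer is an eigenvalue of N0; with N0 = 0 and Y0 = 1
it gives the solutions at an ordinary point, and an exponent mu is treated by
replacing N0 by N0 - mu. The coefficient is a sum of two geometric series
because the Fuchsian systems below have, besides the centre, two singular points.
The last clause is the equation at u = 0, where it cannot be divided by u. *)
Theorem frobenius (R : realType) k (N0 A1 A2 : 'M[Cplx R]_3) (q1 q2 : Cplx R) (r : R)
    (Y0 : 'M[Cplx R]_(3, k)) :
  0 < r -> cabs q1 * r <= 1 -> cabs q2 * r <= 1 -> N0 *m Y0 = 0 ->
  (forall n, (n.+1%:R%:M - N0) \in unitmx) ->
  exists Y : Cplx R -> 'M[Cplx R]_(3, k), Y 0 = Y0 /\
    forall u, cabs u < r -> exists Y' : 'M[Cplx R]_(3, k),
      [/\ forall i j, hasd (fun w => Y w i j) u (Y' i j),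
      u *: Y' = (N0 + (u * q1 / (1 - u * q1)) *: A1 + (u * q2 / (1 - u * q2)) *: A2) *m Y u
      & u = 0 -> (1%:M - N0) *m Y' = (q1 *: A1 + q2 *: A2) *m Y0].
Proof.
move=> r0 h1 h2 h3 h4; exists (psm (fun n => (frob N0 A1 A2 q1 q2 Y0 n).1.1)); split.
  apply/matrixP => i j; rewrite mxE; have [pY _ _] := frob_pb A1 A2 r0 h1 h2 h3 h4.
  by rewrite (ps_at0 r0 (pY i j)).
by move=> u hu; exact: (frobenius_aux A1 A2 r0 h1 h2 h3 h4 hu).
Qed.

(** * Solutions of a Fuchsian system on three charts *)

Section Gluing.
Variable R : realType.
Local Notation C := (Cplx R).

Lemma contV (z : C) : z != 0 -> cont (fun w => w^-1) z.
Proof.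
move=> z0 e e0; have p : 0 < cabs z by rewrite cabs_gt0.
exists (Num.min (cabs z / 2) (e * cabs z ^+ 2 / 2)).
  by rewrite lt_min !divr_gt0 // mulr_gt0 ?exprn_gt0.
move=> w; rewrite lt_min => /andP[h1 h2].
have wz : cabs z / 2 < cabs w.
  by have := cabsB w (w - z); rewrite (_ : w - (w - z) = z); [lra | ring].
have w0 : w != 0 by rewrite -cabs_gt0; lra.
have -> : w^-1 - z^-1 = (z - w) * (w^-1 * z^-1).
  by field; rewrite z0 w0.
rewrite !cabsM !cabsV cabsC.
have q : 0 < cabs w by rewrite cabs_gt0.
rewrite -invfM ltr_pdivrMr ?mulr_gt0 //; apply: lt_le_trans h2 _.
rewrite expr2 -!mulrA ler_pM2l //; nra.
Qed.

Lemma singular_col (K : fieldType) n (A : 'M[K]_n) : A \notin unitmx ->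
  exists2 v : 'cV[K]_n, v != 0 & A *m v = 0.
Proof.
rewrite unitmxE unitfE negbK -det_tr => /det0P[v v0 hv].
exists v^T; first by apply: contra_neq v0 => /(congr1 trmx); rewrite trmxK trmx0.
by apply: trmx_inj; rewrite trmx_mul trmxK trmx0.
Qed.

Lemma unit_col (K : fieldType) n (A : 'M[K]_n) :
  (forall v : 'cV[K]_n, A *m v = 0 -> v = 0) -> A \in unitmx.
Proof.
move=> h; apply: contrapT => /negP /singular_col[v /eqP v0 hv]; exact/v0/h.
Qed.

Variable a : C -> 'M[C]_3.

Lemma sol_unit D (Y : C -> 'M[C]_3) z0 z : openC D -> convexC D -> contmx a D ->
  sol a D Y -> D z0 -> Y z0 \in unitmx -> D z -> Y z \in unitmx.
Proof.
move=> oD cD ca sY D0 Y0 Dz; apply: unit_col => v hv.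
have h := uniq_zero oD cD ca (sol_mulr v sY) Dz hv D0.
by rewrite -(mulKmx Y0 v) h mulmx0.
Qed.

(** Solutions on convex regions that share a base point agree on the intersections,
which are convex and contain that point, so they form a single solution on the
union. *)
Lemma glue (I : Type) (D : I -> C -> Prop) z0 (i0 : I) :
  (forall i, [/\ openC (D i), convexC (D i), D i z0 & contmx a (D i)]) ->
  (forall i, exists2 Y : C -> 'M[C]_3, sol a (D i) Y & Y z0 = 1%:M) ->
  exists2 Y : C -> 'M[C]_3, sol a (fun z => exists i, D i z) Y &
    forall z, (exists i, D i z) -> Y z \in unitmx.
Proof.
move=> hD hY.
have /choice[Yi hYi] : forall i, exists Y : C -> 'M[C]_3, sol a (D i) Y /\ Y z0 = 1%:M.
  by move=> i; have [Y h1 h2] := hY i; exists Y.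
have /choice[Y hYY] : forall z, exists M : 'M[C]_3, forall i, D i z -> M = Yi i z.
  move=> z; case: (pselect (exists i, D i z)) => [ [i hi]|h]; last first.
    by exists 0 => i hi; case: h; exists i.
  exists (Yi i z) => j hj.
  have [op1 c1 d1 a1] := hD i; have [op2 c2 d2 a2] := hD j.
  have [s1 e1] := hYi i; have [s2 e2] := hYi j.
  pose E w := D i w /\ D j w.
  apply: (@uniq_sol _ a 3 E (Yi i) (Yi j) z0 z).
  - move=> w [/op1[r r0 hr] /op2[s s0 hs]]; exists (Num.min r s); first by rewrite lt_min r0 s0.
    by move=> x; rewrite lt_min => /andP[/hr ? /hs ?].
  - by move=> w x [w1 w2] [x1 x2] t ht; split; [exact: c1 | exact: c2].
  - by move=> w [w1 _]; exact: a1.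
  - by apply: sol_sub s1 => w [].
  - by apply: sol_sub s2 => w [].
  - by [].
  - by rewrite e1 e2.
  - by [].
exists Y.
  move=> z [i hi] m n; have [op1 c1 d1 a1] := hD i; have [s1 e1] := hYi i.
  have [r r0 hr] := op1 _ hi; rewrite (hYY _ _ hi).
  by apply: hasd_near (s1 _ hi m n); exists r => // w /hr h; rewrite (hYY _ _ h).
move=> z [i hi]; have [op1 c1 d1 a1] := hD i; have [s1 e1] := hYi i.
rewrite (hYY _ _ hi); apply: (sol_unit op1 c1 a1 s1 d1 _ hi).
by rewrite e1 unitmx1.
Qed.

(** Two fundamental solutions differ by a constant matrix, found at one point. *)
Lemma transition D (Y Y' : C -> 'M[C]_3) z0 :
  openC D -> convexC D -> contmx a D -> sol a D Y -> sol a D Y' -> D z0 ->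
  Y z0 \in unitmx -> Y' z0 \in unitmx ->
  exists2 G, G \in unitmx & forall z, D z -> Y' z = Y z *m G.
Proof.
move=> oD cD ca sY sY' D0 u u'; exists (invmx (Y z0) *m Y' z0).
  by rewrite unitmx_mul unitmx_inv u u'.
move=> z Dz; apply: (uniq_sol oD cD ca sY' (sol_mulr _ sY) D0 _ Dz).
by rewrite mulKVmx.
Qed.

End Gluing.

Section Discs.
Variable R : realType.
Local Notation C := (Cplx R).

Lemma re_seg (z w : C) t : re (seg z w t) = re z + t * (re w - re z).
Proof. by rewrite /seg reD reM reB re_ofR im_ofR mul0r subr0. Qed.
Lemma im_seg (z w : C) t : im (seg z w t) = im z + t * (im w - im z).
Proof. by rewrite /seg imD imM imB re_ofR im_ofR mul0r addr0. Qed.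

Lemma convex_disc (c : C) (r : R) : convexC (fun z => cabs (z - c) < r).
Proof.
move=> z w hz hw t ht.
have -> : seg z w t - c = ofR (1 - t) * (z - c) + ofR t * (w - c).
  by rewrite ofRB ofR1 /seg; ring.
apply: le_lt_trans (cabsD _ _) _; rewrite !cabsM !cabs_ofR !ger0_norm; try lra.
have h1 : (1 - t) * cabs (z - c) <= (1 - t) * r by apply: ler_wpM2l; [lra | exact: ltW].
have h2 : t * cabs (w - c) <= t * r by apply: ler_wpM2l; [lra | exact: ltW].
have [t0|t0] := ltP 0 t.
  have : t * cabs (w - c) < t * r by rewrite ltr_pM2l.
  lra.
have -> : t = 0 by lra.
by rewrite !mul0r subr0 mul1r addr0.
Qed.

Lemma open_disc (c : C) (r : R) : openC (fun z => cabs (z - c) < r).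
Proof.
move=> z hz; exists (r - cabs (z - c)); first lra.
move=> w hw; have := cabsD (w - z) (z - c); rewrite (_ : w - z + (z - c) = w - c); last ring.
lra.
Qed.

Lemma convexI (D D' : C -> Prop) : convexC D -> convexC D' -> convexC (fun z => D z /\ D' z).
Proof. by move=> h h' z w [? ?] [? ?] t ht; split; [exact: h | exact: h']. Qed.

Lemma openI (D D' : C -> Prop) : openC D -> openC D' -> openC (fun z => D z /\ D' z).
Proof.
move=> h h' z [/h[r r0 hr] /h'[s s0 hs]]; exists (Num.min r s); first by rewrite lt_min r0 s0.
by move=> w; rewrite lt_min => /andP[/hr ? /hs ?].
Qed.

Definition half (a b c : R) (z : C) : Prop := a * re z + b * im z < c.

Lemma convex_lt (x y c t : R) : x < c -> y < c -> 0 <= t <= 1 -> x + t * (y - x) < c.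
Proof. by move=> xc yc ht; case: (leP x y) => xy; nra. Qed.

Lemma convex_half a b c : convexC (half a b c).
Proof. move=> z w hz hw t ht; move: hz hw; rewrite /half re_seg im_seg => hz hw.
have := convex_lt hz hw ht; lra. Qed.

Lemma open_half a b c : openC (half a b c).
Proof.
move=> z; rewrite /half => hz.
have p : 0 < `|a| + `|b| + 1 by have := normr_ge0 a; have := normr_ge0 b; lra.
exists ((c - (a * re z + b * im z)) / (`|a| + `|b| + 1)).
  by rewrite divr_gt0 // subr_gt0.
move=> w; rewrite ltr_pdivlMr // => h.
have h1 : a * re (w - z) <= cabs (w - z) * `|a|.
  apply: le_trans (ler_norm _) _; rewrite normrM mulrC ler_wpM2r //; exact: cabs_re.
have h2 : b * im (w - z) <= cabs (w - z) * `|b|.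
  apply: le_trans (ler_norm _) _; rewrite normrM mulrC ler_wpM2r //; exact: cabs_im.
have := cabs_ge0 (w - z); move: h1 h2; rewrite reB imB; lra.
Qed.

(** The largest disc about c without 0 and 1, described by two inequalities that are
linear in c; this makes the choice of centres below a linear problem. *)
Lemma discP (c z : C) : cabs (z - c) < Num.min (cabs c) (cabs (1 - c)) <->
  re z ^+ 2 + im z ^+ 2 < 2 * (re z * re c + im z * im c) /\
  (re z - 1) ^+ 2 + im z ^+ 2 < 2 * ((re z - 1) * (re c - 1) + im z * im c).
Proof.
have H w : cabs (z - c) < cabs w <->
    (re z - re c) ^+ 2 + (im z - im c) ^+ 2 < re w ^+ 2 + im w ^+ 2.
  rewrite -(ltr_pXn2r (ltn0Sn 1)) ?nnegrE ?cabs_ge0 // !cabs_sq reB imB; split=> //.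
rewrite lt_min; split.
  by case/andP=> /H + /H; rewrite reB imB re1 im1 => h1 h2; split; nra.
by case=> h1 h2; apply/andP; split; apply/H; rewrite ?(reB, imB, re1, im1); nra.
Qed.

End Discs.

Section Charts.
Variable R : realType.
Local Notation C := (Cplx R).
Variables C0 C1 : 'M[C]_3.

(** The Fuchsian systems with singular points 0, 1 and infinity; the residues are C0 at 0
and - C1 at 1. *)
Definition coef (z : C) : 'M[C]_3 := z^-1 *: C0 + (1 - z)^-1 *: C1.

Lemma contmx_coef (D : C -> Prop) : ~ D 0 -> ~ D 1 -> contmx coef D.
Proof.
move=> d0 d1 z Dz i j.
apply: (@cont_near _ (fun w => w^-1 * C0 i j + (1 - w)^-1 * C1 i j)).
  by exists 1 => // w _; rewrite !mxE.
have z0 : z != 0 by apply: contra_notN d0 => /eqP <-.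
have z1 : 1 - z != 0 by rewrite subr_eq0; apply: contra_notN d1 => /eqP ->.
have k1 : cont (fun w => w^-1) z by exact: contV.
have k2 : cont (fun w => (1 - w)^-1) z.
  apply: (@cont_comp _ (fun w => w^-1) (fun w => 1 - w)); last exact: contV.
  apply: (@cont_near _ (fun w => 1 + -1 * w)); first by exists 1 => // w _; rewrite mulN1r.
  exact: (contD (cont_cst 1 z) (contM (cont_cst (-1) z) (cont_id z))).
exact: (contD (contM k1 (cont_cst _ z)) (contM k2 (cont_cst _ z))).
Qed.

Definition disc (c z : C) := cabs (z - c) < Num.min (cabs c) (cabs (1 - c)).

Lemma disc01 c : ~ disc c 0 /\ ~ disc c 1.
Proof.
split; rewrite /disc lt_min => /andP[h1 h2].
  by move: h1; rewrite sub0r cabsN ltxx.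
by move: h2; rewrite ltxx.
Qed.

(** Expanding 1/z and 1/(1 - z) about c gives geometric series of ratios -1/c and
1/(1-c), which is the situation of [frobenius] with N0 = 0. *)
Lemma ordinary_point (c : C) : c != 0 -> c != 1 ->
  exists2 Y : C -> 'M[C]_3, sol coef (disc c) Y & Y c = 1%:M.
Proof.
move=> c0 c1; set r := Num.min (cabs c) (cabs (1 - c)).
have c1' : 1 - c != 0 by rewrite subr_eq0 eq_sym.
have p0 : 0 < cabs c by rewrite cabs_gt0.
have p1 : 0 < cabs (1 - c) by rewrite cabs_gt0.
have r0 : 0 < r by rewrite /r lt_min p0 p1.
have h1 : cabs (- c^-1) * r <= 1.
  by rewrite cabsN cabsV mulrC ler_pdivrMr // mul1r /r ge_min lexx.
have h2 : cabs ((1 - c)^-1) * r <= 1.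
  by rewrite cabsV mulrC ler_pdivrMr // mul1r /r ge_min lexx orbT.
have [|n|Y [Yc hY]] := @frobenius R 3 0 (- C0) C1 _ _ r 1%:M r0 h1 h2.
- by rewrite mul0mx.
- by rewrite subr0 unitmxE det_scalar unitfE expf_eq0 /= pnatr_eq0.
exists (fun z => Y (z - c)); last by rewrite subrr.
move=> z zr i j; have [Y' [d E E0]] := hY (z - c) zr.
have -> : coef z *m Y (z - c) = Y'.
  have [zc|zc] := eqVneq z c.
    have := E0 _; rewrite zc subrr subr0 mul1mx => -> //.
    by rewrite Yc /coef scalerN scaleNr opprK.
  have u0 : z - c != 0 by rewrite subr_eq0.
  have [d0 d1] := disc01 c.
  have z0 : z != 0 by apply: contra_notN d0 => /eqP <-.
  have z1 : 1 - z != 0 by rewrite subr_eq0; apply: contra_notN d1 => /eqP ->.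
  apply: (scalerI u0); rewrite E add0r scalemxAl; congr (_ *m Y (z - c)).
  rewrite /coef scalerDr !scalerA scalerN -scaleNr.
  have -> : (z - c) / z = - ((z - c) * - c^-1 / (1 - (z - c) * - c^-1)).
    have -> : 1 - (z - c) * - c^-1 = z / c by field.
    by field; rewrite ?z0 ?c0.
  have -> // : (z - c) / (1 - z) = (z - c) / (1 - c) / (1 - (z - c) / (1 - c)).
  have -> : 1 - (z - c) / (1 - c) = (1 - z) / (1 - c) by field.
  by field; rewrite ?z1 ?c1'.
rewrite -[Y' i j]mul1r; apply: (@hasd_comp _ (fun w => Y w i j) (fun w => w - c)) (d i j).
by have := hasdD (hasd_id z) (hasd_cst (- c) z); rewrite addr0.
Qed.

Lemma disc_sol (c z0 : C) : c != 0 -> c != 1 -> disc c z0 ->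
  exists2 Y : C -> 'M[C]_3, sol coef (disc c) Y & Y z0 = 1%:M.
Proof.
move=> c0 c1 hz; have [Y sY Yc] := ordinary_point c0 c1.
have [d0 d1] := disc01 c.
have cc : disc c c.
  by rewrite /disc subrr cabs0 lt_min !cabs_gt0 c0 subr_eq0 eq_sym c1.
have u : Y z0 \in unitmx.
  apply: (sol_unit (@open_disc _ c _) (@convex_disc _ c _) (contmx_coef d0 d1) sY cc _ hz).
  by rewrite Yc unitmx1.
by exists (fun z => Y z *m invmx (Y z0)); [exact: sol_mulr | rewrite mulmxV].
Qed.

(** A region covered by discs that all contain the same point z0 carries an invertible
solution. *)
Lemma chart (I : Type) (i0 : I) (c : I -> C) (z0 : C) (U : C -> Prop) :
  (forall i, c i != 0 /\ c i != 1) -> (forall i, disc (c i) z0) ->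
  (forall z, U z -> exists i, disc (c i) z) ->
  exists2 Y : C -> 'M[C]_3, sol coef U Y & forall z, U z -> Y z \in unitmx.
Proof.
move=> hc hz hU.
have [|i|Y sY uY] := @glue _ coef I (fun i => disc (c i)) z0 i0.
- move=> i; have [d0 d1] := disc01 (c i); split=> //; [exact: open_disc | exact: convex_disc |].
  exact: contmx_coef.
- by have [h0 h1] := hc i; exact: disc_sol.
by exists Y; [apply: sol_sub sY | move=> z /hU /uY].
Qed.

(** The plane cut along the two half-lines z <= 0 and z >= 1. *)
Definition U0 (z : C) : Prop := im z != 0 \/ 0 < re z < 1.
Definition U1 (z : C) : Prop := re z < 0.
Definition U2 (z : C) : Prop := 1 < re z.

(** The discs are centred on the line re z = 1/2, on which both singular points are
equally distant. *)
Lemma chart0 : exists2 Y : C -> 'M[C]_3, sol coef U0 Y & forall z, U0 z -> Y z \in unitmx.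
Proof.
apply: (@chart R 0 (fun T => 2^-1 +i* T) (ofR 2^-1)).
- by move=> T; split; apply/eqP => /(congr1 (@re R)); rewrite ?re_cplx ?re0 ?re1; lra.
- by move=> T; apply/discP; rewrite re_cplx im_cplx re_ofR im_ofR; lra.
move=> z hz; case: (eqVneq (im z) 0) hz => [y0|y0 _].
  case=> [|hx]; first by rewrite y0 eqxx.
  by exists 0; apply/discP; rewrite re_cplx im_cplx y0; nra.
(* for this ordinate both inequalities of discP hold with the margin 1 *)
exists ((re z ^+ 2 - re z + im z ^+ 2 + 1) / (2 * im z)); apply/discP.
rewrite re_cplx im_cplx.
have -> : im z * ((re z ^+ 2 - re z + im z ^+ 2 + 1) / (2 * im z)) =
   (re z ^+ 2 - re z + im z ^+ 2 + 1) / 2 by field.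
by lra.
Qed.

(** The half-plane is exhausted by the discs centred at a < 0 through 0, which increase as a
decreases. *)
Lemma chart1 : exists2 Y : C -> 'M[C]_3, sol coef U1 Y & forall z, U1 z -> Y z \in unitmx.
Proof.
apply: (@chart R 0 (fun T => ofR (- (1 + T ^+ 2))) (ofR (-1))).
- move=> T; have := sqr_ge0 T.
  by split; apply/eqP => /(congr1 (@re R)); rewrite re_ofR ?re0 ?re1; lra.
- by move=> T; have := sqr_ge0 T; move=> ?; apply/discP; rewrite !re_ofR !im_ofR; lra.
rewrite /U1 => z hz; pose m := (re z ^+ 2 + im z ^+ 2) / (- 2 * re z).
exists m; apply/discP; rewrite re_ofR im_ofR.
have E : re z ^+ 2 + im z ^+ 2 = m * (- 2 * re z) by rewrite /m divfK // mulf_neq0 //; lra.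
have mm : m < 1 + m ^+ 2 by nra.
by split; nra.
Qed.

Lemma chart2 : exists2 Y : C -> 'M[C]_3, sol coef U2 Y & forall z, U2 z -> Y z \in unitmx.
Proof.
apply: (@chart R 0 (fun T => ofR (2 + T ^+ 2)) (ofR 2)).
- move=> T; have := sqr_ge0 T.
  by split; apply/eqP => /(congr1 (@re R)); rewrite re_ofR ?re0 ?re1; lra.
- by move=> T; have := sqr_ge0 T; move=> ?; apply/discP; rewrite !re_ofR !im_ofR; lra.
rewrite /U2 => z hz; pose m := ((re z - 1) ^+ 2 + im z ^+ 2) / (2 * (re z - 1)).
exists m; apply/discP; rewrite re_ofR im_ofR.
have E : (re z - 1) ^+ 2 + im z ^+ 2 = m * (2 * (re z - 1)) by rewrite /m divfK // mulf_neq0 //; lra.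
have mm : m < 1 + m ^+ 2 by nra.
by split; nra.
Qed.

Lemma nU1 : ~ U1 0 /\ ~ U1 1.
Proof. by rewrite /U1 re0 re1 ltxx ltr10. Qed.
Lemma nU2 : ~ U2 0 /\ ~ U2 1.
Proof. by rewrite /U2 re0 re1 ltxx ltr10. Qed.

Definition quad (a c b : R) (z : C) := half a 0 c z /\ half 0 b 0 z.

(** The overlaps of U0 with the two half-planes are four quadrants, which are convex.
Correcting F1 and F2 by the transition matrices of the upper ones leaves a
constant matrix on each lower one. *)
Theorem charts : exists F0 F1 F2 : C -> 'M[C]_3, exists M0 M1 : 'M[C]_3,
  [/\ [/\ sol coef U0 F0, sol coef U1 F1 & sol coef U2 F2],
      [/\ forall z, U0 z -> F0 z \in unitmx, forall z, U1 z -> F1 z \in unitmx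
        & forall z, U2 z -> F2 z \in unitmx],
      M0 \in unitmx /\ M1 \in unitmx,
      (forall z, re z < 0 -> 0 < im z -> F1 z = F0 z) /\
      (forall z, re z < 0 -> im z < 0 -> F1 z = F0 z *m M0)
    & (forall z, 1 < re z -> 0 < im z -> F2 z = F0 z) /\
      (forall z, 1 < re z -> im z < 0 -> F2 z = F0 z *m M1)].
Proof.
have [F0 s0 u0] := chart0; have [F1 s1 u1] := chart1; have [F2 s2 u2] := chart2.
have key (U : C -> Prop) F a c b (z0 : C) : ~ U 0 -> ~ U 1 -> sol coef U F -> (forall z, U z -> F z \in unitmx) ->
    quad a c b z0 -> (forall z, quad a c b z -> U z /\ im z != 0) ->
    exists2 G, G \in unitmx & forall z, quad a c b z -> F z = F0 z *m G.
  move=> n0 n1 sF uF q0 qU; apply: (@transition _ coef _ F0 F z0) => //.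
  - by apply: openI; exact: open_half.
  - by apply: convexI; exact: convex_half.
  - by apply: contmx_coef => /qU[].
  - by apply: sol_sub s0 => z /qU[_ h]; left.
  - by apply: sol_sub sF => z /qU[].
  - by apply: u0; left; case: (qU _ q0).
  - by apply: uF; case: (qU _ q0).
have nz (x : R) : 0 < x \/ x < 0 -> x != 0 by case=> h; lra.
have [A uA hA] : exists2 G, G \in unitmx & forall z, quad 1 0 (-1) z -> F1 z = F0 z *m G.
  apply: (key U1 F1 _ _ _ ((-1) +i* 1) (nU1).1 (nU1).2 s1 u1); rewrite /U1 /quad /half ?re_cplx ?im_cplx.
  - by split; lra.
  - by move=> z [h1 h2]; split; [lra | apply: nz; left; lra].
have [B uB hB] : exists2 G, G \in unitmx & forall z, quad 1 0 1 z -> F1 z = F0 z *m G.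
  apply: (key U1 F1 _ _ _ ((-1) +i* (-1)) (nU1).1 (nU1).2 s1 u1); rewrite /U1 /quad /half ?re_cplx ?im_cplx.
  - by split; lra.
  - by move=> z [h1 h2]; split; [lra | apply: nz; right; lra].
have [A' uA' hA'] : exists2 G, G \in unitmx & forall z, quad (-1) (-1) (-1) z -> F2 z = F0 z *m G.
  apply: (key U2 F2 _ _ _ (2 +i* 1) (nU2).1 (nU2).2 s2 u2); rewrite /U2 /quad /half ?re_cplx ?im_cplx.
  - by split; lra.
  - by move=> z [h1 h2]; split; [lra | apply: nz; left; lra].
have [B' uB' hB'] : exists2 G, G \in unitmx & forall z, quad (-1) (-1) 1 z -> F2 z = F0 z *m G.
  apply: (key U2 F2 _ _ _ (2 +i* (-1)) (nU2).1 (nU2).2 s2 u2); rewrite /U2 /quad /half ?re_cplx ?im_cplx.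
  - by split; lra.
  - by move=> z [h1 h2]; split; [lra | apply: nz; right; lra].
exists F0, (fun z => F1 z *m invmx A), (fun z => F2 z *m invmx A'), (B *m invmx A), (B' *m invmx A').
split.
- by split=> //; exact: sol_mulr.
- by split=> // z h; rewrite unitmx_mul unitmx_inv ?uA ?uA' andbT; [exact: u1 | exact: u2].
- by rewrite !unitmx_mul !unitmx_inv uA uA' uB uB'.
- split=> z h1 h2; [rewrite hA ?mulmxK // | rewrite hB ?mulmxA //];
    by rewrite /quad /half; split; lra.
- split=> z h1 h2; [rewrite hA' ?mulmxK // | rewrite hB' ?mulmxA //];
    by rewrite /quad /half; split; lra.
Qed.

End Charts.

(** * The hypergeometric equation as a system *)

Section Symmetric.
Variable K : fieldType.

Definition e1 (x : 'I_3 -> K) := x 0 + x 1 + x 2.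
Definition e2 (x : 'I_3 -> K) := x 0 * x 1 + x 0 * x 2 + x 1 * x 2.
Definition e3 (x : 'I_3 -> K) := x 0 * x 1 * x 2.

End Symmetric.

Section Companion.
Variable R : realType.
Local Notation C := (Cplx R).
Variables alpha beta : 'I_3 -> C.

Let b i := beta i - 1.

(** The coefficients of the system satisfied by (w, theta w, theta^2 w). Solving the equation for
theta^3 w gives the coefficient (- e_j(b) + z e_j(alpha))/(1 - z), which is
[- e_j b] plus z/(1 - z) times [e_j alpha - e_j b]; as the system is divided by z,
these are the residue at 0 and a matrix with one nonzero row at 1. *)
Definition residue0 : 'M[C]_3 := mx3 [:: [:: 0; 1; 0]; [:: 0; 0; 1]; [:: - e3 b; - e2 b; - e1 b]].
Definition residue1 : 'M[C]_3 := mx3 [:: [:: 0; 0; 0]; [:: 0; 0; 0];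
  [:: e3 alpha - e3 b; e2 alpha - e2 b; e1 alpha - e1 b]].

Lemma sum3 (V : nmodType) (f : 'I_3 -> V) : \sum_i f i = f 0 + f 1 + f 2.
Proof.
rewrite !big_ord_recl big_ord0 addr0 -addrA; congr (f _ + (f _ + f _)); exact/val_inj.
Qed.

Lemma ord3P (P : 'I_3 -> Prop) : P 0 -> P 1 -> P 2 -> forall i, P i.
Proof.
move=> h0 h1 h2 [[|[|[|//]]] hi].
- by move: h0; congr P; exact: val_inj.
- by move: h1; congr P; exact: val_inj.
- by move: h2; congr P; exact: val_inj.
Qed.

Lemma coef_row k (Y : 'M[C]_(3, k)) z j :
  [/\ (coef residue0 residue1 z *m Y) 0 j = z^-1 * Y 1 j,
      (coef residue0 residue1 z *m Y) 1 j = z^-1 * Y 2 j &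
      (coef residue0 residue1 z *m Y) 2 j =
        z^-1 * - (e3 b * Y 0 j + e2 b * Y 1 j + e1 b * Y 2 j) +
        (1 - z)^-1 * ((e3 alpha - e3 b) * Y 0 j + (e2 alpha - e2 b) * Y 1 j +
                      (e1 alpha - e1 b) * Y 2 j)].
Proof. by split; rewrite mxE sum3 !mxE /=; ring. Qed.

Lemma hasd_uniq (f : C -> C) z d d' : hasd f z d -> hasd f z d' -> d = d'.
Proof. by move=> /hasd_derive[_ <-] /hasd_derive[_ <-]. Qed.

Lemma thetaE (f : C -> C) z d : hasd f z d -> theta f z = z * d.
Proof. by move=> /hasd_derive[_ <-]. Qed.

Lemma thetaDE c (f : C -> C) z d : hasd f z d -> thetaD c f z = z * d + c * f z.
Proof. by move=> /thetaE; rewrite /thetaD => ->. Qed.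

Lemma thetaD3 (D : C -> Prop) (c : 'I_3 -> C) (w d : C -> C) :
  openC D -> (forall y, D y -> y != 0) ->
  (forall y, D y -> hasd w y (y^-1 * theta w y)) ->
  (forall y, D y -> hasd (theta w) y (y^-1 * theta (theta w) y)) ->
  (forall y, D y -> hasd (theta (theta w)) y (d y)) ->
  forall y, D y -> thetaD (c 0) (thetaD (c 1) (thetaD (c 2) w)) y =
    y * d y + e1 c * theta (theta w) y + e2 c * theta w y + e3 c * w y.
Proof.
move=> oD D0 h0 h1 h2.
have k2 y : D y -> hasd (thetaD (c 2) w) y (y^-1 * theta (theta w) y + c 2 * (y^-1 * theta w y)).
  by move=> Dy; apply: hasdD; [exact: h1 | apply: hasdZ; exact: h0].
have E1 y : D y -> thetaD (c 1) (thetaD (c 2) w) y =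
    theta (theta w) y + ((c 1 + c 2) * theta w y + c 1 * c 2 * w y).
  move=> Dy; rewrite (thetaDE _ (k2 _ Dy)) /thetaD; have y0 := D0 _ Dy.
  by move: (theta (theta w) y) (theta w y) (w y) => u v t; field.
move=> y Dy.
have k1 : hasd (thetaD (c 1) (thetaD (c 2) w)) y
    (d y + ((c 1 + c 2) * (y^-1 * theta (theta w) y) + c 1 * c 2 * (y^-1 * theta w y))).
  have [r r0 hr] := oD _ Dy.
  apply: (@hasd_near _ (fun y => theta (theta w) y + ((c 1 + c 2) * theta w y + c 1 * c 2 * w y))).
    by exists r => // x /hr /E1.
  by apply: hasdD; [exact: h2 | apply: hasdD; apply: hasdZ; [exact: h1 | exact: h0]].
rewrite (thetaDE _ k1) (E1 _ Dy) /e1 /e2 /e3; have y0 := D0 _ Dy.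
by move: (theta (theta w) y) (theta w y) (w y) (d y) => u v t d'; field.
Qed.

(** The vector on which the equation becomes a first order system. *)
Definition jet (w : C -> C) (z : C) : 'cV[C]_3 := \col_i iter i (@theta R) w z.

Lemma jetE w z : [/\ jet w z 0 0 = w z, jet w z 1 0 = theta w z & jet w z 2 0 = theta (theta w) z].
Proof. by split; rewrite mxE. Qed.

Lemma solution_sol w z : z != 0 -> z != 1 -> solution_at alpha beta w z ->
  exists2 r : R, 0 < r & sol (coef residue0 residue1) (fun y => cabs (y - z) < r) (jet w).
Proof.
move=> z0 z1 /nbhs_cabs[r r0 hr].
have p0 : 0 < cabs z by rewrite cabs_gt0.
have p1 : 0 < cabs (1 - z) by rewrite cabs_gt0 subr_eq0 eq_sym.
pose s := Num.min r (Num.min (cabs z) (cabs (1 - z))).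
have s0 : 0 < s by rewrite !lt_min r0 p0 p1.
have sP y : cabs (y - z) < s -> [/\ cabs (y - z) < r, y != 0 & 1 - y != 0].
  rewrite !lt_min => /and3P[h1 h2 h3]; split=> //.
    by apply: contraTneq h2 => ->; rewrite sub0r cabsN ltxx.
  by apply: contraTneq h3 => /eqP; rewrite subr_eq0 => /eqP <-; rewrite ltxx.
exists s => //.
pose D y := cabs (y - z) < s.
have oD : openC D by exact: open_disc.
have D0 y : D y -> y != 0 by case/sP.
have h0 y : D y -> hasd w y (y^-1 * theta w y).
  move=> Dy; have [h _ _] := sP _ Dy; have [h1 _ _ _] := hr _ h.
  by apply/hasd_derive; split=> //; rewrite /theta mulKf // D0.
have h1 y : D y -> hasd (theta w) y (y^-1 * theta (theta w) y).
  move=> Dy; have [h _ _] := sP _ Dy; have [_ h1 _ _] := hr _ h.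
  by apply/hasd_derive; split=> //; rewrite {2}/theta mulKf // D0.
have h2 y : D y -> hasd (theta (theta w)) y (derive1 (theta (theta w)) y).
  by move=> Dy; have [h _ _] := sP _ Dy; have [_ _ h2 _] := hr _ h; apply/hasd_derive.
move=> y Dy; have [yr y0 y1] := sP _ Dy; have [_ _ _] := hr _ yr.
rewrite /hypergeometric_op (thetaD3 b oD D0 h0 h1 h2 Dy) (thetaD3 alpha oD D0 h0 h1 h2 Dy) => E.
have [c0 c1 c2] := coef_row (jet w y) y 0; have [j0 j1 j2] := jetE w y.
move=> i j; rewrite ord1; move: i; apply: ord3P.
- by rewrite c0 j1; apply: hasd_ext (h0 _ Dy) => x; case: (jetE w x).
- by rewrite c1 j2; apply: hasd_ext (h1 _ Dy) => x; case: (jetE w x).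
- apply: (@hasd_ext _ (theta (theta w))) => [x|]; first by case: (jetE w x).
  rewrite c2 j0 j1 j2.
  set d := derive1 _ y in E; have := h2 _ Dy; rewrite -/d; congr hasd.
  clearbody d; move: (theta (theta w) y) (theta w y) (w y) E => u v t E.
  have k : (1 - y) * (y * d) = y * (e1 alpha * u + e2 alpha * v + e3 alpha * t) - (e1 b * u + e2 b * v + e3 b * t).
    by apply/eqP; rewrite -subr_eq0 -E; apply/eqP; ring.
  apply: (mulfI (mulf_neq0 y1 y0)); rewrite -mulrA k.
  by field; rewrite y0 y1.
Qed.

Lemma sol_solution k (D : C -> Prop) (Y : C -> 'M[C]_(3, k)) j w z :
  openC D -> ~ D 0 -> ~ D 1 -> sol (coef residue0 residue1) D Y ->
  (forall y, D y -> w y = Y y 0 j) -> D z -> solution_at alpha beta w z.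
Proof.
move=> oD n0 n1 sY t0 Dz.
have D0 y : D y -> y != 0 by move=> Dy; apply: contra_notN n0 => /eqP <-.
have D1 y : D y -> 1 - y != 0.
  by move=> Dy; rewrite subr_eq0; apply: contra_notN n1 => /eqP ->.
have near1 (u v : C -> C) (d : C) y : (forall x, D x -> v x = u x) -> D y -> hasd u y d -> hasd v y d.
  move=> e Dy; have [r r0 hr] := oD _ Dy; apply: hasd_near; exists r => // x /hr h.
  by rewrite e.
have g0 y : D y -> hasd w y (y^-1 * Y y 1 j).
  move=> Dy; apply: (near1 _ _ _ _ t0 Dy).
  by have := sY _ Dy 0 j; have [-> _ _] := coef_row (Y y) y j.
have t1 y : D y -> theta w y = Y y 1 j.
  by move=> Dy; rewrite (thetaE (g0 _ Dy)) mulVKf // D0.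
have g1 y : D y -> hasd (theta w) y (y^-1 * Y y 2 j).
  move=> Dy; apply: (near1 _ _ _ _ t1 Dy).
  by have := sY _ Dy 1 j; have [_ -> _] := coef_row (Y y) y j.
have t2 y : D y -> theta (theta w) y = Y y 2 j.
  by move=> Dy; rewrite (thetaE (g1 _ Dy)) mulVKf // D0.
have g2 y : D y -> hasd (theta (theta w)) y ((coef residue0 residue1 y *m Y y) 2 j).
  by move=> Dy; apply: (near1 _ _ _ _ t2 Dy); exact: (sY _ Dy 2 j).
have [r r0 hr] := oD _ Dz; apply/nbhs_cabs; exists r => // y /hr Dy.
have h0 x : D x -> hasd w x (x^-1 * theta w x) by move=> Dx; rewrite t1 //; exact: g0.
have h1 x : D x -> hasd (theta w) x (x^-1 * theta (theta w) x) by move=> Dx; rewrite t2 //; exact: g1.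
split.
- by have /hasd_derive[] := g0 _ Dy.
- by have /hasd_derive[] := g1 _ Dy.
- by have /hasd_derive[] := g2 _ Dy.
rewrite /hypergeometric_op (thetaD3 b oD D0 h0 h1 g2 Dy) (thetaD3 alpha oD D0 h0 h1 g2 Dy).
have [_ _ ->] := coef_row (Y y) y j; rewrite (t0 _ Dy) (t1 _ Dy) (t2 _ Dy).
have y0 := D0 _ Dy; have y1 := D1 _ Dy.
by move: (Y y 0 j) (Y y 1 j) (Y y 2 j) => u v t; field; rewrite y0 y1.
Qed.

(** The other entries of a column of a solution are the theta-derivatives of the
first one. *)
Lemma row0_inj k (D : C -> Prop) (Y : C -> 'M[C]_(3, k)) j z :
  openC D -> ~ D 0 -> sol (coef residue0 residue1) D Y -> D z ->
  (exists2 r : R, 0 < r & forall y, cabs (y - z) < r -> Y y 0 j = 0) ->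
  forall i, Y z i j = 0.
Proof.
move=> oD n0 sY Dz [r0 r00 hr0].
have [r1 r10 hr1] := oD _ Dz.
pose r := Num.min r0 r1.
have rp : 0 < r by rewrite lt_min r00 r10.
have rP y : cabs (y - z) < r -> [/\ Y y 0 j = 0, D y & y != 0].
  rewrite lt_min => /andP[/hr0 h1 /hr1 Dy]; split=> //.
  by apply: contra_notN n0 => /eqP <-.
have zr : cabs (z - z) < r by rewrite subrr cabs0.
have next (i i' : 'I_3) : (forall y, (coef residue0 residue1 y *m Y y) i j = y^-1 * Y y i' j) ->
    (forall y, cabs (y - z) < r -> Y y i j = 0) -> forall y, cabs (y - z) < r -> Y y i' j = 0.
  move=> E h y hy; have [_ Dy y0] := rP _ hy.
  have [s sp hs] := open_disc hy.
  have k1 : hasd (fun x => Y x i j) y 0.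
    by apply: hasd_near (hasd_cst 0 y); exists s => // x /hs /h ->.
  have := hasd_uniq k1 (sY _ Dy i j); rewrite E => /eqP.
  by rewrite eq_sym mulf_eq0 invr_eq0 (negbTE y0) /= => /eqP.
have z0 y : cabs (y - z) < r -> Y y 0 j = 0 by case/rP.
have z1 := next 0 1 (fun y => let: And3 a _ _ := coef_row (Y y) y j in a) z0.
have z2 := next 1 2 (fun y => let: And3 _ a _ := coef_row (Y y) y j in a) z1.
by apply: ord3P; [exact: z0 | exact: z1 | exact: z2].
Qed.

End Companion.

(** * Generators of the monodromy group *)

Section Monodromy.
Variable R : realType.
Local Notation C := (Cplx R).
Variables alpha beta : 'I_3 -> C.
Let a := coef (residue0 beta) (residue1 alpha beta).
Variables F0 F1 F2 : C -> 'M[C]_3.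
Variables M0 M1 : 'M[C]_3.
Hypotheses (s0 : sol a (@U0 R) F0) (s1 : sol a (@U1 R) F1) (s2 : sol a (@U2 R) F2).
Hypotheses (u0 : forall z, U0 z -> F0 z \in unitmx)
  (u1 : forall z, U1 z -> F1 z \in unitmx) (u2 : forall z, U2 z -> F2 z \in unitmx).
Hypotheses (uM0 : M0 \in unitmx) (uM1 : M1 \in unitmx).
Hypotheses (h01 : forall z, re z < 0 -> 0 < im z -> F1 z = F0 z)
  (h10 : forall z, re z < 0 -> im z < 0 -> F1 z = F0 z *m M0)
  (h02 : forall z, 1 < re z -> 0 < im z -> F2 z = F0 z)
  (h20 : forall z, 1 < re z -> im z < 0 -> F2 z = F0 z *m M1).

Let G : set 'M[C]_3 := generated [set M | M = M0 \/ M = M1].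

Lemma generated_unit (K : fieldType) (S : set 'M[K]_3) M :
  (forall g, S g -> g \in unitmx) -> generated S M -> M \in unitmx.
Proof.
move=> h; elim=> [|g N /h ug _ uN|g N /h ug _ uN]; first exact: unitmx1.
  by rewrite unitmx_mul ug.
by rewrite unitmx_mul unitmx_inv ug.
Qed.

(** Words are built by multiplication by a generator or its inverse on the left, so
closure under products needs an induction. *)
Lemma gen_mul (K : fieldType) (S : set 'M[K]_3) g h :
  (forall x, S x -> x \in unitmx) -> generated S g -> generated S h -> generated S (g *m h).
Proof.
move=> uS; elim=> [|x y Sx _ IH|x y Sx _ IH] Gh; first by rewrite mul1mx.
  by rewrite -mulmxA; apply: generatedM => //; exact: IH.
by rewrite -mulmxA; apply: generatedV => //; exact: IH.
Qed.

Lemma gen_base (K : fieldType) (S : set 'M[K]_3) g : S g -> generated S g.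
Proof. by move=> Sg; rewrite -[g]mulmx1; apply: generatedM => //; exact: generated1. Qed.

Lemma invmxM (K : fieldType) n (A B : 'M[K]_n) : A \in unitmx -> B \in unitmx ->
  invmx (A *m B) = invmx B *m invmx A.
Proof.
move=> uA uB; have E : A *m B *m (invmx B *m invmx A) = 1%:M.
  by rewrite mulmxA -[A *m B *m _]mulmxA mulmxV // mulmx1 mulmxV.
by rewrite -[LHS]mulmx1 -E mulKmx // unitmx_mul uA.
Qed.

Lemma gen_inv (K : fieldType) (S : set 'M[K]_3) g :
  (forall x, S x -> x \in unitmx) -> generated S g -> generated S (invmx g).
Proof.
move=> uS; elim=> [|x y Sx Gy IH|x y Sx Gy IH]; first by rewrite invmx1; exact: generated1.
  rewrite (invmxM (uS _ Sx) (generated_unit uS Gy)).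
  apply: gen_mul => //; rewrite -[invmx x]mulmx1; apply: generatedV => //; exact: generated1.
rewrite (_ : invmx (invmx x *m y) = invmx y *m x); last first.
  have ux := uS _ Sx; have uy := generated_unit uS Gy.
  by rewrite invmxM ?unitmx_inv // invmxK.
by apply: gen_mul => //; exact: gen_base.
Qed.

Let uS x : [set M | M = M0 \/ M = M1] x -> x \in unitmx.
Proof. by case=> ->. Qed.

Definition chart_at F (z : C) : Prop :=
  [\/ U0 z /\ F = F0, U1 z /\ F = F1 | U2 z /\ F = F2].

Lemma open_U0 : openC (@U0 R).
Proof.
move=> z [y0|x0].
  have p : 0 < `|im z| by rewrite normr_gt0.
  exists `|im z| => // w hw; left; apply: contraTneq hw => w0.
  by have := cabs_im (w - z); rewrite imB w0 sub0r normrN leNgt.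
exists (Num.min (re z) (1 - re z)); first by rewrite lt_min; lra.
move=> w; rewrite lt_min => /andP[h1 h2]; right.
have := cabs_re (w - z); rewrite reB ler_norml; lra.
Qed.

Lemma open_U1 : openC (@U1 R).
Proof.
move=> z; rewrite /U1 => h; exists (- re z); first lra.
move=> w hw; have := cabs_re (w - z); rewrite reB ler_norml; lra.
Qed.

Lemma open_U2 : openC (@U2 R).
Proof.
move=> z; rewrite /U2 => h; exists (re z - 1); first lra.
move=> w hw; have := cabs_re (w - z); rewrite reB ler_norml; lra.
Qed.

Lemma chart_exists z : z != 0 -> z != 1 -> exists F, chart_at F z.
Proof.
move=> z0 z1; have [y0|y0] := eqVneq (im z) 0; last by exists F0; constructor 1; split=> //; left.
have [x0|x0] := ltP (re z) 0; first by exists F1; constructor 2.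
have [x1|x1] := ltP 1 (re z); first by exists F2; constructor 3.
exists F0; constructor 1; split=> //; right.
have h0 : re z != 0 by apply: contra_neq z0 => h; exact: cplx_eq.
have h1 : re z != 1 by apply: contra_neq z1 => h; exact: cplx_eq.
by rewrite !lt_def h0 x0 x1 eq_sym h1.
Qed.

Lemma chartP F z : chart_at F z -> exists U : C -> Prop,
  [/\ openC U /\ (~ U 0 /\ ~ U 1), U z, sol a U F, forall y, U y -> F y \in unitmx
    & forall y, U y -> chart_at F y].
Proof.
case=> -[Uz ->].
- exists (@U0 R); split=> //; last by move=> y; constructor 1.
  by split; [exact: open_U0 | split; case; rewrite ?(im0, im1, eqxx, re0, re1, ltxx) ?andbF].
- by exists (@U1 R); split=> //; [split; [exact: open_U1 | exact: nU1] | move=> y; constructor 2].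
- by exists (@U2 R); split=> //; [split; [exact: open_U2 | exact: nU2] | move=> y; constructor 3].
Qed.

Lemma near_half (z : C) : [/\ re z < 0 -> exists2 r : R, 0 < r & forall w, cabs (w - z) < r -> re w < 0,
  1 < re z -> exists2 r : R, 0 < r & forall w, cabs (w - z) < r -> 1 < re w,
  0 < im z -> exists2 r : R, 0 < r & forall w, cabs (w - z) < r -> 0 < im w &
  im z < 0 -> exists2 r : R, 0 < r & forall w, cabs (w - z) < r -> im w < 0].
Proof.
split=> h; [exists (- re z) | exists (re z - 1) | exists (im z) | exists (- im z)]; try lra; move=> w hw;
  have := cabs_re (w - z); have := cabs_im (w - z); rewrite reB imB !ler_norml; lra.
Qed.

Lemma near2 (z : C) (P Q : C -> Prop) : (exists2 r : R, 0 < r & forall w, cabs (w - z) < r -> P w) ->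
  (exists2 r : R, 0 < r & forall w, cabs (w - z) < r -> Q w) ->
  exists2 r : R, 0 < r & forall w, cabs (w - z) < r -> P w /\ Q w.
Proof.
move=> [r r0 hr] [s sp hs]; exists (Num.min r s); first by rewrite lt_min r0 sp.
by move=> w; rewrite lt_min => /andP[/hr ? /hs ?].
Qed.

(** Two of the three solutions differ near a common point by M0, M1, an inverse of one
of them, or the identity. *)
Lemma chart_trans F F' z : chart_at F z -> chart_at F' z ->
  exists2 g, G g & exists2 r : R, 0 < r & forall w, cabs (w - z) < r -> F' w = F w *m g.
Proof.
have G1 : G 1%:M by exact: generated1.
have refl F'' : exists2 g, G g & exists2 r : R, 0 < r & forall w, cabs (w - z) < r -> F'' w = F'' w *m g.
  by exists 1%:M => //; exists 1 => // w _; rewrite mulmx1.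
have GM M : M = M0 \/ M = M1 -> G M by exact: gen_base.
have Gi M : M = M0 \/ M = M1 -> G (invmx M) by move=> h; apply: gen_inv => //; exact: GM.
have [n1 n2 n3 n4] := near_half z.
have case0 (F3 : C -> 'M[C]_3) M (P : C -> Prop) : M = M0 \/ M = M1 -> M \in unitmx -> im z != 0 ->
    (exists2 r : R, 0 < r & forall w, cabs (w - z) < r -> P w) ->
    (forall w, P w -> 0 < im w -> F3 w = F0 w) ->
    (forall w, P w -> im w < 0 -> F3 w = F0 w *m M) ->
    (exists2 g, G g & exists2 r : R, 0 < r & forall w, cabs (w - z) < r -> F3 w = F0 w *m g) /\
    (exists2 g, G g & exists2 r : R, 0 < r & forall w, cabs (w - z) < r -> F0 w = F3 w *m g).
  move=> hM uM y0 nP hp hn.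
  have [yp|yn|y00] := ltrgtP 0 (im z); last by rewrite -y00 eqxx in y0.
    have [r r0 hr] := near2 nP (n3 yp).
    by split; exists 1%:M => //; exists r => // w /hr[h1 h2]; rewrite mulmx1 hp.
  have [r r0 hr] := near2 nP (n4 yn).
  split; [exists M; first exact: GM | exists (invmx M); first exact: Gi];
    exists r => // w /hr[h1 h2]; rewrite hn ?mulmxK //.
have nz : U0 z -> (0 < re z < 1 -> False) -> im z != 0 by case=> // h /(_ h).
case=> -[Uz ->] [] [Uz' ->] //; rewrite /U1 /U2 in Uz Uz'.
- have y0 : im z != 0 by apply: nz Uz _ => /andP[h1 h2]; lra.
  by have [] := case0 F1 M0 _ (or_introl erefl) uM0 y0 (n1 Uz') h01 h10.
- have y0 : im z != 0 by apply: nz Uz _ => /andP[h1 h2]; lra.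
  by have [] := case0 F2 M1 _ (or_intror erefl) uM1 y0 (n2 Uz') h02 h20.
- have y0 : im z != 0 by apply: nz Uz' _ => /andP[h1 h2]; lra.
  by have [] := case0 F1 M0 _ (or_introl erefl) uM0 y0 (n1 Uz) h01 h10.
- by exfalso; lra.
- have y0 : im z != 0 by apply: nz Uz' _ => /andP[h1 h2]; lra.
  by have [] := case0 F2 M1 _ (or_intror erefl) uM1 y0 (n2 Uz) h02 h20.
- by exfalso; lra.
Qed.

(** A germ of solution has constant coordinates in a fundamental solution: this is
uniqueness for the system satisfied by its jet. *)
Lemma coord_exists F z w : chart_at F z -> solution_at alpha beta w z ->
  exists c : 'cV[C]_3, exists2 r : R, 0 < r & forall y, cabs (y - z) < r -> w y = (F y *m c) 0 0.
Proof.
move=> /chartP[U [[oU [nU0 nU1]] Uz sF uF cF]] sw.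
have z0 : z != 0 by apply: contra_notN nU0 => /eqP <-.
have z1 : z != 1 by apply: contra_notN nU1 => /eqP <-.
have [r r0 sr] := solution_sol z0 z1 sw.
have [r' r'0 hr'] := oU _ Uz.
pose D y := cabs (y - z) < r /\ cabs (y - z) < r'.
have oD : openC D by apply: openI; exact: open_disc.
have cD : convexC D by apply: convexI; exact: convex_disc.
have Dz : D z by rewrite /D subrr cabs0.
have cc : contmx a D by apply: contmx_coef => -[_ /hr'].
exists (invmx (F z) *m jet w z); have [s sp hs] := oD _ Dz; exists s => // y /hs Dy.
have [<- _ _] := jetE w y; congr (fun M : 'M[C]_(3, 1) => M 0 0).
apply: (@uniq_sol _ a 1 D (jet w) (fun y => F y *m (invmx (F z) *m jet w z)) z y) => //.
- by apply: sol_sub sr => x [].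
- by apply: sol_mulr; apply: sol_sub sF => x [_ /hr'].
- by rewrite mulKVmx // uF.
Qed.

Lemma coord_uniq F z k (c c' : 'M[C]_(3, k)) j : chart_at F z ->
  (exists2 r : R, 0 < r & forall y, cabs (y - z) < r -> (F y *m c) 0 j = (F y *m c') 0 j) ->
  forall i, c i j = c' i j.
Proof.
move=> /chartP[U [[oU [nU0 _]] Uz sF uF _]] [r r0 hr].
have H : forall i, (F z *m (c - c')) i j = 0.
  apply: (row0_inj oU nU0 (sol_mulr _ sF) Uz); exists r => // y /hr h.
  by rewrite mulmxBr mxE h [X in _ + X]mxE subrr.
have E : F z *m col j (c - c') = 0.
  by rewrite colE mulmxA -colE; apply/matrixP => i k'; rewrite mxE H mxE.
have := congr1 (mulmx (invmx (F z))) E; rewrite mulKmx ?uF // mulmx0 => /matrixP/(_ _ 0) h i.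
by have := h i; rewrite !mxE => /eqP; rewrite subr_eq0 => /eqP.
Qed.

Lemma coord_solution F z k (c : 'M[C]_(3, k)) j w : chart_at F z ->
  (exists2 r : R, 0 < r & forall y, cabs (y - z) < r -> w y = (F y *m c) 0 j) ->
  solution_at alpha beta w z.
Proof.
move=> /chartP[U [[oU [nU0 nU1]] Uz sF uF _]] [r r0 hr].
apply: (@sol_solution _ _ _ _ (fun y => U y /\ cabs (y - z) < r) (fun y => F y *m c) j).
- by apply: openI => //; exact: open_disc.
- by case=> /nU0.
- by case=> /nU1.
- by apply: sol_mulr; apply: sol_sub sF => y [].
- by move=> y [_ /hr].
- by rewrite subrr cabs0.
Qed.

Lemma eq_germP z (f g : C -> C) : eq_germ z f g <->
  exists2 r : R, 0 < r & forall y, cabs (y - z) < r -> f y = g y.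
Proof. exact: nbhs_cabs. Qed.


Definition base_point : C := ofR 2^-1.
Definition f0 (j : 'I_3) : C -> C := fun z => F0 z 0 j.
Let mono : set 'M[C]_3 := monodromy alpha beta base_point f0.

Lemma base0 : chart_at F0 base_point.
Proof. by constructor 1; split=> //; right; rewrite re_ofR; lra. Qed.

Lemma base_neq : base_point != 0 /\ base_point != 1.
Proof. by split; apply/eqP => /(congr1 (@re R)); rewrite ?re0 ?re1 re_ofR; lra. Qed.

Lemma fundamental_f0 : fundamental_system alpha beta base_point f0.
Proof.
split=> [j|w sw].
  apply: (@coord_solution F0 base_point 3 1%:M j _ base0).
  by exists 1 => // y _; rewrite mulmx1.
have [c [r r0 hr]] := coord_exists base0 sw.
exists c; split.
  apply/eq_germP; exists r => // y /hr ->; rewrite mxE; apply: eq_bigr => j _.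
  by rewrite /f0 mulrC.
move=> c' /eq_germP[s sp hs]; apply/matrixP => i j; rewrite ord1.
apply: (coord_uniq base0); exists (Num.min r s); first by rewrite lt_min r0 sp.
move=> y; rewrite lt_min => /andP[/hr <- /hs ->].
by rewrite mxE; apply: eq_bigr => l _; rewrite /f0 mulrC.
Qed.

Lemma nbhsR (t : R) (P : R -> Prop) : (\forall s \near t, P s) <->
  exists2 d : R, 0 < d & forall s, `|s - t| < d -> P s.
Proof.
split.
  move=> /nbhs_ballP[e /= e0 H]; exists e => // s hs; apply: H.
  by rewrite -ball_normE /ball_ /= distrC.
move=> [d d0 H]; apply/nbhs_ballP; exists d => //= s; rewrite -ball_normE /ball_ /= distrC.
exact: H.
Qed.

Definition pathc (g : R -> C) := forall t, 0 <= t <= 1 -> forall e, 0 < e ->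
  exists2 d : R, 0 < d & forall s, 0 <= s <= 1 -> `|s - t| < d -> cabs (g s - g t) < e.

Lemma pathcP (g : R -> C) : {within `[0, 1], continuous g} <-> pathc g.
Proof.
have itvE (s : R) : (`[0, 1]%classic : set R) s <-> 0 <= s <= 1 by rewrite /= in_itv.
split=> [/subspace_continuousP H t ht e e0|H].
  have := H t ((itvE t).2 ht) [set w | cabs (w - g t) < e].
  have hn : nbhs (g t) [set w | cabs (w - g t) < e] by apply/nbhs_cabs; exists e.
  move=> /(_ hn); rewrite /= /within => /nbhsR[d d0 hd].
  by exists d => // s hs hst; apply: hd => //; apply/itvE.
apply/subspace_continuousP => t /itvE ht A /nbhs_cabs[e e0 hA].
have [d d0 hd] := H t ht _ e0.
by apply/nbhsR; exists d => // s hst /itvE hs; apply: hA; exact: hd.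
Qed.

Lemma comb_germ z (n : nat) (f g : 'I_n -> C -> C) (m : 'I_n -> C) :
  (forall i, eq_germ z (f i) (g i)) ->
  eq_germ z (fun y => \sum_i m i * f i y) (fun y => \sum_i m i * g i y).
Proof.
move=> h; apply/eq_germP.
have [r r0 hr] : exists2 r : R, 0 < r & forall y, cabs (y - z) < r -> forall i, f i y = g i y.
  by apply: eventually_forall => i; apply/eq_germP.
by exists r => // y hy; apply: eq_bigr => i _; rewrite hr.
Qed.

Lemma germ_trans z (f g h : C -> C) : eq_germ z f g -> eq_germ z g h -> eq_germ z f h.
Proof.
move=> /eq_germP h1 /eq_germP h2; apply/eq_germP; have [r r0 hr] := near2 h1 h2.
by exists r => // y /hr[-> ->].
Qed.

Lemma germ_sym z (f g : C -> C) : eq_germ z f g -> eq_germ z g f.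
Proof. by move=> /eq_germP[r r0 hr]; apply/eq_germP; exists r => // y /hr ->. Qed.

Lemma germ_ext z (f g : C -> C) : f =1 g -> eq_germ z f g.
Proof. by move=> e; apply/eq_germP; exists 1. Qed.

Lemma germ_near z (f g : C -> C) : eq_germ z f g ->
  exists2 r : R, 0 < r & forall y, cabs (y - z) < r -> eq_germ y f g.
Proof.
move=> /eq_germP[r r0 hr]; exists r => // y hy; apply/eq_germP.
have [s sp hs] := open_disc hy; by exists s => // x /hs /hr.
Qed.

Lemma solution_comb z n (w : 'I_n -> C -> C) (m : 'I_n -> C) : z != 0 -> z != 1 ->
  (forall i, solution_at alpha beta (w i) z) ->
  solution_at alpha beta (fun y => \sum_i m i * w i y) z.
Proof.
move=> z0 z1 sw; have [F cF] := chart_exists z0 z1.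
have /choice[c hc] : forall i, exists c : 'cV[C]_3, eq_germ z (w i) (fun y => (F y *m c) 0 0).
  by move=> i; have [c h] := coord_exists cF (sw i); exists c; apply/eq_germP.
apply: (@coord_solution F z 1 (\sum_i m i *: c i) 0 _ cF); apply/eq_germP.
apply: germ_trans (comb_germ m hc) _; apply: germ_ext => y /=.
rewrite mulmx_sumr summxE; apply: eq_bigr => i _.
by rewrite -scalemxAr [RHS]mxE.
Qed.

(** At each parameter the continued germs are expressed in one of the three solutions
by a matrix of coordinates. The property that this matrix belongs to the
group generated by M0 and M1 does not depend on the chosen solution, and it is locally constant along
the loop; at the end of the loop the solution is F0 again. *)
Lemma mono_sub M : mono M -> G M.
Proof.
case=> gamma [/pathcP gc g0 g1 gn] /choice[w hw].
have gn' t : 0 <= t <= 1 -> gamma t != 0 /\ gamma t != 1 by exact: gn.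
pose P t := exists2 F, chart_at F (gamma t) & exists2 g, G g &
  forall j, eq_germ (gamma t) (w j t) (fun y => (F y *m g) 0 j).
(* membership in G does not depend on the chart in which coordinates are taken *)
have indep F z (c : 'M[C]_3) F' g' (v : 'I_3 -> C -> C) : chart_at F z -> chart_at F' z -> G g' ->
    (forall j, eq_germ z (v j) (fun y => (F' y *m g') 0 j)) ->
    (forall j, eq_germ z (v j) (fun y => (F y *m c) 0 j)) -> G c.
  move=> cF cF' Gg' h' h; have [k Gk [r r0 hr]] := chart_trans cF cF'.
  have -> : c = k *m g'.
    apply/matrixP => i j; apply: (coord_uniq cF).
    have /eq_germP hj := germ_trans (germ_sym (h j)) (h' j).
    have [s sp hs] := near2 hj (ex_intro2 _ _ r r0 hr).
    by exists s => // y /hs[-> ->]; rewrite mulmxA.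
  exact: gen_mul.
(* membership in G is locally constant along the loop *)
have loc : forall t, 0 <= t <= 1 -> P t.
  apply: locally_constant.
    exists F0; first by rewrite g0; exact: base0.
    exists 1%:M; first exact: generated1.
    move=> j; have [h _ _ _] := hw j; apply: germ_trans h _.
    by apply: germ_ext => y; rewrite mulmx1.
  move=> t ht; have [z0 z1] := gn' _ ht; have [F cF] := chart_exists z0 z1.
  have /choice[c hc] : forall j, exists c : 'cV[C]_3,
      eq_germ (gamma t) (w j t) (fun y => (F y *m c) 0 0).
    move=> j; have [_ _ h _] := hw j.
    by have [c k] := coord_exists cF (h _ ht); exists c; apply/eq_germP.
  pose cm : 'M[C]_3 := \matrix_(i, j) c j i 0.
  have hcm j : eq_germ (gamma t) (w j t) (fun y => (F y *m cm) 0 j).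
    apply: germ_trans (hc j) _; apply: germ_ext => y; rewrite !mxE.
    by apply: eq_bigr => l _; rewrite !mxE.
  have [U [[oU _] Uz _ _ cU]] := chartP cF.
  have [r0 r00 hr0] := oU _ Uz.
  have [r1 r10 hr1] : exists2 r : R, 0 < r & forall y, cabs (y - gamma t) < r ->
      forall j, eq_germ y (w j t) (fun y => (F y *m cm) 0 j).
    by apply: eventually_forall => j; exact: germ_near.
  have [d0 d00 hd0] := gc _ ht _ r00; have [d1 d10 hd1] := gc _ ht _ r10.
  have /choice[dj hdj] : forall j, exists d : R, 0 < d /\ forall s, `|s - t| < d -> 0 <= s <= 1 ->
      eq_germ (gamma s) (w j s) (w j t).
    by move=> j; have [_ _ _ /(_ _ ht)/nbhsR[d dp hd]] := hw j; exists d.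
  pose d := Num.min (Num.min d0 d1) (Num.min (dj 0) (Num.min (dj 1) (dj 2))).
  have dp : 0 < d by rewrite !lt_min d00 d10 !(hdj _).1.
  have key s : 0 <= s <= 1 -> `|s - t| < d -> chart_at F (gamma s) /\
      forall j, eq_germ (gamma s) (w j s) (fun y => (F y *m cm) 0 j).
    move=> hs; rewrite !lt_min => /andP[/andP[k0 k1] /and3P[m0 m1 m2]].
    split; first by apply: cU; apply: hr0; exact: hd0.
    have m j : `|s - t| < dj j by move: j; apply: ord3P.
    move=> j; apply: germ_trans ((hdj j).2 _ (m j) hs) _.
    by apply: hr1; exact: hd1.
  exists d; first exact: dp.
  move=> s s' hs hs' ks ks' [F' cF' [g' Gg' h'] ].
  have [cs es] := key _ hs ks; have [cs' es'] := key _ hs' ks'.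
  exists F; first exact: cs'.
  exists cm; last exact: es'.
  exact: (indep F (gamma s) cm F' g' (fun j => w j s) cs cF' Gg' h' es).
have [F cF [g Gg h]] := loc 1 ltac:(lra).
rewrite g1 in cF h.
apply: (indep F0 base_point M F g (fun j => w j 1) base0 cF Gg h) => j.
have [_ k _ _] := hw j; rewrite g1 in k; apply: germ_trans k _.
by apply: germ_ext => y; rewrite mxE; apply: eq_bigr => i _; rewrite /f0 mulrC.
Qed.

Lemma mono1 : mono 1%:M.
Proof.
have [b0 b1] := base_neq.
exists (fun=> base_point).
  split; [|by []|by []|by []].
  by apply/pathcP => t _ e e0; exists 1 => // s _ _; rewrite subrr cabs0.
move=> j; exists (fun _ => f0 j); split.
- exact: germ_ext.
- apply: germ_ext => y; rewrite (bigD1 j) //= mxE eqxx mul1r big1 ?addr0 // => i ij.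
  by rewrite mxE (negbTE ij) mul0r.
- by move=> t _; exact: (fundamental_f0.1 j).
- by move=> t _; apply/nbhsR; exists 1 => // s _ _; exact: germ_ext.
Qed.

(** The loop of B comes first: continuation of a combination along the loop of A is the
combination of the continuations, so the coordinates of B are multiplied by A on the
left. *)
Lemma monoM A B : mono A -> mono B -> mono (A *m B).
Proof.
case=> g2 [/pathcP c2 g20 g21 gn2] h2 [g1 [/pathcP c1 g10 g11 gn1] h1].
exists (fun t => if t <= 2^-1 then g1 (2 * t) else g2 (2 * t - 1)).
  split.
  - apply/pathcP => t ht e e0.
    case: (ltrgtP t 2^-1) => ht2.
    + have [d d0 hd] := c1 (2 * t) ltac:(lra) _ e0.
      exists (Num.min (d / 2) (2^-1 - t)); first by rewrite lt_min; lra.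
      move=> s hs; rewrite lt_min !ltr_norml => /andP[k1 k2].
      have -> : s <= 2^-1 by lra.
      by apply: hd; rewrite ?ltr_norml; lra.
    + have [d d0 hd] := c2 (2 * t - 1) ltac:(lra) _ e0.
      exists (Num.min (d / 2) (t - 2^-1)); first by rewrite lt_min; lra.
      move=> s hs; rewrite lt_min !ltr_norml => /andP[k1 k2].
      have /negbTE -> : ~~ (s <= 2^-1) by rewrite -ltNge; lra.
      by apply: hd; rewrite ?ltr_norml; lra.
    + rewrite ht2 (_ : 2 * 2^-1 = 1); last by rewrite mulfV.
      have [d d0 hd] := c1 1 ltac:(lra) _ e0; have [d' d'0 hd'] := c2 0 ltac:(lra) _ e0.
      exists (Num.min (d / 2) (d' / 2)); first by rewrite lt_min; lra.
      move=> s hs; rewrite lt_min !ltr_norml => /andP[k1 k2].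
      case: (leP s 2^-1) => sh; first by apply: hd; rewrite ?ltr_norml; lra.
      by rewrite g11 -g20; apply: hd'; rewrite ?ltr_norml; lra.
  - by have -> : (0 : R) <= 2^-1 by []; rewrite mulr0.
  - have /negbTE -> : ~~ ((1 : R) <= 2^-1) by rewrite -ltNge; lra.
    by rewrite (_ : 2 * 1 - 1 = 1) //; ring.
  - move=> t ht; case: (leP t 2^-1) => h; [apply: gn1 | apply: gn2]; lra.
have {h1}/choice[w1 h1] := h1; have {h2}/choice[w2 h2] := h2.
move=> j.
exists (fun t => if t <= 2^-1 then w1 j (2 * t) else
  fun y => \sum_i B i j * w2 i (2 * t - 1) y).
split.
- have -> : (0 : R) <= 2^-1 by []; rewrite mulr0; have [k _ _ _] := h1 j; exact: k.
- have /negbTE -> : ~~ ((1 : R) <= 2^-1) by rewrite -ltNge; lra.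
  rewrite (_ : 2 * 1 - 1 = 1 :> R); last by ring.
  have kk i : eq_germ (g2 1) (w2 i 1) (fun z => \sum_l A l i * f0 l z).
    by have [_ x _ _] := h2 i; exact: x.
  apply: germ_trans (comb_germ (fun i => B i j) kk) _.
  apply: germ_ext => y /=.
  under eq_bigr do rewrite mulr_sumr.
  rewrite exchange_big /=; apply: eq_bigr => k _; rewrite mxE mulr_suml.
  by apply: eq_bigr => i _; ring.
- move=> t ht; case: (leP t 2^-1) => h; first by have [_ _ k _] := h1 j; apply: k; lra.
  have tt : 0 <= 2 * t - 1 <= 1 by lra.
  have [z0 z1] := gn2 _ tt.
  by apply: solution_comb => // i; have [_ _ k _] := h2 i; exact: k.
move=> t ht; apply/nbhsR; case: (ltrgtP t 2^-1) => ht2.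
- have [_ _ _ /(_ (2 * t) ltac:(lra))/nbhsR[d d0 hd]] := h1 j.
  exists (Num.min (d / 2) (2^-1 - t)); first by rewrite lt_min; lra.
  move=> s; rewrite lt_min !ltr_norml => /andP[k1 k2] hs.
  have -> : s <= 2^-1 by lra.
  by apply: hd; rewrite ?ltr_norml; lra.
- have /choice[d hd] : forall i, exists d : R, 0 < d /\ forall s, `|s - (2 * t - 1)| < d ->
      0 <= s <= 1 -> eq_germ (g2 s) (w2 i s) (w2 i (2 * t - 1)).
    by move=> i; have [_ _ _ /(_ (2 * t - 1) ltac:(lra))/nbhsR[d dp hd]] := h2 i; exists d.
  exists (Num.min (t - 2^-1) (Num.min (d 0 / 2) (Num.min (d 1 / 2) (d 2 / 2)))).
    by have := (hd 0).1; have := (hd 1).1; have := (hd 2).1; rewrite !lt_min; lra.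
  move=> s; rewrite !lt_min => /and4P[k m0 m1 m2] hs; move: k; rewrite ltr_norml => k.
  have /negbTE -> : ~~ (s <= 2^-1) by rewrite -ltNge; lra.
  have m i : `|s - t| < d i / 2 by move: i; apply: ord3P.
  apply: comb_germ => i; apply: (hd i).2; last lra.
  by have := m i; rewrite !ltr_norml; lra.
rewrite ht2 (_ : 2 * 2^-1 = 1) ?mulfV //.
have [_ e1 _ /(_ 1 ltac:(lra))/nbhsR[d d0 hd]] := h1 j.
have /choice[d2 hd2] : forall i, exists d : R, 0 < d /\ forall s, `|s - 0| < d ->
    0 <= s <= 1 -> eq_germ (g2 s) (w2 i s) (w2 i 0).
  by move=> i; have [_ _ _ /(_ 0 ltac:(lra))/nbhsR[d' dp hd']] := h2 i; exists d'.
have E : eq_germ base_point (fun y => \sum_i B i j * w2 i 0 y) (w1 j 1).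
  rewrite g11 in e1; apply: germ_trans (germ_sym e1).
  by apply: comb_germ => i; have [k _ _ _] := h2 i; rewrite g20 in k; exact: k.
have [r r0 hr] := germ_near E.
have [d3 d30 hd3] := c2 0 ltac:(lra) _ r0.
exists (Num.min (Num.min (d / 2) (d3 / 2)) (Num.min (d2 0 / 2) (Num.min (d2 1 / 2) (d2 2 / 2)))).
  by have := (hd2 0).1; have := (hd2 1).1; have := (hd2 2).1; rewrite !lt_min; lra.
move=> s; rewrite !lt_min => /andP[/andP[k1 k2] /and3P[m0 m1 m2]] hs.
move: k1 k2; rewrite !ltr_norml => k1 k2.
case: (leP s 2^-1) => sh; first by apply: hd; rewrite ?ltr_norml; lra.
have hs' : 0 <= 2 * s - 1 <= 1 by lra.
have m i : `|s - 2^-1| < d2 i / 2 by move: i; apply: ord3P.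
apply: germ_trans (comb_germ (fun i => B i j) (_ : forall i, eq_germ _ (w2 i _) (w2 i 0))) _.
  move=> i; apply: (hd2 i).2 => //.
  by have := m i; rewrite !ltr_norml; lra.
apply: hr; rewrite -g20; apply: hd3 => //; rewrite ltr_norml; lra.
Qed.

(** The reversed loop. The continuation along it is corrected by the inverse matrix
so that it starts at the given fundamental system. *)
Lemma monoV A : A \in unitmx -> mono A -> mono (invmx A).
Proof.
move=> uA [g [/pathcP c g0 g1 gn] /choice[w h]].
exists (fun t => g (1 - t)).
  split; last by move=> t ht; apply: gn; lra.
  - apply/pathcP => t ht e e0; have [d d0 hd] := c (1 - t) ltac:(lra) _ e0.
    exists d => // s hs hst; apply: hd; first lra.
    by rewrite (_ : 1 - s - (1 - t) = - (s - t)) ?normrN //; ring.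
  - by rewrite subr0.
  - by rewrite subrr.
move=> j; exists (fun t y => \sum_i invmx A i j * w i (1 - t) y); split.
- rewrite subr0.
  have kk i : eq_germ (g 1) (w i 1) (fun z => \sum_l A l i * f0 l z).
    by have [_ x _ _] := h i; exact: x.
  apply: germ_trans (comb_germ (fun i => invmx A i j) kk) _.
  apply: germ_ext => y /=.
  under eq_bigr do rewrite mulr_sumr.
  rewrite exchange_big /= (bigD1 j) //= [X in _ + X]big1 ?addr0 => [|k kj].
    rewrite -[RHS]mul1r (_ : 1 = (A *m invmx A) j j); last by rewrite mulmxV // mxE eqxx.
    by rewrite mxE mulr_suml; apply: eq_bigr => i _; ring.
  rewrite (_ : \sum_i _ = (A *m invmx A) k j * f0 k y); last first.
    by rewrite mxE mulr_suml; apply: eq_bigr => i _; ring.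
  by rewrite mulmxV // mxE (negbTE kj) mul0r.
- rewrite subrr; apply: (comb_germ (fun i => invmx A i j)) => i; have [k _ _ _] := h i; exact: k.
- move=> t ht; have tt : 0 <= 1 - t <= 1 by lra.
  have [z0 z1] := gn _ tt.
  by apply: solution_comb => // i; have [_ _ k _] := h i; exact: k.
move=> t ht; apply/nbhsR.
have /choice[d hd] : forall i, exists d : R, 0 < d /\ forall s, `|s - (1 - t)| < d ->
    0 <= s <= 1 -> eq_germ (g s) (w i s) (w i (1 - t)).
  by move=> i; have [_ _ _ /(_ (1 - t) ltac:(lra))/nbhsR[d dp hd]] := h i; exists d.
exists (Num.min (d 0) (Num.min (d 1) (d 2))).
  by rewrite !lt_min !(hd _).1.
move=> s; rewrite !lt_min => /and3P[m0 m1 m2] hs.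
have m i : `|s - t| < d i by move: i; apply: ord3P.
apply: comb_germ => i; apply: (hd i).2; last lra.
by rewrite (_ : 1 - s - (1 - t) = - (s - t)) ?normrN //; ring.
Qed.

End Monodromy.

(** * Loops around the singular points *)

Section Trigonometry.
Variable R : realType.
Implicit Types x : R.

Lemma sin_neg x : pi < x < 2 * pi -> sin x < 0.
Proof.
move=> hx; have -> : x = (x - pi) + pi by ring.
by rewrite sinDpi oppr_lt0; apply: sin_gt0_pi; lra.
Qed.

Lemma cos_neg x : pi / 2 < x < 3 * pi / 2 -> cos x < 0.
Proof.
move=> hx; have -> : x = (x - pi) + pi by ring.
by rewrite cosDpi oppr_lt0; apply: cos_gt0_pihalf; lra.
Qed.

Lemma cos_pi3 : cos (pi / 3) = 2^-1 :> R.
Proof.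
have p := pi_gt0 R.
have c0 : 0 < cos (pi / 3 : R) by apply: cos_gt0_pihalf; lra.
have : cos (pi / 3 + (pi / 3 + pi / 3) : R) = -1.
  by rewrite -[RHS]cospi; congr cos; field.
rewrite !cosD !sinD.
have := cos2Dsin2 (pi / 3 : R).
move: (cos _) (sin _) c0 => c s c0 e1.
have -> : c * (c * c - s * s) - s * (s * c + c * s) = 4 * c ^+ 3 - 3 * c.
  have -> : c * (c * c - s * s) - s * (s * c + c * s) = c ^+ 3 - 3 * c * s ^+ 2 by ring.
  by rewrite (_ : s ^+ 2 = 1 - c ^+ 2); [ring | lra].
move=> h; have : (c + 1) * (2 * c - 1) ^+ 2 = 0.
  by rewrite (_ : _ * _ = 4 * c ^+ 3 - 3 * c + 1); [lra | ring].
move/eqP; rewrite mulf_eq0 sqrf_eq0 => /orP[] /eqP; lra.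
Qed.

Lemma sin_pi3 : sin (pi / 3) = Num.sqrt 3 / 2 :> R.
Proof.
have p := pi_gt0 R.
have s0 : 0 < sin (pi / 3 : R) by apply: sin_gt0_pi; lra.
have := cos2Dsin2 (pi / 3 : R); rewrite cos_pi3 => e.
have : (2 * sin (pi / 3 : R)) ^+ 2 = 3 by rewrite exprMn; lra.
move=> h; suff -> : Num.sqrt 3 = 2 * sin (pi / 3 : R) by field.
by rewrite -[LHS]/(Num.sqrt _) -[X in Num.sqrt X]h sqrtr_sqr ger0_norm // mulr_ge0 // ltW.
Qed.

(** In the logarithmic coordinate s this gives points of the half-plane re z > 1: when
re s > 1, the modulus of exp s exceeds 2. *)
Lemma cos_gt_half x : - (pi / 3) < x < pi / 3 -> 2^-1 < cos x.
Proof.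
move=> hx; have p := pi_gt0 R; rewrite -cos_pi3 -(cos_norm x).
have hn : `|x| < pi / 3 by rewrite ltr_norml.
have k1 : `|x| \in `[0, pi] by rewrite in_itv /= normr_ge0 /=; lra.
have k2 : pi / 3 \in `[0, pi : R] by rewrite in_itv /=; lra.
by rewrite ltr_cos.
Qed.

Lemma expiD x y : expi (x + y) = expi x * expi y.
Proof.
apply: cplx_eq; rewrite ?(reM, imM, re_expi, im_expi); first by rewrite cosD.
by rewrite sinD; ring.
Qed.

Lemma expi0 : expi (0 : R) = 1.
Proof. by apply: cplx_eq; rewrite ?(re_expi, im_expi) ?cos0 ?sin0. Qed.

Lemma expi2pi : expi (2 * pi : R) = 1.
Proof. by apply: cplx_eq; rewrite ?(re_expi, im_expi) mulr_natl ?cos2pi ?sin2pi. Qed.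

Lemma cabs_expi x : cabs (expi x) = 1.
Proof. by rewrite /cabs re_expi im_expi cos2Dsin2 sqrtr1. Qed.

Lemma real_cont (f : R -> R) : continuous f -> forall t e, 0 < e ->
  exists2 d : R, 0 < d & forall s, `|s - t| < d -> `|f s - f t| < e.
Proof.
move=> cf t e e0; have /cvgrPdist_lt/(_ _ e0)/nbhsR[d d0 hd] := cf t.
by exists d => // s /hd; rewrite distrC.
Qed.

End Trigonometry.

Section Loops.
Variable R : realType.
Local Notation C := (Cplx R).
Variables alpha beta : 'I_3 -> C.
Let a := coef (residue0 beta) (residue1 alpha beta).
Variables (F0 F : C -> 'M[C]_3) (M : 'M[C]_3) (U : C -> Prop) (x0 sg : R).
Hypotheses (s0 : sol a (@U0 R) F0) (sF : sol a U F).
Hypotheses (oU : openC U) (nU0 : ~ U 0) (nU1 : ~ U 1).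
Hypothesis hb : x0 + sg / 2 = 2^-1.
Hypothesis hU : forall z, (re z - x0) * sg < 0 -> U z.
Hypothesis hp : forall z, (re z - x0) * sg < 0 -> 0 < im z -> F z = F0 z.
Hypothesis hn : forall z, (re z - x0) * sg < 0 -> im z < 0 -> F z = F0 z *m M.
Hypothesis sg1 : sg ^+ 2 = 1.

Let g (t : R) : C := (x0 + sg * cos (2 * pi * t) / 2) +i* (sin (2 * pi * t) / 2).

Let g_im_pos t : 0 < t < 2^-1 -> 0 < im (g t).
Proof.
move=> ht; have p := pi_gt0 R; rewrite im_cplx divr_gt0 //; apply: sin_gt0_pi.
by apply/andP; split; nra.
Qed.
Let g_im_neg t : 2^-1 < t < 1 -> im (g t) < 0.
Proof.
move=> ht; have p := pi_gt0 R; rewrite im_cplx.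
have : sin (2 * pi * t) < 0 by apply: sin_neg; apply/andP; split; nra.
lra.
Qed.
Let g_re t : 4^-1 < t < 3 / 4 -> (re (g t) - x0) * sg < 0.
Proof.
move=> ht; have p := pi_gt0 R; rewrite re_cplx.
have h : cos (2 * pi * t) < 0 by apply: cos_neg; apply/andP; split; nra.
have -> : (x0 + sg * cos (2 * pi * t) / 2 - x0) * sg = sg ^+ 2 * (cos (2 * pi * t) / 2) by field.
by rewrite sg1; lra.
Qed.
Let baseU0 : U0 (base_point R).
Proof. by right; rewrite re_ofR; lra. Qed.

Let g_0 : g 0 = base_point R.
Proof. by rewrite /g mulr0 cos0 sin0 mulr1 hb mul0r. Qed.
Let g_1 : g 1 = base_point R.
Proof. by rewrite /g mulr1 mulr_natl cos2pi sin2pi mulr1 hb mul0r. Qed.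

Let g_U0 t : 0 <= t <= 3^-1 \/ 2 / 3 <= t <= 1 -> U0 (g t).
Proof.
have [->|t0] := eqVneq t 0; first by move=> _; rewrite g_0; exact: baseU0.
have [->|t1] := eqVneq t 1; first by move=> _; rewrite g_1; exact: baseU0.
have tt0 : 0 <= t -> 0 < t by rewrite lt_def t0.
have tt1 : t <= 1 -> t < 1 by rewrite lt_def eq_sym t1.
case=> h; left.
  have tp : 0 < t by apply: tt0; lra.
  by rewrite gt_eqF //; apply: g_im_pos; lra.
have tp : t < 1 by apply: tt1; lra.
by rewrite lt_eqF //; apply: g_im_neg; lra.
Qed.
Let g_U t : 3^-1 <= t <= 2 / 3 -> U (g t).
Proof. by move=> ht; apply: hU; apply: g_re; lra. Qed.

Let nU00 : ~ U0 (0 : C) /\ ~ U0 (1 : C).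
Proof. by split; case; rewrite ?(im0, im1, eqxx, re0, re1, ltxx) ?andbF. Qed.

Let near_side z : (re z - x0) * sg < 0 ->
  exists2 r : R, 0 < r & forall w, cabs (w - z) < r -> (re w - x0) * sg < 0.
Proof.
move=> h; have hh : half sg 0 (sg * x0) z by rewrite /half; lra.
have [r r0 hr] := open_half hh.
by exists r => // w /hr; rewrite /half; lra.
Qed.

(** A circle of radius 1/2 about x0 based at 1/2, with x0 = 0 and sg = 1, or x0 = 1 and sg = -1. The
continuation is F0 on the first third, the solution F of the half-plane on the
second one and F0 M on the last one; the changes take place where the circle is in
the upper and in the lower half of the overlap. *)
Lemma loop_monodromy : monodromy alpha beta (base_point R) (f0 F0) M.
Proof.
have hsol0 j t : U0 (g t) -> solution_at alpha beta (fun y => F0 y 0 j) (g t).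
  move=> h; refine (@sol_solution R alpha beta 3 (@U0 R) F0 j (fun y => F0 y 0 j) (g t) (@open_U0 R) nU00.1 nU00.2 s0 (fun y _ => erefl) h).
have hsol1 j t : U (g t) -> solution_at alpha beta (fun y => F y 0 j) (g t).
  move=> h; exact: (@sol_solution _ alpha beta _ _ _ j (fun y => F y 0 j) _ oU nU0 nU1 sF (fun y _ => erefl) h).
have hsol2 j t : U0 (g t) -> solution_at alpha beta (fun y => (F0 y *m M) 0 j) (g t).
  move=> h; refine (@sol_solution R alpha beta 3 (@U0 R) (fun y => F0 y *m M) j (fun y => (F0 y *m M) 0 j) (g t) (@open_U0 R) nU00.1 nU00.2 (sol_mulr M s0) (fun y _ => erefl) h).
have zone t : 0 <= t <= 1 -> U0 (g t) \/ U (g t).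
  move=> ht; case: (lerP t 3^-1) => h1; first by left; apply: g_U0; left; lra.
  case: (lerP t (2 / 3)) => h2; first by right; apply: g_U; lra.
  by left; apply: g_U0; right; lra.
exists g.
  split=> [| | |t /zone h].
  - apply/pathcP => t ht e e0.
    have cc : continuous (fun t : R => cos (2 * pi * t)).
      by move=> x; apply: continuous_comp; [exact: mulrl_continuous | exact: continuous_cos].
    have cs : continuous (fun t : R => sin (2 * pi * t)).
      by move=> x; apply: continuous_comp; [exact: mulrl_continuous | exact: continuous_sin].
    have [d d0 hd] := real_cont cc t e0; have [d' d'0 hd'] := real_cont cs t e0.
    exists (Num.min d d'); first by rewrite lt_min d0 d'0.
    move=> s _; rewrite lt_min => /andP[/hd k1 /hd' k2].
    apply: le_lt_trans (cabs_reim _) _; rewrite reB imB /g !re_cplx !im_cplx.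
    have -> : x0 + sg * cos (2 * pi * s) / 2 - (x0 + sg * cos (2 * pi * t) / 2) =
       sg * ((cos (2 * pi * s) - cos (2 * pi * t)) / 2) by field.
    have -> : sin (2 * pi * s) / 2 - sin (2 * pi * t) / 2 =
       (sin (2 * pi * s) - sin (2 * pi * t)) / 2 by field.
    have n1 : `|sg| = 1.
      by apply/eqP; rewrite -(pexpr_eq1 (n := 2)) ?normr_ge0 // -normrX sg1 normr1.
    by rewrite !normrM n1 mul1r (_ : `|2^-1| = 2^-1); [lra | rewrite ger0_norm ?invr_ge0].
  - exact: g_0.
  - exact: g_1.
  - by case: h => h; split; apply/eqP => e; rewrite e in h; [case: nU00.1 | case: nU00.2 | case: nU0 | case: nU1].
move=> j; exists (fun t y => if t <= 3^-1 then F0 y 0 j else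
   if t <= 2 / 3 then F y 0 j else (F0 y *m M) 0 j).
have t13 : (3^-1 <= 2 / 3 :> R) by lra.
split.
- have -> : (0 : R) <= 3^-1 by []; exact: germ_ext.
- have /negbTE -> : ~~ ((1 : R) <= 3^-1) by rewrite -ltNge; lra.
  have /negbTE -> : ~~ ((1 : R) <= 2 / 3) by rewrite -ltNge; lra.
  by apply: germ_ext => y; rewrite mxE; apply: eq_bigr => i _; rewrite /f0 mulrC.
- move=> t ht; case: (lerP t 3^-1) => h1; first by apply: hsol0; apply: g_U0; left; lra.
  case: (lerP t (2 / 3)) => h2; first by apply: hsol1; apply: g_U; lra.
  by apply: hsol2; apply: g_U0; right; lra.
have germ1 s : 4^-1 < s < 2^-1 -> eq_germ (g s) (fun y => F y 0 j) (fun y => F0 y 0 j).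
  move=> hs; have h1 := g_re (t := s) ltac:(lra); have h2 := g_im_pos (t := s) ltac:(lra).
  have [_ _ k _] := near_half (g s); have [r r0 hr] := near2 (near_side h1) (k h2).
  by apply/eq_germP; exists r => // y /hr[y1 y2]; rewrite hp.
have germ2 s : 2^-1 < s < 3 / 4 -> eq_germ (g s) (fun y => F y 0 j) (fun y => (F0 y *m M) 0 j).
  move=> hs; have h1 := g_re (t := s) ltac:(lra); have h2 := g_im_neg (t := s) ltac:(lra).
  have [_ _ _ k] := near_half (g s); have [r r0 hr] := near2 (near_side h1) (k h2).
  by apply/eq_germP; exists r => // y /hr[y1 y2]; rewrite hn.
move=> t ht; apply/nbhsR; case: (ltrgtP t 3^-1) => h1.
- exists (3^-1 - t) => [|s hs hs']; first lra; move: hs; rewrite ltr_norml => hs.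
  by have -> : s <= 3^-1 by [lra]; exact: germ_ext.
- case: (ltrgtP t (2 / 3)) => h2.
  + exists (Num.min (t - 3^-1) (2 / 3 - t)) => [|s]; first by rewrite lt_min; lra.
    rewrite lt_min !ltr_norml => hs hs'.
    have /negbTE -> : ~~ (s <= 3^-1) by rewrite -ltNge; lra.
    by have -> : s <= 2 / 3 by [lra]; exact: germ_ext.
  + exists (t - 2 / 3) => [|s]; first lra; rewrite ltr_norml => hs hs'.
    have /negbTE -> : ~~ (s <= 3^-1) by rewrite -ltNge; lra.
    by have /negbTE -> : ~~ (s <= 2 / 3) by [rewrite -ltNge; lra]; exact: germ_ext.
  + exists (12^-1) => [|s]; first lra; rewrite ltr_norml => hs hs'.
    have /negbTE -> : ~~ (s <= 3^-1) by rewrite -ltNge; lra.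
    case: (lerP s (2 / 3)) => h3; first exact: germ_ext.
    by apply: germ_sym; apply: germ2; lra.
- exists (12^-1) => [|s]; first lra; rewrite ltr_norml => hs hs'.
  case: (lerP s 3^-1) => h3; first exact: germ_ext.
  have -> : s <= 2 / 3 by lra.
  by apply: germ1; lra.
Qed.

End Loops.

(** * The logarithmic coordinate *)

Section ComplexExp.
Variable R : realType.
Local Notation C := (Cplx R).

Lemma real_hasd (f : R -> R) (x d : R) : is_derive x 1 f d -> forall e, 0 < e ->
  exists2 r : R, 0 < r & forall h, `|h| < r -> `|f (x + h) - f x - h * d| <= e * `|h|.
Proof.
move=> [df dd] e e0.
have H : (fun h : R => h^-1 *: ((f \o shift x) (h *: 1) - f x)) @ 0^' --> d by rewrite -dd.
have /cvgrPdist_lt/(_ _ e0) := H; rewrite /= => /nbhsR[r r0 hr].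
exists r => // h hh; have [->|h0] := eqVneq h 0.
  by rewrite addr0 subrr mul0r subrr normr0 mulr0.
have := hr h; rewrite subr0 => /(_ hh h0) /ltW.
have p0 : 0 < `|h| by rewrite normr_gt0.
rewrite -(ler_pM2r p0) -normrM => k; apply: le_trans k.
rewrite -normrN le_eqVlt; apply/orP; left; apply/eqP; congr (`| _ |).
rewrite -[_ *: 1]/(h * 1) mulr1 [x + h]addrC -[_ *: _]/(h^-1 * _) mulrBl mulrAC mulVf // mul1r.
ring.
Qed.

Lemma re_cexp (z : C) : re (cexp z) = expR (re z) * cos (im z).
Proof. by rewrite /cexp reM re_ofR im_ofR mul0r subr0. Qed.
Lemma im_cexp (z : C) : im (cexp z) = expR (re z) * sin (im z).
Proof. by rewrite /cexp imM re_ofR im_ofR mul0r addr0. Qed.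

Lemma cexpD (z w : C) : cexp (z + w) = cexp z * cexp w.
Proof. by rewrite /cexp -[complex.Re (z + w)]/(re (z + w)) -[complex.Im (z + w)]/(im (z + w)) reD imD expRD ofRM expiD; ring. Qed.

Lemma cexp0 : cexp (0 : C) = 1.
Proof. by apply: cplx_eq; rewrite ?(re_cexp, im_cexp) re0 im0 expR0 ?cos0 ?sin0 mul1r. Qed.

Lemma cexp_neq0 (z : C) : cexp z != 0.
Proof.
apply/eqP => h; have := cexpD z (- z); rewrite subrr cexp0 h mul0r => /eqP.
by rewrite oner_eq0.
Qed.

Lemma cabs_cexp (z : C) : cabs (cexp z) = expR (re z).
Proof. by rewrite /cexp cabsM cabs_expi mulr1 cabs_ofR ger0_norm ?expR_ge0. Qed.

Lemma cexp2pi (z : C) : cexp (z + 0 +i* (2 * pi)) = cexp z.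
Proof.
rewrite cexpD (_ : cexp (0 +i* _) = 1) ?mulr1 //.
by rewrite /cexp -[complex.Re _]/(0 : R) expR0 ofR1 mul1r -[complex.Im _]/(2 * pi : R) expi2pi.
Qed.

(** The derivative at 0 comes from those of the real exponential, sine and cosine; the
addition formula transports it to all points. *)
Lemma cexp_hasd0 : hasd (@cexp R) 0 1.
Proof.
apply/hasdP => e e0.
pose d := Num.min (e / 6) 1.
have d0 : 0 < d by rewrite lt_min; lra.
have de : d <= e / 6 by rewrite ge_min lexx.
have d1 : d <= 1 by rewrite ge_min lexx orbT.
have [r1 r10 h1] := real_hasd (is_derive_expR 0) d0.
have [r2 r20 h2] := real_hasd (is_derive_cos 0) d0.
have [r3 r30 h3] := real_hasd (is_derive_sin 0) d0.
exists (Num.min (d / 2) (Num.min r1 (Num.min r2 r3))); first by rewrite !lt_min r10 r20 r30; lra.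
move=> h; rewrite !lt_min => /and4P[k k1 k2 k3]; rewrite add0r cexp0 mulr1.
have x := cabs_re h; have y := cabs_im h.
have := h1 _ (le_lt_trans x k1); have := h2 _ (le_lt_trans y k2); have := h3 _ (le_lt_trans y k3).
rewrite !add0r expR0 cos0 sin0 oppr0 !mulr1 !mulr0 !subr0 ?addr0.
set E := expR _; set c := cos _; set s := sin _ => es ec eE.
set N := cabs h in x y k *.
have N0 : 0 <= N by exact: cabs_ge0.
have x0 := normr_ge0 (re h); have y0 := normr_ge0 (im h).
have E1 : `|E - 1| <= d.
  rewrite (_ : E - 1 = (E - 1 - re h) + re h); last by ring.
  have := ler_normD (E - 1 - re h) (re h).
  have : d * `|re h| <= `|re h| by rewrite ler_piMl.
  lra.
have E2 : `|E| <= 2.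
  rewrite (_ : E = (E - 1) + 1); last by ring.
  have := ler_normD (E - 1) 1; rewrite normr1; lra.
apply: le_trans (cabs_reim _) _; rewrite !reB !imB re1 im1 re_cexp im_cexp -/E -/c -/s subr0.
have dN : d * N <= e / 6 * N by apply: ler_wpM2r.
have q1 : `|E * c - 1 - re h| <= 3 * (d * N).
  rewrite (_ : _ - _ = (E - 1 - re h) + E * (c - 1)); last by ring.
  apply: le_trans (ler_normD _ _) _; rewrite normrM.
  have : `|E| * `|c - 1| <= 2 * (d * `|im h|) by apply: ler_pM.
  have : d * `|re h| <= d * N by rewrite ler_pM2l.
  have : d * `|im h| <= d * N by rewrite ler_pM2l.
  lra.
have q2 : `|E * s - im h| <= 3 * (d * N).
  rewrite (_ : _ - _ = E * (s - im h) + (E - 1) * im h); last by ring.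
  apply: le_trans (ler_normD _ _) _; rewrite !normrM.
  have : `|E| * `|s - im h| <= 2 * (d * `|im h|) by apply: ler_pM.
  have : `|E - 1| * `|im h| <= d * N by apply: ler_pM.
  have : d * `|im h| <= d * N by rewrite ler_pM2l.
  lra.
lra.
Qed.

Lemma cexp_hasd (z : C) : hasd (@cexp R) z (cexp z).
Proof.
have h : hasd (fun w => w + - z) z 1.
  by have := hasdD (hasd_id z) (hasd_cst (- z) z); rewrite addr0.
have h' : hasd (@cexp R) (z + - z) 1 by rewrite subrr; exact: cexp_hasd0.
have := hasdZ (cexp z) (hasd_comp h h'); rewrite !mulr1; apply: hasd_ext => w.
by rewrite -cexpD addrC subrK.
Qed.

Lemma cexpM_hasd (m z : C) : hasd (fun s => cexp (m * s)) z (m * cexp (m * z)).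
Proof.
have h : hasd (fun s => m * s) z m by have := hasdZ m (hasd_id z); rewrite mulr1.
exact: (hasd_comp h (cexp_hasd (m * z))).
Qed.

End ComplexExp.

Section Pullback.
Variable R : realType.
Local Notation C := (Cplx R).
Variables C0 C1 : 'M[C]_3.
Let a := coef C0 C1.

(** The coefficient of the system in the coordinate s = log z. The powers z^mu become
single valued there, and continuation around 0 is the translation by 2 pi i. *)
Definition logcoef (s : C) : 'M[C]_3 := cexp s *: coef C0 C1 (cexp s).

Lemma sol_exp k (D : C -> Prop) (Y : C -> 'M[C]_(3, k)) :
  sol a D Y -> sol logcoef (fun s => D (cexp s)) (fun s => Y (cexp s)).
Proof.
move=> sY s Ds i j; rewrite /logcoef -scalemxAl mxE.
exact: (hasd_comp (cexp_hasd s) (sY _ Ds i j)).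
Qed.

Lemma contmx_log (D : C -> Prop) : (forall s, D s -> cexp s != 1) -> contmx logcoef D.
Proof.
move=> D1 s Ds i j.
apply: (@cont_near _ (fun w => cexp w * (coef C0 C1 (cexp w)) i j)).
  by exists 1 => // w _; rewrite /logcoef [RHS]mxE.
apply: contM; first exact: hasd_cont (cexp_hasd s).
apply: (@cont_comp _ (fun w => coef C0 C1 w i j)); first exact: hasd_cont (cexp_hasd s).
apply: (@contmx_coef _ _ _ (fun z => z != 0 /\ z != 1)); try by case; rewrite eqxx.
by split; [exact: cexp_neq0 | exact: D1].
Qed.

(** Uniqueness in the logarithmic coordinate: a solution E on a convex region of the
s-plane that starts as F times a constant vector stays so. *)
Lemma transport k (D U : C -> Prop) (F : C -> 'M[C]_3) (E : C -> 'M[C]_(3, k)) p (c : 'M[C]_(3, k)) :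
  openC D -> convexC D -> (forall s, D s -> cexp s != 1) -> (forall s, D s -> U (cexp s)) ->
  sol a U F -> sol logcoef D E -> D p -> E p = F (cexp p) *m c ->
  forall s, D s -> E s = F (cexp s) *m c.
Proof.
move=> oD cD D1 DU sF sE Dp Ep s Ds.
apply: (uniq_sol oD cD (contmx_log D1) sE (Y' := fun s => F (cexp s) *m c) _ Dp Ep Ds).
apply: (@sol_mulr _ logcoef 3 k D (fun s => F (cexp s)) c).
by apply: sol_sub (sol_exp sF) => x /DU.
Qed.

Lemma logcoef_pos s : logcoef s = C0 + (cexp s / (1 - cexp s)) *: C1.
Proof. by rewrite /logcoef /coef scalerDr !scalerA mulfV ?cexp_neq0 // scale1r. Qed.

Lemma logcoef_neg s : 1 - cexp (- s) != 0 ->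
  logcoef s = - (C1 - C0) + (- (cexp (- s) / (1 - cexp (- s)))) *: C1.
Proof.
have t0 := cexp_neq0 s.
have -> : cexp (- s) = (cexp s)^-1.
  by apply: (mulfI t0); rewrite -cexpD subrr cexp0 mulfV.
rewrite logcoef_pos; move: (cexp s) t0 => t t0 u1.
have t1 : 1 - t != 0.
  apply: contra_neq u1 => /eqP; rewrite subr_eq0 => /eqP <-.
  by rewrite invr1 subrr.
have t2 : t - 1 != 0 by rewrite -opprB oppr_eq0.
rewrite opprB -addrA (_ : - C1 = -1 *: C1); last by rewrite scaleN1r.
rewrite -scalerDl; congr (_ + _ *: _).
by field; rewrite ?t0 ?t1 ?t2.
Qed.

(** A solution z^mu times a power series in z at 0 (sg true), and z^-mu times a power
series in 1/z at infinity (sg false), written in the coordinate s. The residue at infinity in the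
coordinate 1/z is C1 - C0. *)
Lemma frob_log (sg : bool) (mu : C) (v : 'cV[C]_3)
    (N := if sg then C0 else C1 - C0) (e : C := if sg then 1 else -1) :
  N *m v = mu *: v -> (forall n, (n.+1%:R%:M - (N - mu%:M)) \in unitmx) ->
  exists Y : C -> 'cV[C]_3, [/\ Y 0 = v, forall i j, cont (fun u => Y u i j) 0 &
    sol logcoef (fun s => cabs (cexp (e * s)) < 1)
      (fun s => cexp (e * mu * s) *: Y (cexp (e * s)))].
Proof.
move=> Nv nr.
have r0 : (0 : R) < 1 by [].
have q1 : cabs (1 : C) * 1 <= 1 by rewrite cabs1 mulr1.
have q0 : cabs (0 : C) * 1 <= 1 by rewrite cabs0 mul0r.
have Nv' : (N - mu%:M) *m v = 0 by rewrite mulmxBl Nv mul_scalar_mx subrr.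
have [Y [Y0 hY]] := @frobenius R 1 (N - mu%:M) C1 0 1 0 1 v r0 q1 q0 Nv' nr.
exists Y; split=> //.
  move=> i j; have [|Y' [d _ _]] := hY 0; first by rewrite cabs0.
  exact: hasd_cont (d i j).
move=> s hs i j; have [Y' [d E _]] := hY _ hs.
set u := cexp (e * s) in hs d E *.
have u0 : u != 0 by exact: cexp_neq0.
have u1 : 1 - u != 0.
  by apply: contraTneq hs => /eqP; rewrite subr_eq0 => /eqP <-; rewrite cabs1 ltxx.
have hd : hasd (fun s => cexp (e * mu * s) * Y (cexp (e * s)) i j) s
    (e * mu * cexp (e * mu * s) * Y u i j + cexp (e * mu * s) * (e * u * Y' i j)).
  apply: hasdM; first exact: cexpM_hasd.
  exact: (hasd_comp (cexpM_hasd e s) (d i j)).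
have -> : (logcoef s *m (cexp (e * mu * s) *: Y u)) i j =
    e * mu * cexp (e * mu * s) * Y u i j + cexp (e * mu * s) * (e * u * Y' i j).
  have -> : e * u * Y' i j = e * (u *: Y') i j by rewrite mxE mulrA.
  rewrite E -scalemxAr mxE.
  have -> : logcoef s = e *: N + (e * (u / (1 - u))) *: C1.
    move: u1; rewrite /e /N /u /e; clear; case: sg => u1.
      rewrite scale1r !mul1r; exact: logcoef_pos.
    rewrite !mulN1r in u1 *; rewrite scaleN1r; exact: logcoef_neg.
  rewrite mulr1 scaler0 addr0 !mulmxDl mulNmx mul_scalar_mx -!scalemxAl !mxE.
  by move: (cexp (e * mu * s)) ((N *m Y u) i j) ((C1 *m Y u) i j) (Y u i j) => x y z t; ring.
by apply: hasd_ext hd => w; rewrite mxE.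
Qed.

End Pullback.

(** * Local monodromies *)

Section LocalMonodromy.
Variable R : realType.
Local Notation C := (Cplx R).
Variables C0 C1 : 'M[C]_3.
Let a := coef C0 C1.
Variables F0 F1 F2 : C -> 'M[C]_3.
Variables M0 M1 : 'M[C]_3.
Hypotheses (s0 : sol a (@U0 R) F0) (s1 : sol a (@U1 R) F1) (s2 : sol a (@U2 R) F2).
Hypothesis (u0 : forall z, U0 z -> F0 z \in unitmx).
Hypotheses (h01 : forall z, re z < 0 -> 0 < im z -> F1 z = F0 z)
  (h10 : forall z, re z < 0 -> im z < 0 -> F1 z = F0 z *m M0)
  (h02 : forall z, 1 < re z -> 0 < im z -> F2 z = F0 z)
  (h20 : forall z, 1 < re z -> im z < 0 -> F2 z = F0 z *m M1).

Definition twopii : C := 0 +i* (2 * pi).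

(** The horizontal strips of the s-plane whose images under the exponential are
sectors of the regions of the charts. *)
Definition strip (x c y1 y2 : R) (s : C) : Prop :=
  half x 0 c s /\ (half 0 (-1) (- y1) s /\ half 0 1 y2 s).

Lemma stripP x c y1 y2 s : strip x c y1 y2 s <-> x * re s < c /\ y1 < im s < y2.
Proof.
rewrite /strip /half; split.
  by move=> [h1 [h2 h3]]; split; [lra | apply/andP; split; lra].
by move=> [h1 /andP[h2 h3]]; split; [lra | split; lra].
Qed.

Lemma open_strip x c y1 y2 : openC (strip x c y1 y2).
Proof. by apply: openI; [|apply: openI]; exact: open_half. Qed.

Lemma convex_strip x c y1 y2 : convexC (strip x c y1 y2).
Proof. by apply: convexI; [|apply: convexI]; exact: convex_half. Qed.

Lemma cexp_neq1 (s : C) : re s != 0 -> cexp s != 1.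
Proof.
apply: contra_neq => h; have := cabs_cexp s; rewrite h cabs1 -[LHS]expR0.
by move/expR_inj.
Qed.

Lemma im_cexp_pos (s : C) : 0 < im s < pi -> 0 < im (cexp s).
Proof. by move=> h; rewrite im_cexp mulr_gt0 ?expR_gt0 // sin_gt0_pi. Qed.
Lemma im_cexp_neg (s : C) : pi < im s < 2 * pi \/ - pi < im s < 0 -> im (cexp s) < 0.
Proof.
move=> h; rewrite im_cexp pmulr_rlt0 ?expR_gt0 //; case: h => h; first exact: sin_neg.
by rewrite -[im s]opprK sinN oppr_lt0; apply: sin_gt0_pi; lra.
Qed.
Lemma re_cexp_neg (s : C) : pi / 2 < im s < 3 * pi / 2 -> re (cexp s) < 0.
Proof. by move=> h; rewrite re_cexp pmulr_rlt0 ?expR_gt0 //; exact: cos_neg. Qed.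
Lemma re_cexp_gt1 (s : C) : 1 < re s -> - (pi / 3) < im s < pi / 3 -> 1 < re (cexp s).
Proof.
move=> h1 /cos_gt_half h2; rewrite re_cexp; have := expR_ge1Dx (re s).
by move: (expR _) (cos _) h2 => x y h2 h3; nra.
Qed.

Lemma transport_strip x c y1 y2 k (U : C -> Prop) (F : C -> 'M[C]_3) (E : C -> 'M[C]_(3, k)) p (d : 'M[C]_(3, k)) :
  (forall s, strip x c y1 y2 s -> re s != 0) ->
  (forall s, strip x c y1 y2 s -> U (cexp s)) ->
  sol a U F -> sol (logcoef C0 C1) (fun s => x * re s < c) E -> strip x c y1 y2 p ->
  E p = F (cexp p) *m d -> forall s, strip x c y1 y2 s -> E s = F (cexp s) *m d.
Proof.
move=> h1 h2 sF sE sp Ep; apply: (@transport R C0 C1 k (strip x c y1 y2) U F E p d (@open_strip _ _ _ _) (@convex_strip _ _ _ _) _ h2 sF _ sp Ep).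
  by move=> s /h1 /cexp_neq1.
by apply: sol_sub sE => s /stripP[].
Qed.

(** The half-plane re s < 0 is crossed upwards by overlapping strips: E is F0 c on
the first one, F1 c on the second one and F0 M0 c on the third one, which is the
translate by 2 pi i of a strip where E is F0 c. Comparing with the
quasi-periodicity of E gives the eigenvector equation. *)
Lemma local_monodromy_0 (E : C -> 'cV[C]_3) (ka : C) :
  sol (logcoef C0 C1) (fun s => 1 * re s < 0) E ->
  (forall s, E (s + twopii) = ka *: E s) ->
  exists2 c, M0 *m c = ka *: c & forall s, re s < 0 -> 0 < im s < pi -> E s = F0 (cexp s) *m c.
Proof.
move=> sE per; have pp := pi_gt0 R.
(* points of the overlaps of consecutive strips: arguments in the second and third quadrants *)
pose p : C := (-1) +i* (3 * pi / 4); pose q : C := (-1) +i* (5 * pi / 4).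
have [rp ip rq iq] : [/\ re p = -1, im p = 3 * pi / 4, re q = -1 & im q = 5 * pi / 4] by [].
have neg y1 y2 s : strip 1 0 y1 y2 s -> re s != 0 by move=> /stripP[h _]; rewrite lt_eqF //; lra.
pose c := invmx (F0 (cexp p)) *m E p.
have U0p (s : C) : 0 < im s < pi -> U0 (cexp s) by move=> hs; have h := im_cexp_pos hs; left; rewrite gt_eqF.
have U0n (s : C) : pi < im s < 2 * pi \/ - pi < im s < 0 -> U0 (cexp s).
  by move=> hs; have h := im_cexp_neg hs; left; rewrite lt_eqF.
have Ep : E p = F0 (cexp p) *m c by rewrite mulKVmx //; apply: u0; apply: U0p; rewrite ip; lra.
have U0d s : strip 1 0 (- pi) pi s -> U0 (cexp s).
  move=> /stripP[h1 h2]; have [e|e] := eqVneq (im s) 0.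
    right; rewrite re_cexp e cos0 mulr1 expR_gt0 expR_lt1; lra.
  have [e'|e'] := ltP 0 (im s); first by apply: U0p; lra.
  have e3 : im s < 0 by rewrite lt_neqAle e e'.
  by apply: U0n; right; lra.
have Ed : forall s, strip 1 0 (- pi) pi s -> E s = F0 (cexp s) *m c.
  apply: (transport_strip (@neg _ _) U0d s0 sE _ Ep); apply/stripP; rewrite rp ip; lra.
have Eb : forall s, strip 1 0 (pi / 2) (3 * pi / 2) s -> E s = F1 (cexp s) *m c.
  apply: (transport_strip (p := p) (@neg _ _) _ s1 sE).
  - by move=> s /stripP[_ h]; exact: re_cexp_neg.
  - by apply/stripP; rewrite rp ip; lra.
  - rewrite Ep h01 //; first by apply: re_cexp_neg; rewrite ip; lra.
    by apply: im_cexp_pos; rewrite ip; lra.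
have Ec : forall s, strip 1 0 pi (2 * pi) s -> E s = F0 (cexp s) *m (M0 *m c).
  apply: (transport_strip (p := q) (@neg _ _) _ s0 sE).
  - by move=> s /stripP[_ h]; apply: U0n; left.
  - by apply/stripP; rewrite rq iq; lra.
  - rewrite Eb; last by apply/stripP; rewrite rq iq; lra.
    rewrite h10 ?mulmxA //; first by apply: re_cexp_neg; rewrite iq; lra.
    by apply: im_cexp_neg; left; rewrite iq; lra.
exists c; last first.
  by move=> s h1 h2; apply: Ed; apply/stripP; lra.
pose q' : C := (-1) +i* (- (3 * pi / 4)).
have qq' : q = q' + twopii.
  by apply: cplx_eq; rewrite ?reD ?imD /twopii ?re_cplx ?im_cplx; [ring | field].
have e1 : E q = F0 (cexp q) *m (M0 *m c) by apply: Ec; apply/stripP; rewrite rq iq; lra.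
have e2 : E q' = F0 (cexp q') *m c.
  by apply: Ed; apply/stripP; rewrite re_cplx im_cplx; lra.
have eq : cexp q = cexp q' by rewrite qq' cexp2pi.
have uq : F0 (cexp q) \in unitmx by apply/u0/U0n; left; rewrite iq; lra.
move: e1; rewrite {1}qq' per e2 -eq scalemxAr => /(congr1 (mulmx (invmx (F0 (cexp q))))).
by rewrite !mulKmx.
Qed.

(** As at 0, in the half-plane re s > 1. Here both singular points are encircled. Starting
from the strip over the upper half-plane, where E is F0 c, the strip above it gives
F0 M0 c, the one below it gives F0 M1 c; both lie over the lower half-plane and differ by
the translation by 2 pi i. *)
Lemma local_monodromy_inf (E : C -> 'cV[C]_3) (ka : C) :
  sol (logcoef C0 C1) (fun s => -1 * re s < -1) E ->
  (forall s, E (s + twopii) = ka *: E s) ->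
  exists2 c, M0 *m c = ka *: (M1 *m c) &
    forall s, 1 < re s -> 0 < im s < pi -> E s = F0 (cexp s) *m c.
Proof.
move=> sE per; have pp := pi_gt0 R.
pose p : C := 2 +i* (3 * pi / 4); pose q : C := 2 +i* (5 * pi / 4).
(* points whose exponentials have real part above 1 *)
pose r : C := 2 +i* (pi / 6); pose r' : C := 2 +i* (- (pi / 6)).
have [rp ip rq iq] : [/\ re p = 2, im p = 3 * pi / 4, re q = 2 & im q = 5 * pi / 4] by [].
have [rr ir rr' ir'] : [/\ re r = 2, im r = pi / 6, re r' = 2 & im r' = - (pi / 6)] by [].
have neg y1 y2 s : strip (-1) (-1) y1 y2 s -> re s != 0.
  by move=> /stripP[h _]; rewrite gt_eqF //; lra.
pose c := invmx (F0 (cexp p)) *m E p.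
have U0p (s : C) : 0 < im s < pi -> U0 (cexp s) by move=> hs; have h := im_cexp_pos hs; left; rewrite gt_eqF.
have U0n (s : C) : pi < im s < 2 * pi \/ - pi < im s < 0 -> U0 (cexp s).
  by move=> hs; have h := im_cexp_neg hs; left; rewrite lt_eqF.
have Ep : E p = F0 (cexp p) *m c by rewrite mulKVmx //; apply: u0; apply: U0p; rewrite ip; lra.
have Ea : forall s, strip (-1) (-1) 0 pi s -> E s = F0 (cexp s) *m c.
  apply: (transport_strip (@neg _ _) _ s0 sE _ Ep).
    by move=> s /stripP[_ h]; exact: U0p.
  by apply/stripP; rewrite rp ip; lra.
have Eb : forall s, strip (-1) (-1) (pi / 2) (3 * pi / 2) s -> E s = F1 (cexp s) *m c.
  apply: (transport_strip (p := p) (@neg _ _) _ s1 sE).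
  - by move=> s /stripP[_ h]; exact: re_cexp_neg.
  - by apply/stripP; rewrite rp ip; lra.
  - rewrite Ep h01 //; first by apply: re_cexp_neg; rewrite ip; lra.
    by apply: im_cexp_pos; rewrite ip; lra.
have Ec : forall s, strip (-1) (-1) pi (2 * pi) s -> E s = F0 (cexp s) *m (M0 *m c).
  apply: (transport_strip (p := q) (@neg _ _) _ s0 sE).
  - by move=> s /stripP[_ h]; apply: U0n; left.
  - by apply/stripP; rewrite rq iq; lra.
  - rewrite Eb; last by apply/stripP; rewrite rq iq; lra.
    rewrite h10 ?mulmxA //; first by apply: re_cexp_neg; rewrite iq; lra.
    by apply: im_cexp_neg; left; rewrite iq; lra.
have EP : forall s, strip (-1) (-1) (- (pi / 3)) (pi / 3) s -> E s = F2 (cexp s) *m c.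
  apply: (transport_strip (p := r) (@neg _ _) _ s2 sE).
  - by move=> s /stripP[h1 h]; apply: re_cexp_gt1 => //; lra.
  - by apply/stripP; rewrite rr ir; lra.
  - rewrite Ea; last by apply/stripP; rewrite rr ir; lra.
    rewrite h02 //; first by apply: re_cexp_gt1; rewrite ?rr ?ir; lra.
    by apply: im_cexp_pos; rewrite ir; lra.
have Ee : forall s, strip (-1) (-1) (- pi) 0 s -> E s = F0 (cexp s) *m (M1 *m c).
  apply: (transport_strip (p := r') (@neg _ _) _ s0 sE).
  - by move=> s /stripP[_ h]; apply: U0n; right.
  - by apply/stripP; rewrite rr' ir'; lra.
  - rewrite EP; last by apply/stripP; rewrite rr' ir'; lra.
    rewrite h20 ?mulmxA //; first by apply: re_cexp_gt1; rewrite ?rr' ?ir'; lra.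
    by apply: im_cexp_neg; right; rewrite ir'; lra.
exists c; last first.
  by move=> s h1 h2; apply: Ea; apply/stripP; lra.
pose q' : C := 2 +i* (- (3 * pi / 4)).
have qq' : q = q' + twopii.
  by apply: cplx_eq; rewrite ?reD ?imD /twopii ?re_cplx ?im_cplx; [ring | field].
have e1 : E q = F0 (cexp q) *m (M0 *m c) by apply: Ec; apply/stripP; rewrite rq iq; lra.
have e2 : E q' = F0 (cexp q') *m (M1 *m c).
  by apply: Ee; apply/stripP; rewrite re_cplx im_cplx; lra.
have eq : cexp q = cexp q' by rewrite qq' cexp2pi.
have uq : F0 (cexp q) \in unitmx by apply/u0/U0n; left; rewrite iq; lra.
move: e1; rewrite {1}qq' per e2 -eq scalemxAr => /(congr1 (mulmx (invmx (F0 (cexp q))))).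
by rewrite !mulKmx.
Qed.

(** The power series of a Frobenius solution is continuous with value v at the origin,
so it cannot vanish on a whole half-strip. *)
Lemma frob_neq0 (sg : bool) (mu : C) (v c : 'cV[C]_3) (Y : C -> 'cV[C]_3)
    (e : C := if sg then 1 else -1) :
  v != 0 -> Y 0 = v -> (forall i j, cont (fun u => Y u i j) 0) ->
  (forall s, (if sg then re s < 0 else 1 < re s) -> 0 < im s < pi ->
     cexp (e * mu * s) *: Y (cexp (e * s)) = F0 (cexp s) *m c) -> c != 0.
Proof.
move=> v0 Y0 cY H; apply: contra_neq v0 => c0.
apply/matrixP => i j; rewrite mxE; apply/eqP; rewrite -cabs_eq0.
have := cabs_ge0 (v i j); rewrite le_eqVlt => /orP[/eqP <- //|p].
have [d d0 hd] := cY i j _ p; have pp := pi_gt0 R.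
pose X := 1 + d^-1; have d1 : 0 < d^-1 by rewrite invr_gt0.
pose s : C := (if sg then - X else X) +i* (pi / 2).
have es : re (e * s) = - X by rewrite /e /s; case: (sg); rewrite ?mul1r ?mulN1r ?reN re_cplx.
have small : cabs (cexp (e * s) - 0) < d.
  rewrite subr0 cabs_cexp es expRN -[d]invrK ltf_pV2 ?posrE ?expR_gt0 //.
  by apply: lt_le_trans (expR_ge1Dx X); rewrite /X; lra.
have hs1 : if sg then re s < 0 else 1 < re s by rewrite /s; case: (sg); rewrite re_cplx /X; lra.
have hs2 : 0 < im s < pi by rewrite /s im_cplx; lra.
have := H s hs1 hs2; rewrite c0 mulmx0 => /eqP; rewrite scaler_eq0 (negbTE (cexp_neq0 _)) /=.
move/eqP => Yz; have := hd _ small.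
by rewrite Yz Y0 mxE sub0r cabsN ltxx.
Qed.

(** The kernel of the residue at 1 consists of initial values of solutions Ps that are
holomorphic near 1, hence not affected by a turn around 1. Written as F0 K, they give
fixed vectors of M1. The columns of K are at least as independent as those of N because Ps
determines its value N at 1. *)
Lemma local_monodromy_1 (N : 'M[C]_3) : C1 *m N = 0 -> (forall n, (n.+1%:R%:M + C1) \in unitmx) ->
  exists2 K : 'M[C]_3, M1 *m K = K & forall x : 'cV[C]_3, K *m x = 0 -> N *m x = 0.
Proof.
move=> CN nr.
have q1 : cabs (-1 : C) * 1 <= 1 by rewrite cabsN cabs1 mulr1.
have q0 : cabs (0 : C) * 1 <= 1 by rewrite cabs0 mul0r.
have CN' : - C1 *m N = 0 by rewrite mulNmx CN oppr0.
have nr' n : (n.+1%:R%:M - - C1) \in unitmx by rewrite opprK.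
have [Y [Y0 hY]] := @frobenius R 3 (- C1) (- C0) 0 (-1) 0 1 N ltr01 q1 q0 CN' nr'.
pose Ps z := Y (z - 1).
pose D (z : C) := cabs (z - 1) < 1 /\ z != 1.
have sP : sol a D Ps.
  move=> z [hz z1] i j; have [Y' [d E _]] := hY _ hz.
  have u0' : z - 1 != 0 by rewrite subr_eq0.
  have z0 : z != 0 by apply: contraTneq hz => ->; rewrite sub0r cabsN cabs1 ltxx.
  have z1' : 1 - z != 0 by rewrite -opprB oppr_eq0.
  have -> : a z *m Ps z = Y'.
    apply: (scalerI u0'); rewrite E scaler0 addr0 scalemxAl; congr (_ *m _).
    rewrite /a /coef scalerDr !scalerA scalerN -scaleNr addrC.
    have -> : (z - 1) / (1 - z) = -1 by field; rewrite ?u0' ?z1'.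
    rewrite scaleN1r; congr (_ + _ *: _).
    rewrite mulrN1 opprK [1 + _]addrC subrK; by field; rewrite ?z0.
  rewrite -[Y' i j]mul1r; apply: (@hasd_comp _ (fun w => Y w i j) (fun w => w - 1)) (d i j).
  by have := hasdD (hasd_id z) (hasd_cst (-1) z); rewrite addr0.
have Dn01 (D' : C -> Prop) : (forall z, D' z -> D z) -> contmx a D'.
  move=> h; apply: contmx_coef => [/h[]|/h[_]]; last by rewrite eqxx.
  by rewrite sub0r cabsN cabs1 ltxx.
pose B x y c (z : C) := cabs (z - 1) < 1 /\ half x y c z.
have oB x y c : openC (B x y c) by apply: openI; [exact: open_disc | exact: open_half].
have cB x y c : convexC (B x y c) by apply: convexI; [exact: convex_disc | exact: convex_half].
have tr x y c (U : C -> Prop) (F : C -> 'M[C]_3) p (d : 'M[C]_3) : (forall z, B x y c z -> U z /\ z != 1) ->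
    sol a U F -> B x y c p -> Ps p = F p *m d -> forall z, B x y c z -> Ps z = F z *m d.
  move=> hU sF Bp Ep z Bz.
  have BD w : B x y c w -> D w by move=> h; split; [case: h | case: (hU _ h)].
  apply: (uniq_sol (@oB _ _ _) (@cB _ _ _) (Dn01 _ BD) (sol_sub BD sP) (Y' := fun z => F z *m d) _ Bp Ep Bz).
  by apply: sol_mulr; apply: sol_sub sF => w /hU[].
have nx (x y : R) : `|x| <= 2^-1 -> `|y| <= 4^-1 -> cabs ((1 + x) +i* y - 1) < 1.
  move=> hx hy; apply: le_lt_trans (cabs_reim _) _; rewrite reB imB re_cplx im_cplx re1 im1 subr0.
  by rewrite (_ : 1 + x - 1 = x); [lra | ring].
have ab1 : `|(4^-1 : R)| <= 4^-1 by rewrite ger0_norm ?invr_ge0.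
have ab2 : `|(- 4^-1 : R)| <= 4^-1 by rewrite normrN.
have ab3 : `|(2^-1 : R)| <= 2^-1 by rewrite ger0_norm ?invr_ge0.
have ab4 : `|(- 2^-1 : R)| <= 2^-1 by rewrite normrN.
have ab0 : `|(0 : R)| <= 4^-1 by rewrite normr0 invr_ge0.
pose lp (y : R) : C := (1 + - 2^-1) +i* y; pose rp (y : R) : C := (1 + 2^-1) +i* y.
have one_re z : re z != 1 -> z != 1 :> C by apply: contra_neq => ->.
have one_im z : im z != 0 -> z != 1 :> C by apply: contra_neq => ->.
have UL z : B 1 0 1 z -> U0 z /\ z != 1.
  move=> [h1]; rewrite /half mul1r mul0r addr0 => h2; split; last by apply: one_re; rewrite lt_eqF.
  right; rewrite h2 andbT; have := cabs_re (z - 1); rewrite reB re1 ler_norml; lra.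
have Uu z : B 0 (-1) 0 z -> U0 z /\ z != 1.
  move=> [h1]; rewrite /half => h2.
  have h3 : im z != 0 by rewrite gt_eqF //; lra.
  by split; [left | exact: one_im].
have Ud z : B 0 1 0 z -> U0 z /\ z != 1.
  move=> [h1]; rewrite /half => h2.
  have h3 : im z != 0 by rewrite lt_eqF //; lra.
  by split; [left | exact: one_im].
have UR z : B (-1) 0 (-1) z -> U2 z /\ z != 1.
  move=> [h1]; rewrite /half => h2; have h3 : 1 < re z by lra.
  by split=> //; apply: one_re; rewrite gt_eqF.
have Bl y : `|y| <= 4^-1 -> B 1 0 1 (lp y).
  by move=> hy; split; [exact: nx | rewrite /half re_cplx im_cplx; lra].
have Br y : `|y| <= 4^-1 -> B (-1) 0 (-1) (rp y).
  by move=> hy; split; [exact: nx | rewrite /half re_cplx im_cplx; lra].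
pose K := invmx (F0 (lp 0)) *m Ps (lp 0).
have EL : forall z, B 1 0 1 z -> Ps z = F0 z *m K.
  apply: (tr _ _ _ _ _ (lp 0) _ UL s0 (Bl _ ab0)).
  by rewrite mulKVmx // u0 //; case: (UL _ (Bl _ ab0)).
have Eu : forall z, B 0 (-1) 0 z -> Ps z = F0 z *m K.
  apply: (tr _ _ _ _ _ (lp 4^-1) _ Uu s0); last by apply: EL; exact: Bl.
  by split; [exact: nx | rewrite /half re_cplx im_cplx; lra].
have Ed : forall z, B 0 1 0 z -> Ps z = F0 z *m K.
  apply: (tr _ _ _ _ _ (lp (- 4^-1)) _ Ud s0); last by apply: EL; exact: Bl.
  by split; [exact: nx | rewrite /half re_cplx im_cplx; lra].
have bu : B 0 (-1) 0 (rp 4^-1) by split; [exact: nx | rewrite /half re_cplx im_cplx; lra].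
have bd : B 0 1 0 (rp (- 4^-1)) by split; [exact: nx | rewrite /half re_cplx im_cplx; lra].
have ER : forall z, B (-1) 0 (-1) z -> Ps z = F2 z *m K.
  apply: (tr _ _ _ _ _ (rp 4^-1) _ UR s2 (Br _ ab1)).
  have e : F2 (rp 4^-1) = F0 (rp 4^-1) by apply: h02; rewrite ?re_cplx ?im_cplx; lra.
  by rewrite (Eu _ bu) e.
exists K.
  have e : F2 (rp (- 4^-1)) = F0 (rp (- 4^-1)) *m M1.
    by apply: h20; rewrite ?re_cplx ?im_cplx; lra.
  have := ER _ (Br _ ab2); rewrite (Ed _ bd) e.
  rewrite -mulmxA => /(congr1 (mulmx (invmx (F0 (rp (- 4^-1)))))).
  by rewrite !mulKmx ?u0 //; case: (Ud _ bd).
move=> x Kx.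
have Px z : B 1 0 1 z -> Ps z *m x = 0 by move=> /EL ->; rewrite -mulmxA Kx mulmx0.
apply/matrixP => i j; rewrite [RHS]mxE; apply/eqP; rewrite -cabs_eq0.
have := cabs_ge0 ((N *m x) i j); rewrite le_eqVlt => /orP[/eqP <- //|p].
have cY : cont (fun u => (Y u *m x) i j) 0.
  apply: (@cont_near _ (fun u => \sum_l Y u i l * x l j)); first by exists 1 => // w _; rewrite mxE.
  apply: cont_sum => l; apply: contM; last exact: cont_cst.
  have [|Y' [d _ _]] := hY 0; first by rewrite cabs0.
  exact: hasd_cont (d i l).
have [d d0 hd] := cY _ p.
pose t := Num.min (d / 2) 2^-1.
have t0 : 0 < t by rewrite lt_min; lra.
have td : t <= d / 2 by rewrite ge_min lexx.
have t2 : t <= 2^-1 by rewrite ge_min lexx orbT.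
have := hd (ofR (- t)); rewrite subr0 cabs_ofR normrN ger0_norm; last exact: ltW.
have e3 : ofR (- t) = ofR (1 - t) - 1 :> C.
  by apply: cplx_eq; rewrite ?reB ?imB ?re_ofR ?im_ofR ?re1 ?im1; ring.
rewrite e3 Px; last first.
  split; last by rewrite /half re_ofR im_ofR; lra.
  by rewrite -e3 cabs_ofR normrN ger0_norm ?ltW //; lra.
by rewrite Y0 mxE sub0r cabsN ltxx => /(_ ltac:(lra)).
Qed.

End LocalMonodromy.

(** * Spectra of the monodromy matrices *)

Section CompanionSpectrum.
Variable R : realType.
Local Notation C := (Cplx R).
Variables alpha beta : 'I_3 -> C.
Let b i := beta i - 1.

(** The eigenvectors of a companion matrix. *)
Definition powers (mu : C) : 'cV[C]_3 := \col_i mu ^+ i.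

Lemma powers_neq0 mu : powers mu != 0.
Proof.
apply/eqP => /matrixP/(_ 0 0); rewrite !mxE expr0 => /eqP.
by rewrite oner_eq0.
Qed.

Lemma powersE mu : [/\ powers mu 0 0 = 1, powers mu 1 0 = mu & powers mu 2 0 = mu * mu].
Proof. by split; rewrite mxE. Qed.

Lemma root_e (x : 'I_3 -> C) j : x j ^+ 3 = e1 x * x j ^+ 2 - e2 x * x j + e3 x.
Proof. by move: j; apply: ord3P; rewrite /e1 /e2 /e3; ring. Qed.

Lemma residue0_eig j : residue0 beta *m powers (1 - beta j) = (1 - beta j) *: powers (1 - beta j).
Proof.
have [p0 p1 p2] := powersE (1 - beta j); have := root_e b j; rewrite /b => h.
apply/matrixP => i k; rewrite ord1; move: i; apply: ord3P; rewrite mxE sum3 [RHS]mxE p0 p1 p2 !mxE /=; [ring | ring |].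
have E : (1 - beta j) * ((1 - beta j) * (1 - beta j)) = - (beta j - 1) ^+ 3 by ring.
by rewrite E h; ring.
Qed.

Lemma residue0_unit la : (forall i, la + b i != 0) -> la%:M - residue0 beta \in unitmx.
Proof.
move=> h; apply: unit_col => x hx.
have E i : ((la%:M - residue0 beta) *m x) i 0 = 0 by rewrite hx mxE.
have := E 0; have := E 1; have := E 2; rewrite mulmxBl mul_scalar_mx !mxE !sum3 !mxE /= => q2 q1 q0.
have x1 : x 1 0 = la * x 0 0 by apply/eqP; rewrite eq_sym -subr_eq0; apply/eqP; rewrite -[RHS]q0; ring.
have x2 : x 2 0 = la * x 1 0 by apply/eqP; rewrite eq_sym -subr_eq0; apply/eqP; rewrite -[RHS]q1; ring.
have : (la + b 0) * (la + b 1) * (la + b 2) * x 0 0 = 0.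
  rewrite -[RHS]q2 x2 x1 /e1 /e2 /e3 /b; ring.
move/eqP; rewrite !mulf_eq0 !(negbTE (h _)) /= => /eqP x0.
apply/matrixP => i j; rewrite ord1 [RHS]mxE; move: i; apply: ord3P => //.
  by rewrite x1 x0 mulr0.
by rewrite x2 x1 x0 !mulr0.
Qed.

Lemma residue_inf_eig j : (residue1 alpha beta - residue0 beta) *m powers (- alpha j) =
  alpha j *: powers (- alpha j).
Proof.
have [p0 p1 p2] := powersE (- alpha j); have h := root_e alpha j.
apply/matrixP => i k; rewrite ord1; move: i; apply: ord3P; rewrite mxE sum3 [RHS]mxE p0 p1 p2 !mxE /=; [ring | ring |].
have E : alpha j * (- alpha j * - alpha j) = alpha j ^+ 3 by ring.
by rewrite E h; ring.
Qed.

Lemma residue_inf_unit la : (forall i, la - alpha i != 0) ->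
  la%:M - (residue1 alpha beta - residue0 beta) \in unitmx.
Proof.
move=> h; apply: unit_col => x hx.
have E i : ((la%:M - (residue1 alpha beta - residue0 beta)) *m x) i 0 = 0 by rewrite hx mxE.
have := E 0; have := E 1; have := E 2; rewrite mulmxBl mul_scalar_mx !mxE !sum3 !mxE /= => q2 q1 q0.
have x1 : x 1 0 = - la * x 0 0 by apply/eqP; rewrite -subr_eq0; apply/eqP; rewrite -[RHS]q0; ring.
have x2 : x 2 0 = - la * x 1 0 by apply/eqP; rewrite -subr_eq0; apply/eqP; rewrite -[RHS]q1; ring.
have : (la - alpha 0) * (la - alpha 1) * (la - alpha 2) * x 0 0 = 0.
  rewrite -[RHS]q2 x2 x1 /e1 /e2 /e3; ring.
move/eqP; rewrite !mulf_eq0 !(negbTE (h _)) /= => /eqP x0.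
apply/matrixP => i j; rewrite ord1 [RHS]mxE; move: i; apply: ord3P => //.
  by rewrite x1 x0 mulr0.
by rewrite x2 x1 x0 !mulr0.
Qed.

Lemma residue1_unit la : la != 0 -> la + (e1 alpha - e1 b) != 0 -> la%:M + residue1 alpha beta \in unitmx.
Proof.
move=> h0 h1; apply: unit_col => x hx.
have E i : ((la%:M + residue1 alpha beta) *m x) i 0 = 0 by rewrite hx mxE.
have := E 0; have := E 1; have := E 2; rewrite mulmxDl mul_scalar_mx !mxE !sum3 !mxE /= => q2 q1 q0.
have x0 : x 0 0 = 0 by apply: (mulfI h0); rewrite mulr0 -[RHS]q0; ring.
have x1 : x 1 0 = 0 by apply: (mulfI h0); rewrite mulr0 -[RHS]q1; ring.
have x2 : x 2 0 = 0 by apply: (mulfI h1); rewrite mulr0 -[RHS]q2 x0 x1 /b; ring.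
by apply/matrixP => i j; rewrite ord1 [RHS]mxE; move: i; apply: ord3P.
Qed.

Lemma residue1_rank : (\rank (residue1 alpha beta) <= 1)%N.
Proof.
have -> : residue1 alpha beta = delta_mx 2 0 *m row 2 (residue1 alpha beta) :> 'M[C]_3.
  apply/matrixP => i j; rewrite !mxE big_ord1 !mxE.
  by rewrite eqxx andbT; move: i; apply: ord3P; move: j; apply: ord3P; rewrite /= ?mul0r ?mul1r.
exact: leq_trans (mxrankM_maxr _ _) (rank_leq_row _).
Qed.

Lemma exp2piE (z : C) : exp2pi z = cexp (twopii R * z). Proof. by []. Qed.

Lemma exp2piD (z w : C) : exp2pi (z + w) = exp2pi z * exp2pi w.
Proof. by rewrite !exp2piE mulrDr cexpD. Qed.

Lemma exp2pi_nat n : exp2pi (n%:R : C) = 1.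
Proof.
elim: n => [|n IH]; first by rewrite exp2piE mulr0 cexp0.
rewrite -natr1 exp2piD IH mul1r exp2piE mulr1 -[twopii R]add0r cexp2pi; exact: cexp0.
Qed.

Lemma exp2piN (z : C) : exp2pi (- z) = (exp2pi z)^-1.
Proof.
have h : exp2pi z != 0 by exact: cexp_neq0.
by apply: (mulfI h); rewrite -exp2piD subrr mulfV // exp2piE mulr0 cexp0.
Qed.

(** Distinct exponentials exclude that two exponents differ by an integer, which is
the absence of resonances needed for Frobenius' method. *)
Lemma exp2pi_sub (x y : C) n : exp2pi x != exp2pi y -> n%:R + (x - y) != 0.
Proof.
apply: contra_neq => h; have -> : y = x + n%:R.
  by apply/eqP; rewrite -subr_eq0 -oppr_eq0; apply/eqP; rewrite -h; ring.
by rewrite exp2piD exp2pi_nat mulr1.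
Qed.

End CompanionSpectrum.

Section Hypergeometric.
Variable R : realType.
Local Notation C := (Cplx R).

(** The common part of the two ends 0 and infinity: a Frobenius solution is
quasi-periodic in the logarithmic coordinate, the property H turns this into an
equation P for its coordinate vector c, and c is not zero. *)
Lemma frobenius_eigenvector (sg : bool) (ka mu : C) (C0 C1 M0 M1 : 'M[C]_3) (v : 'cV[C]_3)
    (N := if sg then C0 else C1 - C0) (e : C := if sg then 1 else -1)
    (P : (C -> 'cV[C]_3) -> 'cV[C]_3 -> Prop) (F0 : C -> 'M[C]_3) :
  N *m v = mu *: v -> v != 0 -> (forall n, (n.+1%:R%:M - (N - mu%:M)) \in unitmx) ->
  ka = cexp (e * mu * twopii R) ->
  (forall E : C -> 'cV[C]_3,
     sol (logcoef C0 C1) (fun s => if sg then 1 * re s < 0 else -1 * re s < -1) E ->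
     (forall s, E (s + twopii R) = ka *: E s) ->
     exists2 c, P E c & forall s, (if sg then re s < 0 else 1 < re s) -> 0 < im s < pi -> E s = F0 (cexp s) *m c) ->
  exists E, exists2 c, P E c & c != 0.
Proof.
move=> Nv v0 nr hka H.
have [Y [Y0 cY sY]] := frob_log (sg := sg) Nv nr.
pose E s := cexp (e * mu * s) *: Y (cexp (e * s)).
have per s : E (s + twopii R) = ka *: E s.
  rewrite /E mulrDr cexpD -hka scalerA [ka * _]mulrC; congr (_ *: Y _).
  rewrite /e; case: (sg); first by rewrite !mul1r cexp2pi.
  by rewrite !mulN1r -[LHS]cexp2pi opprD subrK.
have sE : sol (logcoef C0 C1) (fun s => if sg then 1 * re s < 0 else -1 * re s < -1) E.
  apply: sol_sub sY => s; rewrite cabs_cexp -/e /e.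
  case: (sg) => h; first by rewrite mul1r expR_lt1; lra.
  by rewrite mulN1r reN expR_lt1; lra.
have [c Pc hc] := H E sE per.
exists E, c => //; exact: (frob_neq0 (sg := sg) v0 Y0 cY (fun s k1 k2 => hc s k1 k2)).
Qed.

(** The monodromy group with the data that characterize it: the eigenvalues of M0, those
of M0^-1 M1 in the form of a generalized eigenvector equation, and the rank of M1 - 1. The last
hypothesis says that the third exponent at 1, besides the double eigenvalue 0 of the
residue, is not a positive integer. *)
Theorem hypergeometric_monodromy (alpha beta : 'I_3 -> C) :
  (forall i j, i != j -> exp2pi (alpha i) != exp2pi (alpha j)) ->
  (forall i j, i != j -> exp2pi (beta i) != exp2pi (beta j)) ->
  (forall n, n.+1%:R + (e1 alpha - e1 (fun i => beta i - 1)) != 0) ->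
  exists M0 M1 : 'M[C]_3,
   [/\ M0 \in unitmx /\ M1 \in unitmx,
       monodromy_group alpha beta (generated [set M | M = M0 \/ M = M1]),
       forall j, exists2 c : 'cV[C]_3, c != 0 & M0 *m c = exp2pi (1 - beta j) *: c,
       forall j, exists2 c : 'cV[C]_3, c != 0 & M0 *m c = exp2pi (- alpha j) *: (M1 *m c)
     & (\rank (M1 - 1%:M)%R <= 1)%N].
Proof.
move=> inja injb nonres.
have [F0 [F1 [F2 [M0 [M1 [ [s0 s1 s2] [u0 u1 u2] [uM0 uM1] [h01 h10] [h02 h20]]]]]]] :=
  charts (residue0 beta) (residue1 alpha beta).
have n0 n : (n.+1%:R : C) != 0 by rewrite pnatr_eq0.
exists M0, M1; split=> //.
- have [b0 b1] := base_neq R.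
  exists (base_point R), (f0 F0); split=> //.
    by apply: (fundamental_f0 s0 s1 s2); eassumption.
  apply/seteqP; split=> M.
    have l0 : monodromy alpha beta (base_point R) (f0 F0) M0.
      apply: (@loop_monodromy R alpha beta F0 F1 M0 (@U1 R) 0 1 s0 s1 (@open_U1 R) (nU1 R).1 (nU1 R).2).
      - by rewrite add0r mul1r.
      - by move=> z; rewrite subr0 mulr1.
      - by move=> z; rewrite subr0 mulr1; exact: h01.
      - by move=> z; rewrite subr0 mulr1; exact: h10.
      - by rewrite expr1n.
    have l1 : monodromy alpha beta (base_point R) (f0 F0) M1.
      apply: (@loop_monodromy R alpha beta F0 F2 M1 (@U2 R) 1 (-1) s0 s2 (@open_U2 R) (nU2 R).1 (nU2 R).2).
      - by field.
      - by move=> z; rewrite /U2 mulrN1 oppr_lt0 subr_gt0.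
      - by move=> z; rewrite mulrN1 oppr_lt0 subr_gt0; exact: h02.
      - by move=> z; rewrite mulrN1 oppr_lt0 subr_gt0; exact: h20.
      - by rewrite sqrrN expr1n.
    elim=> [|g h hg _ IH|g h hg _ IH].
    + exact: (mono1 s0 s1 s2 u0 u1 u2).
    + by apply: (monoM s0 s1 s2 u0 u1 u2 _ IH); case: hg => ->.
    + apply: (monoM s0 s1 s2 u0 u1 u2 _ IH).
      by case: hg => ->; apply: (monoV s0 s1 s2 u0 u1 u2).
  exact: (mono_sub s0 s1 s2 u0 u1 u2 uM0 uM1 h01 h10 h02 h20).
- move=> j.
  have [||n||E|E [c hc c0]] := @frobenius_eigenvector true (exp2pi (1 - beta j)) (1 - beta j) (residue0 beta)
     (residue1 alpha beta) M0 M1 (powers (1 - beta j)) (fun _ c => M0 *m c = exp2pi (1 - beta j) *: c) F0.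
  + exact: residue0_eig.
  + exact: powers_neq0.
  + rewrite opprB addrA -raddfD /=; apply: residue0_unit => i.
    have [->|ij] := eqVneq i j; first by rewrite (_ : _ + _ = n.+1%:R) //; ring.
    rewrite (_ : _ + _ = n.+1%:R + (beta i - beta j)); last by ring.
    by apply: exp2pi_sub; exact: injb.
  + by rewrite exp2piE mul1r mulrC.
  + exact: (local_monodromy_0 s0 s1 u0 h01 h10).
  + by exists c.
- move=> j.
  have [||n||E|E [c hc c0]] := @frobenius_eigenvector false (exp2pi (- alpha j)) (alpha j) (residue0 beta)
     (residue1 alpha beta) M0 M1 (powers (- alpha j)) (fun _ c => M0 *m c = exp2pi (- alpha j) *: (M1 *m c)) F0.
  + exact: residue_inf_eig.
  + exact: powers_neq0.
  + rewrite [_ - _%:M]addrC opprD opprK addrA -raddfD /=; apply: residue_inf_unit => i.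
    have [->|ij] := eqVneq i j; first by rewrite addrK.
    rewrite -addrA.
    by apply: exp2pi_sub; rewrite eq_sym; exact: inja.
  + by rewrite exp2piE mulN1r mulrC.
  + exact: (local_monodromy_inf s0 s1 s2 u0 h01 h10 h02 h20).
  + by exists c.
pose N := cokermx (residue1 alpha beta).
have nr n : (n.+1%:R%:M + residue1 alpha beta) \in unitmx by exact: residue1_unit.
have [K MK KN] := local_monodromy_1 s0 s2 u0 h02 h20 (mulmx_coker _ : residue1 alpha beta *m N = 0) nr.
have NK : (N <= K)%MS.
  rewrite submxE; apply/eqP/matrixP => i j.
  have := KN (col j (cokermx K)); rewrite colE mulmxA mulmx_coker mul0mx => /(_ erefl).
  rewrite mulmxA -colE => /matrixP/(_ i 0); rewrite [LHS]mxE => ->.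
  by rewrite !mxE.
have rN : (2 <= \rank N)%N by rewrite mxrank_coker; have := residue1_rank alpha beta; lia.
have rK := leq_trans rN (mxrankS NK).
have := mulmx0_rank_max (_ : (M1 - 1%:M) *m K = 0); rewrite mulmxBl MK mul1mx subrr => /(_ erefl).
by lia.
Qed.

End Hypergeometric.

(** * Levelt's rigidity *)

Section Levelt.
Variable K : fieldType.
Implicit Types (A B : 'M[K]_3) (a b : 'I_3 -> K).

Lemma eigenvalueE A t : eigenvalue A t = (A - t%:M \notin unitmx).
Proof. by rewrite /eigenvalue /eigenspace kermx_eq0 row_free_unit. Qed.

Lemma eigen_col A t (c : 'cV[K]_3) : c != 0 -> A *m c = t *: c -> eigenvalue A t.
Proof.
move=> c0 h; rewrite eigenvalueE; apply: contra_neqN c0 => u.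
by rewrite -(mulKmx u c) mulmxBl h mul_scalar_mx subrr mulmx0.
Qed.

(** Three distinct eigenvalues exhaust the characteristic polynomial. *)
Lemma char_poly_distinct A a : injective a -> (forall j, eigenvalue A (a j)) ->
  char_poly A = \prod_(j < 3) ('X - (a j)%:P).
Proof.
move=> ia h; have -> : \prod_(j < 3) ('X - (a j)%:P) = \prod_(z <- [seq a j | j <- enum 'I_3]) ('X - z%:P).
  by rewrite big_map big_enum.
rewrite [LHS](@all_roots_prod_XsubC _ _ [seq a j | j <- enum 'I_3]).
- by rewrite (monicP (char_poly_monic A)) scale1r.
- by rewrite size_char_poly size_map size_enum_ord.
- by apply/allP => z /mapP[j _ ->]; rewrite -eigenvalue_root_char.
- by rewrite uniq_rootsE map_inj_uniq ?enum_uniq.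
Qed.

Lemma other_unit A a t : injective a -> (forall j, eigenvalue A (a j)) -> (forall j, a j != t) ->
  A - t%:M \in unitmx.
Proof.
move=> ia h n; apply: contraT; rewrite -eigenvalueE eigenvalue_root_char (char_poly_distinct ia h).
rewrite -big_enum -(big_map a xpredT (fun z => 'X - z%:P)) root_prod_XsubC => /mapP[j _ tj].
by have := n j; rewrite tj eqxx.
Qed.

Lemma prod_shift A b (v : 'cV[K]_3) :
  (A - (b 0)%:M) *m ((A - (b 1)%:M) *m ((A - (b 2)%:M) *m v)) =
  A *m (A *m (A *m v)) - e1 b *: (A *m (A *m v)) + e2 b *: (A *m v) - e3 b *: v.
Proof.
rewrite !(mulmxBl, mulmxBr, mul_scalar_mx, scalemxAr) -!scalemxAr !scalerA.
apply/matrixP => i j; rewrite !mxE /e1 /e2 /e3; ring.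
Qed.

Lemma cayley A a (v : 'cV[K]_3) : injective a -> (forall j, eigenvalue A (a j)) ->
  A *m (A *m (A *m v)) = e1 a *: (A *m (A *m v)) - e2 a *: (A *m v) + e3 a *: v.
Proof.
move=> ia h; have := Cayley_Hamilton A; rewrite (char_poly_distinct ia h).
rewrite rmorph_prod /= !big_ord_recl big_ord0 mulr1 !rmorphB /= horner_mx_X !horner_mx_C.
move/(congr1 (mulmx^~ v)); rewrite /= mul0mx -!mulmxE -!mulmxA => h0.
have E : A *m (A *m (A *m v)) - e1 a *: (A *m (A *m v)) + e2 a *: (A *m v) - e3 a *: v = 0.
  rewrite -prod_shift -[RHS]h0.
  by congr ((_ - (a _)%:M) *m ((_ - (a _)%:M) *m ((_ - (a _)%:M) *m _))); exact: val_inj.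
move: (A *m (A *m (A *m v))) (e1 a *: _) (e2 a *: _) (e3 a *: v) E => x y z w E.
by apply/eqP; rewrite -subr_eq0 -[X in _ == X]E; apply/eqP/matrixP => i j; rewrite !mxE; ring.
Qed.

Definition companion a : 'M[K]_3 :=
  mx3 [:: [:: 0; 0; e3 a]; [:: 1; 0; - e2 a]; [:: 0; 1; e1 a]].

Definition columns (w0 w1 w2 : 'cV[K]_3) : 'M[K]_3 :=
  \matrix_(i, j) (nth 0 [:: w0; w1; w2] j) i 0.

Lemma columns_companion A a w0 w1 w2 : A *m w0 = w1 -> A *m w1 = w2 ->
  A *m w2 = e1 a *: w2 - e2 a *: w1 + e3 a *: w0 ->
  A *m columns w0 w1 w2 = columns w0 w1 w2 *m companion a.
Proof.
move=> h0 h1 h2; apply/matrixP => i j.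
have E (x y : 'cV[K]_3) : A *m x = y -> \sum_k A i k * x k 0 = y i 0.
  by move=> <-; rewrite mxE.
move: (E _ _ h0) (E _ _ h1) (E _ _ h2); rewrite !sum3 => {h0 h1 h2} h0 h1 h2.
move: j; apply: ord3P; rewrite mxE sum3 [RHS]mxE sum3 !mxE /=.
- by rewrite h0; ring.
- by rewrite h1; ring.
- by rewrite h2 !mxE; ring.
Qed.

Lemma columns_vec w0 w1 w2 (x : 'cV[K]_3) :
  columns w0 w1 w2 *m x = x 0 0 *: w0 + x 1 0 *: w1 + x 2 0 *: w2.
Proof.
by apply/matrixP => i j; rewrite ord1 [LHS]mxE sum3 !mxE /=; ring.
Qed.

Lemma kernel_col m (M : 'M[K]_(m, 3)) : (\rank M <= 2)%N -> exists2 v : 'cV[K]_3, v != 0 & M *m v = 0.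
Proof.
move=> rM; have : cokermx M != 0 by rewrite -mxrank_eq0 mxrank_coker; lia.
move=> n0; have [j hj] : exists j, col j (cokermx M) != 0.
  apply: contrapT => h; move/eqP: n0; apply; apply/matrixP => i j.
  have : col j (cokermx M) = 0 by apply/eqP; apply: contraT => k; case: h; exists j.
  by move/matrixP/(_ i 0); rewrite !mxE.
by exists (col j (cokermx M)) => //; rewrite colE mulmxA mulmx_coker mul0mx.
Qed.

(** Rigidity. The space where A = B has dimension at least 2, so it meets its preimage under
A: there is v with Av = Bv and A^2 v = B^2 v. If moreover A^3 v = B^3 v, then the
characteristic polynomial of B, evaluated at A, would kill v, which is impossible as
the spectra are disjoint. This gives a vector on which A - B does not vanish, and
with it the independence of v, Av, A^2 v. *)
Lemma levelt A B a b :
  injective a -> injective b -> (forall i j, a i != b j) ->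
  (forall j, eigenvalue A (a j)) -> (forall j, eigenvalue B (b j)) ->
  (\rank (A - B)%R <= 1)%N ->
  exists2 P, P \in unitmx & A *m P = P *m companion a /\ B *m P = P *m companion b.
Proof.
move=> ia ib ab ha hb rD; pose D := A - B.
have [|v v0] := @kernel_col _ (col_mx D (D *m A)).
  rewrite -addsmxE; apply: leq_trans (mxrank_adds_leqif _ _).1 _.
  exact: leq_add rD (leq_trans (mxrankM_maxl D A) rD).
rewrite mul_col_mx -mulmxA => /eqP; rewrite col_mx_eq0 => /andP[/eqP Dv /eqP DAv].
have same (x : 'cV[K]_3) : D *m x = 0 -> B *m x = A *m x.
  by move=> h; rewrite -[RHS](subrK (B *m x)) -mulmxBl h add0r.
have cA := cayley v ia ha; have cB := cayley v ib hb.
rewrite (same v Dv) (same _ DAv) in cB.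
(* otherwise the characteristic polynomial of B, evaluated at A, kills v *)
have DAAv : D *m (A *m (A *m v)) != 0.
  apply: contra_neq v0 => /same h; rewrite h in cB.
  have u j : A - (b j)%:M \in unitmx by apply: (other_unit ia ha) => i.
  rewrite -(mulKmx (u 2) v) -(mulKmx (u 1) (_ *m v)) -(mulKmx (u 0) (_ *m (_ *m v))).
  rewrite (_ : _ *m (_ *m (_ *m v)) = 0) ?mulmx0 //.
  by rewrite prod_shift cB; apply/matrixP => i j; rewrite !mxE; ring.
exists (columns v (A *m v) (A *m (A *m v))); last first.
  split; apply: columns_companion => //; first exact: same.
  exact: same.
apply: unit_col => x; rewrite columns_vec => h.
have x2 : x 2 0 = 0.
  have := congr1 (mulmx D) h; rewrite !mulmxDr -!scalemxAr Dv DAv !scaler0 !add0r mulmx0.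
  by move/eqP; rewrite scaler_eq0 (negbTE DAAv) orbF => /eqP.
have x1 : x 1 0 = 0.
  have := congr1 (fun y => D *m (A *m y)) h; rewrite x2 scale0r addr0 !mulmxDr -!scalemxAr DAv scaler0 add0r !mulmx0.
  by move/eqP; rewrite scaler_eq0 (negbTE DAAv) orbF => /eqP.
move: h; rewrite x1 x2 !scale0r !addr0 => /eqP; rewrite scaler_eq0 (negbTE v0) orbF => /eqP x0.
by apply/matrixP => i j; rewrite ord1 [RHS]mxE; move: i; apply: ord3P.
Qed.
End Levelt.

(** * Realization of pairs by hypergeometric equations *)

Section GeneratedBy.
Variable K : fieldType.
Implicit Types (S T : set 'M[K]_3) (A B P M : 'M[K]_3).

Definition gens2 A B : set 'M[K]_3 := [set M | M = A \/ M = B].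

Lemma gen_sub S T : (forall x, T x -> x \in unitmx) -> S `<=` generated T ->
  generated S `<=` generated T.
Proof.
move=> uT ST M; elim=> [|g h /ST Tg _ Th|g h /ST Tg _ Th]; first exact: generated1.
  exact: gen_mul.
by apply: gen_mul => //; exact: gen_inv.
Qed.

Lemma conj_inv P g : P \in unitmx -> invmx (P *m g *m invmx P) = P *m invmx g *m invmx P.
Proof.
move=> uP; have [ug|ug] := boolP (g \in unitmx).
  by rewrite !invmxM ?unitmx_mul ?unitmx_inv ?uP ?ug // invmxK -!mulmxA.
have nu : P *m g *m invmx P \notin unitmx by rewrite !unitmx_mul (negbTE ug) andbF.
by rewrite (invmx_out ug) (invmx_out nu).
Qed.

Lemma conj_mul P g h : P \in unitmx ->
  P *m g *m invmx P *m (P *m h *m invmx P) = P *m (g *m h) *m invmx P.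
Proof. by move=> uP; rewrite -!mulmxA mulKmx. Qed.

Lemma gen_conj P S : P \in unitmx ->
  conjugate_set P (generated S) = generated (conjugate_set P S).
Proof.
move=> uP; apply/seteqP; split=> M.
  case=> g + <-; elim=> [|x y Sx _ IH|x y Sx _ IH].
  - by rewrite mulmx1 mulmxV //; exact: generated1.
  - by rewrite -conj_mul //; apply: generatedM => //; exists x.
  - rewrite -conj_mul // -(conj_inv _ uP); apply: generatedV => //; by exists x.
elim=> [|_ h [g Sg <-] _ [y Gy <-]|_ h [g Sg <-] _ [y Gy <-]].
- by exists 1%:M; [exact: generated1 | rewrite mulmx1 mulmxV].
- by exists (g *m y); [exact: generatedM | rewrite conj_mul].
- by exists (invmx g *m y); [exact: generatedV | rewrite (conj_inv _ uP) conj_mul].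
Qed.

Lemma gens2_unit A B : A \in unitmx -> B \in unitmx -> forall x, gens2 A B x -> x \in unitmx.
Proof. by move=> uA uB x [] ->. Qed.

Lemma gens2_l A B : generated (gens2 A B) A. Proof. by apply: gen_base; left. Qed.
Lemma gens2_r A B : generated (gens2 A B) B. Proof. by apply: gen_base; right. Qed.

Lemma gens2_inv A B : A \in unitmx -> B \in unitmx ->
  generated (gens2 A B) = generated (gens2 (invmx A *m B) (invmx A)).
Proof.
move=> uA uB; have uS := gens2_unit uA uB.
have uT : forall x, gens2 (invmx A *m B) (invmx A) x -> x \in unitmx.
  by apply: gens2_unit; rewrite ?unitmx_mul ?unitmx_inv ?uA.
have gA : generated (gens2 (invmx A *m B) (invmx A)) A.
  by rewrite -[A in X in _ X]invmxK; apply: gen_inv => //; exact: gens2_r.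
apply/seteqP; split; apply: gen_sub => // M [] ->.
- exact: gA.
- by have := gen_mul uT gA (gens2_l _ _); rewrite mulKVmx.
- apply: gen_mul => //; last exact: gens2_r.
  by apply: gen_inv => //; exact: gens2_l.
- by apply: gen_inv => //; exact: gens2_l.
Qed.

End GeneratedBy.

Section Realize.
Variable R : realType.
Local Notation C := (Cplx R).
Implicit Types (A B : 'M[C]_3) (alpha beta : 'I_3 -> C).

Lemma eigen_unit A (a : 'I_3 -> C) : injective a -> (forall j, eigenvalue A (a j)) ->
  (forall j, a j != 0) -> A \in unitmx.
Proof.
by move=> ia ha n0; rewrite -[A]subr0 -(raddf0 (@scalar_mx C 3)); exact: other_unit ia ha n0.
Qed.

Lemma exp2pi_neq0 (z : C) : exp2pi z != 0. Proof. exact: cexp_neq0. Qed.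

(** Adding a large integer to one parameter does not change the exponentials and
removes the resonances at 1. *)
Lemma shift_parameter alpha (c : C) : exists2 alpha', forall j, exp2pi (alpha' j) = exp2pi (alpha j) &
  forall n, n.+1%:R + (e1 alpha' - c) != 0.
Proof.
pose N := Num.bound `|re (c - e1 alpha)|.
exists (fun j => alpha j + (if j == 0 then N%:R else 0)).
  by move=> j; case: ifP => _; rewrite ?addr0 // exp2piD exp2pi_nat mulr1.
move=> n; apply/eqP => /(congr1 (@re R)).
have -> : n.+1%:R + (e1 (fun j => alpha j + (if j == 0 then N%:R else 0)) - c) =
   (n.+1 + N)%:R - (c - e1 alpha) by rewrite natrD /e1 /=; ring.
rewrite reB; have -> : re ((n.+1 + N)%:R : C) = (n.+1 + N)%:R by exact: re_nat.
have := archi_boundP (normr_ge0 (re (c - e1 alpha))).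
have h := ler_norm (re (c - e1 alpha)); rewrite -/N natrD re0.
by have n0 : 0 < n.+1%:R :> R; [rewrite ltr0n | lra].
Qed.


(** Every pair as in Levelt's theorem, with distinct eigenvalues in each spectrum,
generates a monodromy group up to conjugation. *)
Theorem realize_hypergeometric A B alpha beta :
  injective (fun j => exp2pi (alpha j)) -> injective (fun j => exp2pi (beta j)) ->
  (forall i j, exp2pi (alpha i) != exp2pi (beta j)) ->
  (forall j, eigenvalue A (exp2pi (alpha j))) -> (forall j, eigenvalue B (exp2pi (beta j))) ->
  (\rank (A - B)%R <= 1)%N ->
  exists alpha' beta', (forall i j, exp2pi (alpha' i) != exp2pi (beta' j)) /\
  exists2 P : 'M[C]_3, P \in unitmx &
    monodromy_group alpha' beta' (conjugate_set P (generated (gens2 A B))).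
Proof.
move=> ia ib ab hA hB rk.
have [al alE nonres] := shift_parameter alpha (e1 (fun i => beta i - 1)).
have Ea : (fun j => exp2pi (al j)) = (fun j => exp2pi (alpha j)) by apply/funext => j.
exists al, beta; split; first by move=> i j; rewrite alE.
have [||M0 [M1 [ [u0 u1] mono z0 z1 rk1]]] := hypergeometric_monodromy (alpha := al) (beta := beta) _ _ nonres.
- by move=> i j; rewrite !alE; apply: contra_neq => /ia.
- by move=> i j; apply: contra_neq => /ib.
(* the pair of hypergeometric generators with eigenvalues exp2pi alpha and exp2pi beta *)
pose A' := invmx M0 *m M1; pose B' := invmx M0.
have hA' j : eigenvalue A' (exp2pi (alpha j)).
  have [c c0 hc] := z1 j; apply: (eigen_col c0).
  rewrite -mulmxA -alE; have -> : M1 *m c = exp2pi (al j) *: (M0 *m c).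
    by rewrite hc scalerA -exp2piD subrr exp2piE mulr0 cexp0 scale1r.
  by rewrite -scalemxAr mulKmx.
have hB' j : eigenvalue B' (exp2pi (beta j)).
  have [c c0 hc] := z0 j; apply: (eigen_col c0).
  have e0 := exp2pi_neq0 (1 - beta j).
  have -> : exp2pi (beta j) = (exp2pi (1 - beta j))^-1.
    by rewrite -exp2piN opprB exp2piD exp2piN (exp2pi_nat R 1) invr1 mulr1.
  by apply: (scalerI e0); rewrite scalerA mulfV // scale1r scalemxAr -hc mulKmx.
have rk' : (\rank (A' - B')%R <= 1)%N.
  rewrite /A' /B' -[X in _ - X]mulmx1 -mulmxBr; exact: leq_trans (mxrankM_maxr _ _) rk1.
have [P uP [PA PB]] := levelt ia ib ab hA hB rk.
have [P' uP' [PA' PB']] := levelt ia ib ab hA' hB' rk'.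
have uQ : P' *m invmx P \in unitmx by rewrite unitmx_mul unitmx_inv uP'.
exists (P' *m invmx P) => //.
have conj X X' Y : X *m P = P *m Y -> X' *m P' = P' *m Y ->
    P' *m invmx P *m X *m invmx (P' *m invmx P) = X'.
  move=> h h'; rewrite invmxM ?unitmx_inv // invmxK !mulmxA -(mulmxA _ X P) h.
  by rewrite !mulmxA mulmxKV // -h' mulmxK.
have uA := eigen_unit ia hA (fun j => exp2pi_neq0 _).
have uB := eigen_unit ib hB (fun j => exp2pi_neq0 _).
rewrite gen_conj //
  (_ : conjugate_set _ _ = gens2 A' B'); last first.
  apply/seteqP; split=> M.
    by case=> X [] -> <-; [left; exact: conj PA PA' | right; exact: conj PB PB'].
  by case=> ->; [exists A; [left|exact: conj PA PA'] | exists B; [right | exact: conj PB PB']].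
by rewrite -gens2_inv.
Qed.

End Realize.

(** * Commensurability *)

Section Projective.
Variable K : fieldType.
Implicit Types (S G H : set 'M[K]_3) (A B P M T : 'M[K]_3).

Lemma projP G M : projective G M <-> exists c g, [/\ c != 0, G g & M = c *: g].
Proof.
split; first by case=> c c0 [g Gg <-]; exists c, g.
by case=> c [g [c0 Gg ->]]; exists c => //; exists g.
Qed.

Lemma proj_scale G c M : c != 0 -> projective G M -> projective G (c *: M).
Proof.
move=> c0 /projP[d [g [d0 Gg ->]]]; apply/projP; exists (c * d), g.
by rewrite mulf_neq0 // scalerA.
Qed.

Lemma proj_scaler G c M : c != 0 -> projective G (c *: M) -> projective G M.
Proof.
move=> c0 /(proj_scale (_ : c^-1 != 0)); rewrite invr_eq0 scalerA mulVf // scale1r; exact.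
Qed.

Lemma proj_sub G M : G M -> projective G M.
Proof. by move=> GM; apply/projP; exists 1, M; rewrite oner_neq0 scale1r. Qed.

Lemma conj_proj P G : conjugate_set P (projective G) = projective (conjugate_set P G).
Proof.
apply/seteqP; split=> M.
  case=> _ /projP[c [g [c0 Gg ->]]] <-; apply/projP; exists c, (P *m g *m invmx P).
  by split=> //; [exists g | rewrite -scalemxAr -scalemxAl].
move=> /projP[c [_ [c0 [g Gg <-] ->]]]; exists (c *: g); last by rewrite -scalemxAr -scalemxAl.
by apply/projP; exists c, g.
Qed.

Section Generated.
Variable S : set 'M[K]_3.
Hypothesis uS : forall x, S x -> x \in unitmx.
Local Notation G' := (projective (generated S)).

Lemma proj1 : G' 1%:M. Proof. by apply: proj_sub; exact: generated1. Qed.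

Lemma proj_unit M : G' M -> M \in unitmx.
Proof.
move=> /projP[c [g [c0 Gg ->]]]; rewrite unitmxZ ?unitfE //; exact: generated_unit Gg.
Qed.

Lemma proj_mul g h : G' g -> G' h -> G' (g *m h).
Proof.
move=> /projP[c [x [c0 Gx ->]]] /projP[d [y [d0 Gy ->]]].
rewrite -scalemxAl -scalemxAr scalerA; apply/projP; exists (c * d), (x *m y).
by rewrite mulf_neq0 //; split=> //; exact: gen_mul.
Qed.

Lemma invmx_scale c M : c != 0 -> M \in unitmx -> invmx (c *: M) = c^-1 *: invmx M.
Proof.
move=> c0 uM; have uc : c *: M \in unitmx by rewrite unitmxZ ?unitfE.
apply: (can_inj (mulKmx uc)).
by rewrite mulmxV // -scalemxAl -scalemxAr scalerA mulfV // scale1r mulmxV.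
Qed.

Lemma proj_inv g : G' g -> G' (invmx g).
Proof.
move=> /projP[c [x [c0 Gx ->]]]; rewrite invmx_scale ?(generated_unit _ Gx) //.
by apply: proj_scale; [rewrite invr_eq0 | apply: proj_sub; exact: gen_inv].
Qed.

Lemma proj_exp g n : G' g -> G' (g ^+ n).
Proof.
move=> Gg; elim: n => [|n IH]; first exact: proj1.
by rewrite exprS; exact: proj_mul.
Qed.

(** Induction over the words in the generators, up to scalars. *)
Lemma proj_min (X : set 'M[K]_3) : X 1%:M -> (forall c x, c != 0 -> X x -> X (c *: x)) ->
  (forall s x, S s -> X x -> X (s *m x)) -> (forall s x, S s -> X x -> X (invmx s *m x)) ->
  G' `<=` X.
Proof.
move=> X1 Xc XM XV M /projP[c [g [c0 + ->]]] => Gg; apply: (Xc _ _ c0).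
by elim: Gg => // s x Ss _; [exact: XM | exact: XV].
Qed.

End Generated.

Lemma proj_subset S S' : (forall x, S' x -> x \in unitmx) -> S `<=` projective (generated S') ->
  projective (generated S) `<=` projective (generated S').
Proof.
move=> uS' h; apply: proj_min.
- exact: proj1.
- by move=> c x; exact: proj_scale.
- by move=> s x /h; exact: proj_mul.
- by move=> s x /h hs hx; apply: proj_mul => //; exact: proj_inv.
Qed.

Lemma finite_index_refl H G : G 1%:M -> (forall g, G g -> H g) -> finite_index H G.
Proof.
move=> G1 GH; exists [:: 1%:M] => [x|g Gg]; first by rewrite inE => /eqP ->.
by exists 1%:M; rewrite ?inE // invmx1 mul1mx; exact: GH.
Qed.

Lemma finite_index_conj P H G : P \in unitmx ->
  finite_index H G ->
  finite_index (conjugate_set P H) (conjugate_set P G).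
Proof.
move=> uP [s sG hs]; exists [seq P *m x *m invmx P | x <- s].
  by move=> _ /mapP[x xs ->]; exists x => //; exact: sG.
move=> _ [g Gg <-]; have [x xs hx] := hs g Gg; exists (P *m x *m invmx P).
  by apply/mapP; exists x.
exists (invmx x *m g) => //.
by rewrite (conj_inv _ uP) conj_mul.
Qed.

Lemma conj_comp P Q G : P \in unitmx -> Q \in unitmx ->
  conjugate_set P (conjugate_set Q G) = conjugate_set (P *m Q) G.
Proof.
move=> uP uQ; apply/seteqP; split=> M.
  by case=> _ [g Gg <-] <-; exists g => //; rewrite invmxM // !mulmxA.
case=> g Gg <-; exists (Q *m g *m invmx Q); first by exists g.
by rewrite invmxM // !mulmxA.
Qed.

Lemma conj_id G : conjugate_set 1%:M G = G.
Proof.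
have E (g : 'M[K]_3) : 1%:M *m g *m invmx 1%:M = g by rewrite invmx1 mul1mx mulmx1.
apply/seteqP; split=> M; first by case=> g Gg <-; rewrite E.
by exists M.
Qed.

Lemma conj_setI P G H : P \in unitmx ->
  conjugate_set P (G `&` H) = conjugate_set P G `&` conjugate_set P H.
Proof.
move=> uP; apply/seteqP; split=> M; first by case=> g [Gg Hg] <-; split; exists g.
case=> -[g Gg <-] [h Hh /(can_inj (mulmxK (_ : invmx P \in unitmx)))].
rewrite unitmx_inv => /(_ uP)/(can_inj (mulKmx uP)) hg.
by exists g => //; split=> //; rewrite -hg.
Qed.

Lemma conjK P G : P \in unitmx -> conjugate_set (invmx P) (conjugate_set P G) = G.
Proof. by move=> uP; rewrite conj_comp ?unitmx_inv // mulVmx // conj_id. Qed.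

Lemma commensurable_conj P G H : P \in unitmx ->
  commensurable (conjugate_set P G) H -> commensurable G H.
Proof.
move=> uP [Q uQ [h1 h2]]; have uV : invmx P \in unitmx by rewrite unitmx_inv.
exists (invmx P *m Q); first by rewrite unitmx_mul uV.
move: (finite_index_conj uV h1) (finite_index_conj uV h2).
by rewrite conj_setI // -!conj_proj conjK // conj_comp.
Qed.

Lemma commensurable_conj2 P G H : P \in unitmx ->
  finite_index (projective G `&` projective H) (projective G) /\
  finite_index (projective G `&` projective H) (projective H) ->
  commensurable G (conjugate_set P H).
Proof.
move=> uP h; exists (invmx P); first by rewrite unitmx_inv.
by rewrite /= -conj_proj conjK.
Qed.

(** T normalizes the group generated by S up to scalars; A and B are translates of T by
elements of that group, and they generate T and S in turn. *)
Section Extension.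
Variables (S : set 'M[K]_3) (A B T w w' : 'M[K]_3) (n : nat).
Hypothesis uS : forall x, S x -> x \in unitmx.
Local Notation G' := (projective (generated S)).
Local Notation D' := (projective (generated (gens2 A B))).
Hypotheses (uT : T \in unitmx) (n0 : (0 < n)%N).
Hypotheses (nT : forall x, S x -> G' (invmx T *m x *m T)) (Tn : G' (T ^+ n)).
Hypotheses (hA : A = w *m T) (hB : B = w' *m T) (Gw : G' w) (Gw' : G' w').
Hypotheses (DT : D' T) (DS : S `<=` D').

Let uA : A \in unitmx. Proof. by rewrite hA unitmx_mul (proj_unit uS Gw). Qed.
Let uB : B \in unitmx. Proof. by rewrite hB unitmx_mul (proj_unit uS Gw'). Qed.
Let uAB := gens2_unit uA uB.

Let nT' x : G' x -> G' (invmx T *m x *m T).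
Proof.
move: x; apply: proj_min.
- by rewrite mulmx1 mulVmx //; exact: proj1.
- by move=> c x c0 h; rewrite -scalemxAr -scalemxAl; exact: proj_scale.
- move=> s x /nT h1 h2; rewrite (_ : _ *m _ = invmx T *m s *m T *m (invmx T *m x *m T)).
    exact: proj_mul.
  by rewrite -!mulmxA (mulKVmx uT).
- move=> s x Ss h2; have us := uS Ss.
  rewrite (_ : _ *m _ = invmx (invmx T *m s *m T) *m (invmx T *m x *m T)).
    by apply: proj_mul => //; apply: proj_inv => //; exact: nT.
  by rewrite !invmxM ?unitmx_mul ?unitmx_inv ?uT // invmxK -!mulmxA (mulKVmx uT).
Qed.

Let nTk k x : G' x -> exists2 y, G' y & x *m T ^+ k = T ^+ k *m y.
Proof.
move=> Gx; elim: k => [|k [y Gy E]]; first by exists x => //; rewrite mulmx1 mul1mx.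
exists (invmx T *m y *m T); first exact: nT'.
by rewrite !exprSr -!mulmxE !mulmxA E -!mulmxA (mulKVmx uT).
Qed.

Let X : set 'M[K]_3 := [set x | exists k, exists2 g, G' g & x = T ^+ k *m g].

Let X_l w0 : G' w0 -> forall x, X x -> X (w0 *m T *m x).
Proof.
move=> Gw0 _ [k [g Gg ->]]; have [y Gy E] := nTk k.+1 Gw0.
exists k.+1, (y *m g); first exact: proj_mul.
by rewrite !mulmxA -E exprS -mulmxE !mulmxA.
Qed.

Let X_r w0 : G' w0 -> forall x, X x -> X (invmx (w0 *m T) *m x).
Proof.
move=> Gw0 _ [k [g Gg ->]]; have uw := proj_unit uS Gw0.
have uTn := proj_unit uS Tn.
have E : invmx T = T ^+ n.-1 *m invmx (T ^+ n).
  rewrite -{2}(prednK n0) exprS -mulmxE invmxM //; last first.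
    by move: uTn; rewrite -{1}(prednK n0) exprS -mulmxE unitmx_mul => /andP[].
  rewrite mulmxA mulmxV ?mul1mx //.
  by move: uTn; rewrite -{1}(prednK n0) exprS -mulmxE unitmx_mul => /andP[].
have G1 : G' (invmx (T ^+ n) *m invmx w0) by apply: proj_mul => //; apply: proj_inv.
have [y Gy F] := nTk k G1.
exists (n.-1 + k)%N, (y *m g); first exact: proj_mul.
by rewrite invmxM // E exprD -mulmxE -!mulmxA (mulmxA _ y) -F !mulmxA.
Qed.

(** Every element generated by A and B can be written as T^k times an element of G',
as T can be moved to the left; since T^n is in G', finitely many cosets
are left. *)
Lemma commensurable_extension : finite_index (G' `&` D') G' /\ finite_index (G' `&` D') D'.
Proof.
have GD : G' `<=` D' by exact: proj_subset.
split; first by apply: finite_index_refl => [|g Gg]; [exact: proj1 | split=> //; exact: GD].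
exists [seq T ^+ k | k <- iota 0 n].
  by move=> _ /mapP[k _ ->]; apply: (proj_exp uAB).
move=> g Dg.
have [k [h Gh gE]] : X g.
  move: g Dg; apply: proj_min.
  - by exists 0, 1%:M; [exact: proj1 | rewrite mulmx1].
  - move=> c _ c0 [k [h Gh ->]]; exists k, (c *: h); first exact: proj_scale.
    by rewrite scalemxAr.
  - by move=> s x [] ->; [rewrite hA | rewrite hB]; exact: X_l.
  - by move=> s x [] ->; [rewrite hA | rewrite hB]; exact: X_r.
have uTk m : T ^+ m \in unitmx by apply: (proj_unit uAB); exact: proj_exp.
exists (T ^+ (k %% n)); first by apply/mapP; exists (k %% n)%N => //; rewrite mem_iota /= ltn_mod.
have Gr : G' (invmx (T ^+ (k %% n)) *m g).
  rewrite gE {2}(divn_eq k n) addnC exprD -mulmxE -mulmxA mulKmx //.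
  by apply: proj_mul => //; rewrite mulnC exprM; exact: proj_exp.
by split=> //; exact: GD.
Qed.

End Extension.

End Projective.

(** * The hypergeometric commensurability classes *)

Section Class.
Variable R : realType.
Local Notation C := (Cplx R).
Implicit Types (A B P T : 'M[C]_3) (G H : set 'M[C]_3).

Definition hypergeometric_class G := exists alpha beta : 'I_3 -> C,
  (forall j k, exp2pi (alpha j) != exp2pi (beta k)) /\
  exists2 H : set 'M[C]_3, monodromy_group alpha beta H & commensurable G H.

Lemma class_conj P G : P \in unitmx ->
  hypergeometric_class (conjugate_set P G) -> hypergeometric_class G.
Proof.
move=> uP [al [be [ab [H mH c]]]]; exists al, be; split=> //; exists H; first exact: mH.
exact: commensurable_conj uP c.
Qed.

(** Normalization by T gives commensurability, and the spectra of A and B give the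
hypergeometric equation. *)
Lemma class_extension S A B T (w w' : 'M[C]_3) n (alpha beta : 'I_3 -> C) :
  (forall x, S x -> x \in unitmx) -> T \in unitmx -> (0 < n)%N ->
  (forall x, S x -> projective (generated S) (invmx T *m x *m T)) ->
  projective (generated S) (T ^+ n) ->
  A = w *m T -> B = w' *m T -> projective (generated S) w -> projective (generated S) w' ->
  projective (generated (gens2 A B)) T -> S `<=` projective (generated (gens2 A B)) ->
  injective (fun j => exp2pi (alpha j)) -> injective (fun j => exp2pi (beta j)) ->
  (forall i j, exp2pi (alpha i) != exp2pi (beta j)) ->
  (forall j, eigenvalue A (exp2pi (alpha j))) -> (forall j, eigenvalue B (exp2pi (beta j))) ->
  (\rank (A - B)%R <= 1)%N ->
  hypergeometric_class (generated S).
Proof.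
move=> uS uT n0 nT Tn hA hB Gw Gw' DT DS ia ib ab hAe hBe rk.
have [al [be [alb [P uP mono]]]] := realize_hypergeometric ia ib ab hAe hBe rk.
exists al, be; split=> //; eexists; first exact: mono.
apply: (commensurable_conj2 uP); exact: (commensurable_extension uS uT n0 nT Tn hA hB).
Qed.

End Class.

(** * Moves on the parameters of a reflection triple *)

Section Mx3.
Variable K : fieldType.

(** Products of explicit matrices are computed by this rule, so that matrix identities reduce to
nine equations between entries. *)
Lemma mx3M (a1 a2 a3 a4 a5 a6 a7 a8 a9 b1 b2 b3 b4 b5 b6 b7 b8 b9 : K) :
  mx3 [:: [:: a1; a2; a3]; [:: a4; a5; a6]; [:: a7; a8; a9]] *m
  mx3 [:: [:: b1; b2; b3]; [:: b4; b5; b6]; [:: b7; b8; b9]] =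
  mx3 [:: [:: a1 * b1 + a2 * b4 + a3 * b7; a1 * b2 + a2 * b5 + a3 * b8; a1 * b3 + a2 * b6 + a3 * b9];
          [:: a4 * b1 + a5 * b4 + a6 * b7; a4 * b2 + a5 * b5 + a6 * b8; a4 * b3 + a5 * b6 + a6 * b9];
          [:: a7 * b1 + a8 * b4 + a9 * b7; a7 * b2 + a8 * b5 + a9 * b8; a7 * b3 + a8 * b6 + a9 * b9]].
Proof.
apply/matrixP => i j; rewrite mxE sum3 !mxE /=.
by move: i; apply: ord3P; move: j; apply: ord3P.
Qed.

Lemma mx3_eq (a1 a2 a3 a4 a5 a6 a7 a8 a9 b1 b2 b3 b4 b5 b6 b7 b8 b9 : K) :
  a1 = b1 -> a2 = b2 -> a3 = b3 -> a4 = b4 -> a5 = b5 -> a6 = b6 -> a7 = b7 -> a8 = b8 -> a9 = b9 ->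
  mx3 [:: [:: a1; a2; a3]; [:: a4; a5; a6]; [:: a7; a8; a9]] =
  mx3 [:: [:: b1; b2; b3]; [:: b4; b5; b6]; [:: b7; b8; b9]].
Proof. by move=> -> -> -> -> -> -> -> -> ->. Qed.

Lemma mx3Z (c a1 a2 a3 a4 a5 a6 a7 a8 a9 : K) :
  c *: mx3 [:: [:: a1; a2; a3]; [:: a4; a5; a6]; [:: a7; a8; a9]] =
  mx3 [:: [:: c * a1; c * a2; c * a3]; [:: c * a4; c * a5; c * a6]; [:: c * a7; c * a8; c * a9]].
Proof.
apply/matrixP => i j; rewrite !mxE /=.
by move: i; apply: ord3P; move: j; apply: ord3P.
Qed.

Lemma mx3_1 : mx3 [:: [:: 1; 0; 0]; [:: 0; 1; 0]; [:: 0; 0; 1]] = 1%:M :> 'M[K]_3.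
Proof.
apply/matrixP => i j; rewrite !mxE /=.
by move: i; apply: ord3P; move: j; apply: ord3P.
Qed.

Lemma mx3B (a1 a2 a3 a4 a5 a6 a7 a8 a9 b1 b2 b3 b4 b5 b6 b7 b8 b9 : K) :
  mx3 [:: [:: a1; a2; a3]; [:: a4; a5; a6]; [:: a7; a8; a9]] -
  mx3 [:: [:: b1; b2; b3]; [:: b4; b5; b6]; [:: b7; b8; b9]] =
  mx3 [:: [:: a1 - b1; a2 - b2; a3 - b3]; [:: a4 - b4; a5 - b5; a6 - b6];
          [:: a7 - b7; a8 - b8; a9 - b9]].
Proof.
apply/matrixP => i j; rewrite !mxE /=.
by move: i; apply: ord3P; move: j; apply: ord3P.
Qed.

Lemma unit_right (M N : 'M[K]_3) : M *m N = 1%:M -> M \in unitmx.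
Proof. by case/mulmx1_unit. Qed.

(** The two non-obvious relations of the Hurwitz move (R1,R2,R3) to (R1, R3, R3^-1 R2 R3),
deduced from the equation without inverses. *)
Lemma hurwitz_intertwine (P R2 R3 Q2 Q3 : 'M[K]_3) : R3 \in unitmx -> Q2 \in unitmx ->
  P *m Q2 = R3 *m P -> R3 *m P *m Q3 = R2 *m R3 *m P ->
  P *m Q3 = invmx R3 *m (R2 *m R3) *m P /\ R2 *m P = P *m (Q2 *m Q3 *m invmx Q2).
Proof.
move=> u3 u2 h2 h3; split.
  by rewrite -[LHS](mulKmx u3) [X in _ *m X = _]mulmxA h3 !mulmxA.
by rewrite !mulmxA h2 h3 -(mulmxA R2) -h2 mulmxA mulmxK.
Qed.

(** Two generating sets that express each other through P generate conjugate groups.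
Intertwining equations are used instead of conjugates because they contain no inverse
matrices. *)
Lemma intertwine_gen (P : 'M[K]_3) (S S' : set 'M[K]_3) : P \in unitmx ->
  (forall x, S x -> x \in unitmx) -> (forall x, S' x -> x \in unitmx) ->
  (forall x, S' x -> exists2 y, generated S y & P *m x = y *m P) ->
  (forall x, S x -> exists2 y, generated S' y & x *m P = P *m y) ->
  generated S' = conjugate_set (invmx P) (generated S).
Proof.
move=> uP uS uS' h h'.
have uV : invmx P \in unitmx by rewrite unitmx_inv.
rewrite gen_conj //.
have uc x : conjugate_set (invmx P) S x -> x \in unitmx.
  by case=> g /uS ug <-; rewrite !unitmx_mul !unitmx_inv uP ug.
apply/seteqP; split; apply: gen_sub => //.
  move=> x /h[y hy E]; rewrite -gen_conj //; exists y => //.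
  by rewrite invmxK -mulmxA -E mulKmx.
by move=> _ [g /h'[y hy E] <-]; rewrite invmxK -mulmxA E mulKmx.
Qed.

End Mx3.

Section Moves.
Variable R : realType.
Local Notation C := (Cplx R).
Variable p : int.
Implicit Types r s t : C.
Let e : C := expi (2 * pi / p%:~R).

Lemma phase_conj (x : R) : (expi x : C) * (expi x)^* = 1.
Proof. by rewrite -normCK normE cabs_expi expr1n. Qed.

Lemma e_neq0 : e != 0.
Proof. by apply/eqP => h; move: (phase_conj (2 * pi / p%:~R)); rewrite -/e h mul0r => /eqP; rewrite eq_sym oner_eq0. Qed.

Definition reflections r s t : set 'M[C]_3 :=
  [set M | [\/ M = refl1 p r t, M = refl2 p r s | M = refl3 p s t]].

Lemma reflections_unit r s t x : reflections r s t x -> x \in unitmx.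
Proof.
have e0 := e_neq0.
case=> ->.
- apply: (@unit_right _ _ (mx3 [:: [:: e^-1; - e^-1 * r; e^-1 * t^*]; [:: 0; 1; 0]; [:: 0; 0; 1]])).
  rewrite -mx3_1 /refl1 -/e mx3M; apply: mx3_eq; by field.
- apply: (@unit_right _ _ (mx3 [:: [:: 1; 0; 0]; [:: r^*; e^-1; - e^-1 * s]; [:: 0; 0; 1]])).
  rewrite -mx3_1 /refl2 -/e mx3M; apply: mx3_eq; by field.
- apply: (@unit_right _ _ (mx3 [:: [:: 1; 0; 0]; [:: 0; 1; 0]; [:: - t; s^*; e^-1]])).
  rewrite -mx3_1 /refl3 -/e mx3M; apply: mx3_eq; by field.
Qed.

Definition param_class r s t := hypergeometric_class (refl_group p r s t).

Lemma class_change P (S S' : set 'M[C]_3) : P \in unitmx ->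
  (forall x, S x -> x \in unitmx) -> (forall x, S' x -> x \in unitmx) ->
  (forall x, S' x -> exists2 y, generated S y & P *m x = y *m P) ->
  (forall x, S x -> exists2 y, generated S' y & x *m P = P *m y) ->
  hypergeometric_class (generated S') -> hypergeometric_class (generated S).
Proof.
move=> uP uS uS' h h'; rewrite (intertwine_gen uP uS uS' h h').
by apply: class_conj; rewrite unitmx_inv.
Qed.

Lemma gen_refl1 r s t : generated (reflections r s t) (refl1 p r t).
Proof. by apply: gen_base; apply: Or31. Qed.
Lemma gen_refl2 r s t : generated (reflections r s t) (refl2 p r s).
Proof. by apply: gen_base; apply: Or32. Qed.
Lemma gen_refl3 r s t : generated (reflections r s t) (refl3 p s t).
Proof. by apply: gen_base; apply: Or33. Qed.

(** The map e1 to e.e2, e2 to e.e3, e3 to e1 conjugates the triple with shifted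
parameters to the given one. *)
Lemma param_cyclic r s t : param_class s t r -> param_class r s t.
Proof.
have e0 := e_neq0.
pose J : 'M[C]_3 := mx3 [:: [:: 0; 0; 1]; [:: e; 0; 0]; [:: 0; e; 0]].
have uJ : J \in unitmx.
  apply: (@unit_right _ _ (mx3 [:: [:: 0; e^-1; 0]; [:: 0; 0; e^-1]; [:: 1; 0; 0]])).
  rewrite -mx3_1 mx3M; apply: mx3_eq; by field.
have E1 : J *m refl1 p s r = refl2 p r s *m J.
  by rewrite /refl1 /refl2 -/e !mx3M; apply: mx3_eq; ring.
have E2 : J *m refl2 p s t = refl3 p s t *m J.
  by rewrite /refl2 /refl3 -/e !mx3M; apply: mx3_eq; ring.
have E3 : J *m refl3 p t r = refl1 p r t *m J.
  by rewrite /refl1 /refl3 -/e !mx3M; apply: mx3_eq; ring.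
apply: (class_change uJ (@reflections_unit r s t) (@reflections_unit s t r)).
  move=> x [] ->; [exists (refl2 p r s)|exists (refl3 p s t)|exists (refl1 p r t)].
  - exact: gen_refl2.
  - exact: E1.
  - exact: gen_refl3.
  - exact: E2.
  - exact: gen_refl1.
  - exact: E3.
move=> x [] ->; [exists (refl3 p t r)|exists (refl1 p s r)|exists (refl2 p s t)].
- exact: gen_refl3.
- exact/esym/E3.
- exact: gen_refl1.
- exact/esym/E1.
- exact: gen_refl2.
- exact/esym/E2.
Qed.

(** The Hurwitz move: R1, R3 and R3^-1 R2 R3 generate the same group, and in the basis
formed by the vectors e1, e3 and e2 + s^* e3 they are again standard reflections. *)
Lemma param_hurwitz r s t : param_class (- t^*) (- s^*) (s * t - r^*) -> param_class r s t.
Proof.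
have e0 := e_neq0.
pose P : 'M[C]_3 := mx3 [:: [:: 1; 0; 0]; [:: 0; 0; 1]; [:: 0; 1; s^*]].
have uP : P \in unitmx.
  apply: (@unit_right _ _ (mx3 [:: [:: 1; 0; 0]; [:: 0; - s^*; 1]; [:: 0; 1; 0]])).
  rewrite -mx3_1 mx3M; apply: mx3_eq; by ring.
have [r' r'E] : exists r', r' = - t^* by exists (- t^*).
have [s' s'E] : exists s', s' = - s^* by exists (- s^*).
have [t' t'E] : exists t', t' = s * t - r^* by exists (s * t - r^*).
rewrite -r'E -s'E -t'E.
have r'C : r'^* = - t by rewrite r'E rmorphN /= conjCK.
have s'C : s'^* = - s by rewrite s'E rmorphN /= conjCK.
have t'C : t'^* = s^* * t^* - r by rewrite t'E rmorphB rmorphM /= conjCK.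
have E1 : P *m refl1 p r' t' = refl1 p r t *m P.
  by rewrite /refl1 -/e t'C r'E !mx3M; apply: mx3_eq; ring.
have E2 : P *m refl2 p r' s' = refl3 p s t *m P.
  by rewrite /refl2 /refl3 -/e r'C s'E !mx3M; apply: mx3_eq; ring.
have E3 : refl3 p s t *m P *m refl3 p s' t' = refl2 p r s *m refl3 p s t *m P.
  by rewrite /refl2 /refl3 -/e s'C t'E !mx3M; apply: mx3_eq; ring.
have uS := @reflections_unit r s t; have uS' := @reflections_unit r' s' t'.
have [||E3' E4] := hurwitz_intertwine _ _ E2 E3; [exact/uS/Or33 | exact/uS'/Or32 |].
have g1 := gen_refl1 r s t; have g2 := gen_refl2 r s t; have g3 := gen_refl3 r s t.
have g1' := gen_refl1 r' s' t'; have g2' := gen_refl2 r' s' t'; have g3' := gen_refl3 r' s' t'.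
apply: (class_change uP uS uS').
  move=> x [] ->; eexists.
  - exact: g1.
  - exact: E1.
  - exact: g3.
  - exact: E2.
  - exact: gen_mul uS (gen_inv uS g3) (gen_mul uS g2 g3).
  - exact: E3'.
move=> x [] ->; eexists.
- exact: g1'.
- exact: esym E1.
- exact: gen_mul uS' (gen_mul uS' g2' g3') (gen_inv uS' g2').
- exact: E4.
- exact: g2'.
- exact: esym E2.
Qed.

(** Diagonal conjugation: up to conjugation, the group depends only on the moduli of the
parameters and on their product. *)
Lemma param_rescale r s t r' s' t' : r != 0 -> t != 0 -> r' * r'^* = r * r^* -> t' * t'^* = t * t^* ->
  r' * s' * t' = r * s * t -> param_class r' s' t' -> param_class r s t.
Proof.
move=> r0 t0 hr ht h.
have r'0 : r' != 0.
  by apply: contra_neq r0 => E; move/eqP: hr; rewrite E mul0r eq_sym mul_conjC_eq0 => /eqP.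
have t'0 : t' != 0.
  by apply: contra_neq t0 => E; move/eqP: ht; rewrite E mul0r eq_sym mul_conjC_eq0 => /eqP.
have [d2 d2E] : exists d, d = r' / r by exists (r' / r).
have [d3 d3E] : exists d, d = t / t' by exists (t / t').
have d20 : d2 != 0 by rewrite d2E mulf_neq0 ?invr_eq0.
have d30 : d3 != 0 by rewrite d3E mulf_neq0 ?invr_eq0.
have s'E : s' = s * d3 / d2.
  apply: (mulfI r'0); apply: (mulIf t'0); rewrite h d2E d3E; field; exact/and3P.
have d2C : d2^* = d2^-1.
  apply: (mulfI d20); rewrite mulfV // d2E rmorphM fmorphV /=.
  have rC0 : r^* != 0 by rewrite conjC_eq0.
  by apply: (mulIf (mulf_neq0 r0 rC0)); rewrite mul1r -[RHS]hr; field; exact/andP.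
have d3C : d3^* = d3^-1.
  apply: (mulfI d30); rewrite mulfV // d3E rmorphM fmorphV /=.
  have tC0 : t'^* != 0 by rewrite conjC_eq0.
  by apply: (mulIf (mulf_neq0 t'0 tC0)); rewrite mul1r [RHS]ht; field; exact/andP.
have r'E : r' = r * d2 by rewrite d2E mulrC mulfVK.
have t'E : t' = t / d3 by rewrite d3E invfM invrK mulrA mulfV ?mul1r.
pose P : 'M[C]_3 := mx3 [:: [:: 1; 0; 0]; [:: 0; d2; 0]; [:: 0; 0; d3]].
have uP : P \in unitmx.
  apply: (@unit_right _ _ (mx3 [:: [:: 1; 0; 0]; [:: 0; d2^-1; 0]; [:: 0; 0; d3^-1]])).
  rewrite -mx3_1 mx3M; apply: mx3_eq; by field.
have r'C : r'^* = r^* / d2 by rewrite r'E rmorphM /= d2C.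
have t'C : t'^* = t^* * d3 by rewrite t'E rmorphM fmorphV /= d3C invrK.
have s'C : s'^* = s^* * d2 / d3 by rewrite s'E !rmorphM fmorphV /= d2C d3C invrK mulrAC.
have e0 := e_neq0.
have E1 : P *m refl1 p r' t' = refl1 p r t *m P.
  by rewrite /refl1 -/e t'C r'E !mx3M; apply: mx3_eq; ring.
have E2 : P *m refl2 p r' s' = refl2 p r s *m P.
  by rewrite /refl2 -/e r'C s'E !mx3M; apply: mx3_eq; field.
have E3 : P *m refl3 p s' t' = refl3 p s t *m P.
  by rewrite /refl3 -/e s'C t'E !mx3M; apply: mx3_eq; field.
apply: (class_change uP (@reflections_unit r s t) (@reflections_unit r' s' t')).
  move=> x [] ->; eexists.
  - exact: gen_refl1.
  - exact: E1.
  - exact: gen_refl2.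
  - exact: E2.
  - exact: gen_refl3.
  - exact: E3.
move=> x [] ->; eexists.
- exact: gen_refl1.
- exact: esym E1.
- exact: gen_refl2.
- exact: esym E2.
- exact: gen_refl3.
- exact: esym E3.
Qed.

End Moves.

(** * Spectra given by rational angles *)

Section Angles.
Variable R : realType.
Local Notation C := (Cplx R).
Implicit Types (x y : rat).

(** Roots of unity are indexed by rational angles, so that their equality can be
decided by computation. *)
Definition expq x : C := expi (2 * pi * ratr x).

Lemma expqD x y : expq (x + y) = expq x * expq y.
Proof. by rewrite /expq rmorphD mulrDr expiD. Qed.

Lemma expq0 : expq 0 = 1.
Proof. by rewrite /expq rmorph0 mulr0 expi0. Qed.

Lemma expq1 : expq 1 = 1.
Proof. by rewrite /expq rmorph1 mulr1 expi2pi. Qed.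

Lemma expq_neq0 x : expq x != 0.
Proof. by apply/eqP => h; have := cabs_expi (2 * pi * ratr x : R); rewrite -/(expq x) h cabs0 => /eqP; rewrite eq_sym oner_eq0. Qed.

Lemma expqN x : expq (- x) = (expq x)^-1.
Proof. by apply: (mulfI (expq_neq0 x)); rewrite -expqD subrr expq0 mulfV ?expq_neq0. Qed.

Lemma expqC x : (expq x)^* = expq (- x).
Proof. by apply: (mulfI (expq_neq0 x)); rewrite phase_conj -expqD subrr expq0. Qed.

Lemma expq_shift x : expq (x + 1) = expq x.
Proof. by rewrite expqD expq1 mulr1. Qed.

Lemma exp2pi_expq x : exp2pi (ofR (ratr x) : C) = expq x.
Proof.
rewrite exp2piE /twopii /cexp /expq.
have -> : (0 +i* (2 * pi)) * ofR (ratr x) = 0 +i* (2 * pi * ratr x) :> C.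
  by apply: cplx_eq; rewrite ?reM ?imM re_cplx im_cplx ?re_cplx ?im_cplx /=; ring.
by rewrite -/(re _) -/(im _) re_cplx im_cplx expR0 mul1r.
Qed.

Lemma expq_neq1 x : 0 < x < 1 -> expq x != 1.
Proof.
move=> /andP[x0 x1]; apply/eqP => h.
have hs : sin (2 * pi * ratr x : R) = 0 by rewrite -[RHS]im1 -h.
have hc : cos (2 * pi * ratr x : R) = 1 by rewrite -[RHS]re1 -h.
have p0 := pi_gt0 R.
have r0 : 0 < ratr x :> R by rewrite ltr0q.
have r1 : ratr x < 1 :> R by rewrite -(rmorph1 (@ratr R)) ltr_rat.
move: (ratr x) r0 r1 hs hc => y y0 y1 hs hc.
have [h1|h1|h1] := ltrgtP y 2^-1.
- have : 0 < sin (2 * pi * y) by apply: sin_gt0_pi; nra.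
  by rewrite hs ltxx.
- have : sin (2 * pi * y) < 0 by apply: sin_neg; apply/andP; split; nra.
  by rewrite hs ltxx.
- move: hc; rewrite h1 (_ : 2 * pi * 2^-1 = pi) ?cospi; first by lra.
  by field.
Qed.

(** An interval of length one, on which the exponential is injective. *)
Definition window (s : seq rat) := all (fun x => - (1/2) <= x < 1/2) s.

Lemma expq_inj s : window s -> {in s &, injective expq}.
Proof.
move=> /allP ws x y /ws/andP[x0 x1] /ws/andP[y0 y1] h.
wlog lt : x y x0 x1 y0 y1 h / x < y.
  move=> W; have [] := ltrgtP x y => // l; first exact: W.
  by apply/esym; apply: W.
have /expq_neq1/eqP[] : 0 < y - x < 1 by apply/andP; split; lra.
by rewrite expqD -h -expqD subrr expq0.
Qed.

Lemma class_angles (S : set 'M[C]_3) (A B T w w' : 'M[C]_3) (n : nat) (a b : seq rat) :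
  (forall x : 'M[C]_3, S x -> x \in unitmx) -> T \in unitmx -> (0 < n)%N ->
  (forall x : 'M[C]_3, S x -> projective (generated S) (invmx T *m x *m T)) ->
  projective (generated S) (T ^+ n) ->
  A = w *m T -> B = w' *m T -> projective (generated S) w -> projective (generated S) w' ->
  projective (generated (gens2 A B)) T -> S `<=` projective (generated (gens2 A B)) ->
  size a = 3 -> size b = 3 -> window (a ++ b) && uniq (a ++ b) ->
  (forall x, x \in a -> eigenvalue A (expq x)) -> (forall x, x \in b -> eigenvalue B (expq x)) ->
  (\rank (A - B)%R <= 1)%N ->
  hypergeometric_class (generated S).
Proof.
move=> uS uT n0 nT Tn hA hB Gw Gw' DT DS sa sb /andP[wab].
rewrite cat_uniq => /and3P[ua /hasPn dab ub] hAe hBe rk.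
have inj := expq_inj wab.
have ina (i : 'I_3) : a`_i \in a by rewrite mem_nth // sa.
have inb (i : 'I_3) : b`_i \in b by rewrite mem_nth // sb.
apply: (class_extension uS uT n0 nT Tn hA hB Gw Gw' DT DS (alpha := fun j => ofR (ratr a`_j))
  (beta := fun j => ofR (ratr b`_j))) => //.
- move=> i j; rewrite !exp2pi_expq => /inj; rewrite !mem_cat !ina => /(_ erefl erefl)/eqP.
  by rewrite nth_uniq ?sa // => /eqP/val_inj.
- move=> i j; rewrite !exp2pi_expq => /inj; rewrite !mem_cat !inb !orbT => /(_ erefl erefl)/eqP.
  by rewrite nth_uniq ?sb // => /eqP/val_inj.
- move=> i j; rewrite !exp2pi_expq; apply/eqP => /inj; rewrite !mem_cat ina inb orbT => /(_ erefl erefl) h.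
  by have := dab _ (inb j); rewrite -h ina.
- by move=> j; rewrite exp2pi_expq; apply: hAe.
- by move=> j; rewrite exp2pi_expq; apply: hBe.
Qed.

End Angles.

(** * Two types of triples *)

Section Rank.
Variable K : fieldType.

(** Multiplication by a complex reflection changes a matrix by rank one. *)
Lemma rank_mulmx_sub1 (M N : 'M[K]_3) (x : 'cV[K]_3) (y : 'rV[K]_3) : M - 1%:M = x *m y ->
  (\rank (N - M *m N)%R <= 1)%N.
Proof.
move=> h; have -> : N - M *m N = - (x *m (y *m N)).
  by rewrite mulmxA -h mulmxBl mul1mx opprB.
rewrite mxrank_opp; exact: leq_trans (mxrankM_maxl _ _) (rank_leq_col _).
Qed.

Lemma mx3_col (a1 a2 a3 a4 a5 a6 a7 a8 a9 x1 x2 x3 u : K) :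
  a1 * x1 + a2 * x2 + a3 * x3 = u * x1 -> a4 * x1 + a5 * x2 + a6 * x3 = u * x2 ->
  a7 * x1 + a8 * x2 + a9 * x3 = u * x3 ->
  let c : 'cV[K]_3 := \col_i [:: x1; x2; x3]`_i in
  mx3 [:: [:: a1; a2; a3]; [:: a4; a5; a6]; [:: a7; a8; a9]] *m c = u *: c.
Proof.
move=> h1 h2 h3; apply/matrixP => i j; rewrite mxE sum3 !mxE /=.
by move: i; apply: ord3P.
Qed.

Lemma rank1_row (a1 a2 a3 : K) : exists (x : 'cV[K]_3) (y : 'rV[K]_3),
  mx3 [:: [:: a1; a2; a3]; [:: 0; 1; 0]; [:: 0; 0; 1]] - 1%:M = x *m y.
Proof.
exists (\col_i (i == 0)%:R), (\row_i [:: a1 - 1; a2; a3]`_i).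
apply/matrixP => i j; rewrite -mx3_1 mx3B [RHS]mxE big_ord1 !mxE.
by move: i; apply: ord3P; move: j; apply: ord3P; rewrite /= ?mul1r ?mul0r ?subr0 ?subrr.
Qed.

Section Intertwining.
Variables (T x y : 'M[K]_3) (S : set 'M[K]_3).
Hypotheses (uT : T \in unitmx) (h : T *m x = y *m T).

Lemma intertwine_normal : projective (generated S) x -> projective (generated S) (invmx T *m y *m T).
Proof. by rewrite -mulmxA -h mulKmx. Qed.

Hypotheses (uS : forall z, S z -> z \in unitmx) (ST : projective (generated S) T).

Lemma intertwine_target : projective (generated S) x -> projective (generated S) y.
Proof.
by move=> Sx; rewrite -(mulmxK uT y) -h; apply: proj_mul => //; [exact: proj_mul | exact: proj_inv].
Qed.

End Intertwining.

Lemma conj_commute (Q X Y Z : 'M[K]_3) : Z \in unitmx -> Q *m Z = Z *m Q ->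
  Q *m X = Z *m Y -> Q *m (invmx Z *m X) = Y.
Proof.
move=> uZ h hX; rewrite -[RHS](mulKmx uZ) -hX !mulmxA; congr (_ *m X).
by apply: (can_inj (mulmxK uZ)); rewrite mulmxKV // -mulmxA h mulKmx.
Qed.

Lemma inv_sum (u0 u1 u2 : K) : u0 != 0 -> u1 != 0 -> u2 != 0 ->
  u0^-1 + u1^-1 + u2^-1 = (u0 * u1 + u0 * u2 + u1 * u2) / (u0 * u1 * u2).
Proof. by move=> n0 n1 n2; field; exact/and3P. Qed.

(** B = M A with M a generator, so M is a quotient of the two matrices. *)
Lemma gens2_quotient (A M : 'M[K]_3) : A \in unitmx -> M \in unitmx ->
  [/\ forall x, gens2 A (M *m A) x -> x \in unitmx, projective (generated (gens2 A (M *m A))) A &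
     projective (generated (gens2 A (M *m A))) M].
Proof.
move=> uA uM; have uAB : forall x, gens2 A (M *m A) x -> x \in unitmx.
  by apply: gens2_unit; rewrite ?unitmx_mul ?uM.
split=> //; first exact/proj_sub/gens2_l.
rewrite -[M in X in _ X](mulmxK uA); apply: proj_mul => //; first exact/proj_sub/gens2_r.
by apply: proj_inv => //; exact/proj_sub/gens2_l.
Qed.

End Rank.

Section Types.
Variable R : realType.
Local Notation C := (Cplx R).
Variable p : int.
Let e : C := expi (2 * pi / p%:~R).

Lemma e_expq : e = expq R (1 / p%:~R).
Proof. by rewrite /e /expq fmorph_div rmorph1 /= ratr_int mul1r. Qed.

(** The angles of the cube roots of 1/e, chosen in the interval of [window] when p is at least 2. *)
Definition cubic_angles : seq rat :=
  [:: - (1 / p%:~R) / 3; (1 - 1 / p%:~R) / 3; (-1 - 1 / p%:~R) / 3].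

Lemma expq_int (n : int) : expq R n%:~R = 1.
Proof.
have nat m : expq R m%:R = 1.
  by elim: m => [|m IH]; [exact: expq0 | rewrite -natr1 expq_shift].
by case: n => n; [rewrite -pmulrn nat | rewrite NegzE mulrNz -pmulrn expqN nat invr1].
Qed.

Lemma cubic_anglesP x : x \in cubic_angles -> expq R x ^+ 3 = e^-1.
Proof.
rewrite /cubic_angles; move: (1 / p%:~R) e_expq => q eq.
have E y (n : int) : y *+ 3 = - q + n%:~R -> expq R y ^+ 3 = e^-1.
  move=> h; rewrite eq -expqN -[RHS]mulr1 -(expq_int n) -expqD -h !exprS expr0 mulr1.
  by rewrite !mulrS mulr0n addr0 !expqD.
rewrite !inE => /or3P[] /eqP ->; [apply: (E _ 0)|apply: (E _ 1)|apply: (E _ (-1))]; by field.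
Qed.

(** J permutes the reflections cyclically, and J^3 is the scalar e^2. For every eigenvalue u
of A = J/e or of R1 A the vector (u^2, u, 1) is an eigenvector: A shifts the entries, and R1
changes only the first one. *)
Lemma class_cubic_type t (b : seq rat) : size b = 3 -> window (cubic_angles ++ b) && uniq (cubic_angles ++ b) ->
  (forall x, x \in b -> expq R x ^+ 3 = t * expq R x ^+ 2 - t^* * expq R x + 1) ->
  param_class p t t t.
Proof.
move=> sb chk hb; have e0 := e_neq0 R p; rewrite -/e in e0.
have [J JE] : exists M : 'M[C]_3, M = mx3 [:: [:: 0; 0; 1]; [:: e; 0; 0]; [:: 0; e; 0]] by eexists.
have [A AE] : exists M : 'M[C]_3, M = mx3 [:: [:: 0; 0; e^-1]; [:: 1; 0; 0]; [:: 0; 1; 0]] by eexists.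
have uJ : J \in unitmx.
  apply: (@unit_right _ _ (mx3 [:: [:: 0; e^-1; 0]; [:: 0; 0; e^-1]; [:: 1; 0; 0]])).
  rewrite JE -mx3_1 mx3M; apply: mx3_eq; by field.
have AJ : A = e^-1 *: J by rewrite AE JE mx3Z; apply: mx3_eq; field.
have E1 : J *m refl1 p t t = refl2 p t t *m J.
  by rewrite JE /refl1 /refl2 -/e !mx3M; apply: mx3_eq; ring.
have E2 : J *m refl2 p t t = refl3 p t t *m J.
  by rewrite JE /refl2 /refl3 -/e !mx3M; apply: mx3_eq; ring.
have E3 : J *m refl3 p t t = refl1 p t t *m J.
  by rewrite JE /refl1 /refl3 -/e !mx3M; apply: mx3_eq; ring.
have J3 : J ^+ 3 = e ^+ 2 *: 1%:M.
  by rewrite -[J ^+ 3]/(J *m (J *m J)) JE !mx3M -mx3_1 mx3Z; apply: mx3_eq; ring.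
have uS := @reflections_unit _ p t t t.
have e0' : e^-1 != 0 by rewrite invr_eq0.
have e20 : e ^+ 2 != 0 by rewrite expf_neq0.
have uA : A \in unitmx by rewrite AJ unitmxZ ?unitfE.
have uR1 : refl1 p t t \in unitmx by apply/uS/Or31.
have [uAB dA d1] := gens2_quotient uA uR1.
have dJ : projective (generated (gens2 A (refl1 p t t *m A))) J by apply: (proj_scaler e0'); rewrite -AJ.
have g1 := proj_sub (gen_refl1 p t t t); have g2 := proj_sub (gen_refl2 p t t t).
have g3 := proj_sub (gen_refl3 p t t t).
apply: (class_angles uS uJ (isT : (0 < 3)%N) (w := e^-1 *: 1%:M) (w' := e^-1 *: refl1 p t t)
  _ _ _ _ _ _ dJ _ (erefl : size cubic_angles = 3) sb chk).
- move=> x [] ->; [exact: intertwine_normal E3 g3 | exact: intertwine_normal E1 g1 |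
    exact: intertwine_normal E2 g2].
- by rewrite J3; apply: proj_scale => //; exact: proj1.
- by rewrite AJ -scalemxAl mul1mx.
- by rewrite AJ -scalemxAl -scalemxAr.
- by apply: proj_scale => //; exact: proj1.
- exact: proj_scale e0' g1.
- have d2 := intertwine_target uJ E1 uAB dJ d1; have d3 := intertwine_target uJ E2 uAB dJ d2.
  by move=> x [] ->; [exact: d1 | exact: d2 | exact: d3].
- move=> x /cubic_anglesP; move: (expq R x) => u hu.
  apply: (@eigen_col _ A _ (\col_i [:: u ^+ 2; u; 1]`_i)).
    by apply/eqP => /matrixP/(_ 2 0); rewrite !mxE /= => /eqP; rewrite oner_eq0.
  by rewrite AE; apply: mx3_col; rewrite -?hu; ring.
- move=> x /hb; move: (expq R x) => u hu.
  apply: (@eigen_col _ _ _ (\col_i [:: u ^+ 2; u; 1]`_i)).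
    by apply/eqP => /matrixP/(_ 2 0); rewrite !mxE /= => /eqP; rewrite oner_eq0.
  rewrite AE /refl1 -/e mx3M; apply: mx3_col; last by ring.
    by rewrite -exprS hu; field.
  by ring.
- by have [x [y h]] := rank1_row e t (- t^*); exact: rank_mulmx_sub1 h.
Qed.


(** The sum of the eigenvalues of B is t and their product is 1; the middle coefficient t^* is then
automatic, since the eigenvalues have modulus one. *)
Lemma class_cubic_sum (b0 b1 b2 : rat) : b0 + b1 + b2 = 0 ->
  window (cubic_angles ++ [:: b0; b1; b2]) && uniq (cubic_angles ++ [:: b0; b1; b2]) ->
  let t := expq R b0 + expq R b1 + expq R b2 in param_class p t t t.
Proof.
move=> b123 chk t; apply: (class_cubic_type (erefl : size [:: b0; b1; b2] = 3) chk).
have h : expq R b0 * expq R b1 * expq R b2 = 1 by rewrite -!expqD b123 expq0.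
have tC : t^* = (expq R b0)^-1 + (expq R b1)^-1 + (expq R b2)^-1.
  by rewrite /t !rmorphD /= !expqC !expqN.
have n0 := expq_neq0 R b0; have n1 := expq_neq0 R b1; have n2 := expq_neq0 R b2.
rewrite tC /t => x; rewrite !inE.
suff H u0 u1 u2 u : u0 * u1 * u2 = 1 -> u0 != 0 -> u1 != 0 -> u2 != 0 -> [\/ u = u0, u = u1 | u = u2] ->
    u ^+ 3 = (u0 + u1 + u2) * u ^+ 2 - (u0^-1 + u1^-1 + u2^-1) * u + 1 :> C.
  by case/or3P => /eqP ->; apply: H => //; [exact: Or31 | exact: Or32 | exact: Or33].
move=> {}h {}n0 {}n1 {}n2 hu.
by rewrite inv_sum // h divr1 -h; case: hu => ->; ring.
Qed.

(** The angle of 1 and those of the square roots of 1/e. *)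
Definition square_angles : seq rat := [:: 0; - (1 / p%:~R) / 2; (1 - 1 / p%:~R) / 2].

Lemma square_anglesP x : x \in square_angles -> expq R x = 1 \/ expq R x ^+ 2 = e^-1.
Proof.
rewrite /square_angles; move: (1 / p%:~R) e_expq => q eq.
have E y (n : int) : y *+ 2 = - q + n%:~R -> expq R y ^+ 2 = e^-1.
  move=> h; rewrite eq -expqN -[RHS]mulr1 -(expq_int n) -expqD -h !exprS expr0 mulr1.
  by rewrite !mulrS mulr0n addr0 !expqD.
rewrite !inE => /or3P[] /eqP ->; first (by left; exact: expq0); right.
- by apply: (E _ 0); field.
- by apply: (E _ 1); field.
Qed.

(** Q^2 is R3/e, and Q conjugates R1 to R2 and R3^-1 R2 R3 to R1. For every
eigenvalue u of Q or of R1 Q the vector (- u(1-u), 1-u, s) is an eigenvector; this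
includes u = 1, for which it is a multiple of e3. *)
Lemma class_quadratic_type r s (b : seq rat) : s != 0 -> s^* = s -> r + r^* = s ^+ 2 -> size b = 3 ->
  window (square_angles ++ b) && uniq (square_angles ++ b) ->
  (forall x, x \in b -> expq R x ^+ 3 = (1 - r) * expq R x ^+ 2 - (r^* - 1) * expq R x - 1) ->
  param_class p r s s.
Proof.
move=> s0 sC rs sb chk hb; have rC : r^* = s ^+ 2 - r by rewrite -rs addrC addKr.
have e0 := e_neq0 R p; rewrite -/e in e0.
have [Q QE] : exists M : 'M[C]_3, M = mx3 [:: [:: 0; - e^-1; 0]; [:: -1; 0; 0]; [:: 0; - s; 1]] by eexists.
have uQ : Q \in unitmx.
  apply: (@unit_right _ _ (mx3 [:: [:: 0; - 1; 0]; [:: - e; 0; 0]; [:: - (e * s); 0; 1]])).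
  rewrite QE -mx3_1 mx3M; apply: mx3_eq; by field.
have E1 : Q *m refl1 p r s = refl2 p r s *m Q.
  by rewrite QE /refl1 /refl2 -/e sC rC !mx3M; apply: mx3_eq; field.
have E3 : Q *m refl3 p s s = refl3 p s s *m Q.
  by rewrite QE /refl3 -/e sC !mx3M; apply: mx3_eq; field.
have E2 : Q *m (invmx (refl3 p s s) *m (refl2 p r s *m refl3 p s s)) = refl1 p r s *m Q.
  apply: conj_commute E3 _; first exact/(@reflections_unit _ p r s s)/Or33.
  by rewrite QE /refl1 /refl2 /refl3 -/e sC rC !mx3M; apply: mx3_eq; field.
have Q2 : Q ^+ 2 = e^-1 *: refl3 p s s.
  by rewrite -[Q ^+ 2]/(Q *m Q) QE /refl3 -/e !mx3M mx3Z sC; apply: mx3_eq; field.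
have uS := @reflections_unit _ p r s s.
have e0' : e^-1 != 0 by rewrite invr_eq0.
have uR1 : refl1 p r s \in unitmx by apply/uS/Or31.
have [uAB dQ d1] := gens2_quotient uQ uR1.
have g1 := proj_sub (gen_refl1 p r s s); have g2 := proj_sub (gen_refl2 p r s s).
have g3 := proj_sub (gen_refl3 p r s s).
apply: (class_angles uS uQ (isT : (0 < 2)%N) (w := 1%:M) (w' := refl1 p r s)
  _ _ _ _ _ _ dQ _ (erefl : size square_angles = 3) sb chk).
- have g4 := proj_mul uS (proj_inv uS g3) (proj_mul uS g2 g3).
  move=> x [] ->; [exact: intertwine_normal E2 g4 | exact: intertwine_normal E1 g1 |
    exact: intertwine_normal E3 g3].
- by rewrite Q2; exact: proj_scale.
- by rewrite mul1mx.
- by [].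
- exact: proj1.
- exact: g1.
- have d2 := intertwine_target uQ E1 uAB dQ d1.
  have d3 : projective (generated (gens2 Q (refl1 p r s *m Q))) (refl3 p s s).
    by apply: (proj_scaler e0'); rewrite -Q2; exact: proj_exp.
  by move=> x [] ->; [exact: d1 | exact: d2 | exact: d3].
- move=> x /square_anglesP; move: (expq R x) => u hu.
  apply: (@eigen_col _ Q _ (\col_i [:: - (u * (1 - u)); 1 - u; s]`_i)).
    by apply/eqP => /matrixP/(_ 2 0); rewrite !mxE /= => /eqP; rewrite (negbTE s0).
  rewrite QE; apply: mx3_col; case: hu => hu; rewrite ?hu -?hu; by ring.
- move=> x /hb; move: (expq R x) => u hu.
  apply: (@eigen_col _ _ _ (\col_i [:: - (u * (1 - u)); 1 - u; s]`_i)).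
    by apply/eqP => /matrixP/(_ 2 0); rewrite !mxE /= => /eqP; rewrite (negbTE s0).
  rewrite QE /refl1 -/e mx3M sC; apply: mx3_col; last by ring.
    move: hu; rewrite rC => hu; apply/eqP; rewrite -subr_eq0; apply/eqP.
    by rewrite -[RHS](subrr (u ^+ 3)) {1}hu; field.
  by ring.
- by have [x [y h]] := rank1_row e r (- s^*); exact: rank_mulmx_sub1 h.
Qed.

End Types.

(** * Values of roots of unity *)

Ltac ratr_field :=
  rewrite ?(rmorphN, fmorph_div, rmorph1, rmorphM, rmorphB, rmorphD) /= ?ratr_nat; field.

Lemma expi_expq (R : realType) (t : R) (x : rat) : t = 2 * pi * ratr x -> expi t = expq R x.
Proof. by move=> ->. Qed.

Ltac to_expq := first [apply: expi_expq | apply/esym/expi_expq]; ratr_field.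

Section Trigonometry.
Variable R : realType.
Local Notation C := (Cplx R).
Implicit Types x y : rat.
Local Notation ex := (expq R).

Lemma expqX x n : ex x ^+ n = ex (x *+ n).
Proof. by elim: n => [|n IH]; rewrite ?expr0 ?mulr0n ?expq0 // exprS IH mulrS expqD. Qed.

Lemma expq_half : ex (1 / 2) = -1.
Proof.
have -> : ex (1 / 2) = expi (pi : R) by to_expq.
by apply: cplx_eq; rewrite ?re_expi ?im_expi ?reN ?imN ?cospi ?sinpi ?re1 ?im1 ?oppr0.
Qed.

Lemma expq_opp x y : y - x = 1 / 2 -> ex y = - ex x.
Proof. by move=> h; rewrite -(subrK x y) h expqD expq_half mulN1r. Qed.

Lemma expq_period x y : y - x = 1 -> ex y = ex x.
Proof. by move=> h; rewrite -(subrK x y) addrC h expq_shift. Qed.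

Lemma expq_sum_opp x : ex x + ex (- x) = ofR (2 * cos (2 * pi * ratr x)).
Proof.
rewrite -expqC /expq conjcE; apply: cplx_eq.
  by rewrite re_ofR reD re_expi re_cplx; ring.
by rewrite im_ofR imD im_expi im_cplx subrr.
Qed.

Lemma expq_sixth : ex (1 / 3) + 1 = ex (1 / 6).
Proof.
have h : ex (1 / 6) + ex (- (1 / 6)) = 1.
  rewrite expq_sum_opp; have -> : 2 * pi * ratr (1 / 6) = pi / 3 :> R.
    by ratr_field.
  by rewrite cos_pi3 mulfV ?pnatr_eq0.
have e2 : ex (1 / 3) = ex (1 / 6) * ex (1 / 6) by rewrite -expqD; congr expq; field.
have e3 : ex (1 / 6) * ex (- (1 / 6)) = 1 by rewrite -expqD subrr expq0.
by rewrite e2 -[X in _ + X]e3 -mulrDr h mulr1.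
Qed.

(** Two unit vectors at an angle of 60 degrees to their bisector add up to it. *)
Lemma expq_triple x y z : y = x - 1 / 3 -> z = x - 1 / 6 -> ex x + ex y = ex z.
Proof.
move=> hy hz; have -> : x = y + 1 / 3 by rewrite hy subrK.
have -> : z = y + 1 / 6 by rewrite hz hy; field.
by rewrite !expqD -expq_sixth mulrDr mulr1.
Qed.

Lemma root_sum n (u : C) : u ^+ n.+1 = 1 -> u != 1 -> \sum_(i < n.+1) u ^+ i = 0.
Proof.
move=> h u1; have := subrX1 u n.+1; rewrite h subrr => /esym/eqP.
by rewrite mulf_eq0 subr_eq0 (negbTE u1) => /eqP.
Qed.

Definition sq (n : nat) : C := ofR (Num.sqrt n%:R).

Lemma sqK n : sq n ^+ 2 = n%:R.
Proof. by rewrite /sq expr2 -ofRM -expr2 sqr_sqrtr ?ler0n // ofR_nat. Qed.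

Lemma sqC n : (sq n)^* = sq n.
Proof. by rewrite conjcE /sq; apply: cplx_eq; rewrite ?re_cplx ?im_cplx ?re_ofR ?im_ofR ?oppr0. Qed.

Lemma fifth_sum : 1 + ex (1 / 5) + ex (2 / 5) + ex (- (2 / 5)) + ex (- (1 / 5)) = 0.
Proof.
have h5 : ex (1 / 5) ^+ 5 = 1 by rewrite expqX (_ : (1 / 5) *+ 5 = 1) ?expq1 //; field.
have n1 : ex (1 / 5) != 1 by exact: expq_neq1.
have := root_sum h5 n1; rewrite !big_ord_recl big_ord0 /= addr0 => <-.
have -> : ex (2 / 5) = ex (1 / 5) ^+ 2 by rewrite expqX; congr expq; field.
have -> : ex (- (2 / 5)) = ex (1 / 5) ^+ 3 by rewrite expqX; apply/esym/expq_period; field.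
have -> : ex (- (1 / 5)) = ex (1 / 5) ^+ 4 by rewrite expqX; apply/esym/expq_period; field.
by rewrite expr0 !addrA.
Qed.

(** The value is (sqrt 5 - 1)/2, the positive root of x^2 + x - 1; this equation
expresses the vanishing of the sum of the fifth roots of unity. *)
Lemma golden : ex (1 / 5) + ex (- (1 / 5)) = (sq 5 - 1) / 2.
Proof.
have E : ex (2 / 5) + ex (- (2 / 5)) = (ex (1 / 5) + ex (- (1 / 5))) ^+ 2 - 2.
  have h1 : ex (1 / 5) * ex (- (1 / 5)) = 1 by rewrite -expqD subrr expq0.
  have -> : ex (2 / 5) = ex (1 / 5) ^+ 2 by rewrite expqX; congr expq; field.
  have -> : ex (- (2 / 5)) = ex (- (1 / 5)) ^+ 2 by rewrite expqX; congr expq; field.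
  have -> : 2 = 2 * (ex (1 / 5) * ex (- (1 / 5))) :> C by rewrite h1 mulr1.
  by ring.
have := expq_sum_opp (1 / 5); set c := 2 * cos _ => K.
have h : 1 + ofR c + (ofR c ^+ 2 - 2) = 0 by rewrite -K -E -[RHS]fifth_sum; ring.
have c0 : 0 < c.
  rewrite /c mulr_gt0 // cos_gt0_pihalf //.
  have p0 := pi_gt0 R.
  have -> : 2 * pi * ratr (1 / 5) = 2 / 5 * pi :> R by ratr_field.
  by apply/andP; split; lra.
rewrite K; clearbody c.
have hc : (2 * c + 1) ^+ 2 = 5.
  apply: ofR_inj; rewrite expr2 !(ofRM, ofRD, ofR1, ofR_nat).
  have {}h : ofR c ^+ 2 = 1 - ofR c by apply/eqP; rewrite -subr_eq0 -[X in _ == X]h; apply/eqP; ring.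
  by ring: h.
have -> : c = (Num.sqrt 5 - 1) / 2.
  by rewrite -hc sqrtr_sqr ger0_norm; [field | lra].
by rewrite /sq ofRM ofRB ofRV ofR1 ofR_nat.
Qed.

(** The sign of the imaginary part selects the square root of a negative number. *)
Lemma sqrt_neg (v : C) (x : R) : 0 <= x -> 0 < im v -> v ^+ 2 = - ofR x -> v = 0 +i* Num.sqrt x.
Proof.
move=> x0 v0 h; have : v ^+ 2 == (0 +i* Num.sqrt x) ^+ 2.
  rewrite h; apply/eqP/cplx_eq; rewrite ?reN ?imN expr2 ?reM ?imM re_cplx im_cplx ?re_ofR ?im_ofR.
    by rewrite mulr0 sub0r -expr2 sqr_sqrtr.
  by rewrite mul0r mulr0 addr0 oppr0.
rewrite eqf_sqr => /orP[] /eqP // E; move: v0; rewrite E imN im_cplx oppr_gt0.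
by rewrite ltNge sqrtr_ge0.
Qed.

Lemma eighth_sum : ex (1 / 8) + ex (3 / 8) = 0 +i* Num.sqrt 2.
Proof.
apply: sqrt_neg; rewrite ?ler0n //.
  have p0 := pi_gt0 R.
  rewrite imD !im_expi (_ : 2 * pi * ratr (1 / 8) = pi / 4); last by ratr_field.
  rewrite (_ : 2 * pi * ratr (3 / 8) = 3 / 4 * pi); last by ratr_field.
  by apply: addr_gt0; apply: sin_gt0_pi; apply/andP; split; lra.
rewrite sqrrD !expqX -expqD.
rewrite (_ : (1 / 8) *+ 2 = 1 / 4); last by field.
rewrite (_ : 1 / 8 + 3 / 8 = 1 / 2); last by field.
rewrite (_ : (3 / 8) *+ 2 = 3 / 4); last by field.
rewrite (@expq_opp (1 / 4) (3 / 4)); last by field.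
by rewrite expq_half ofR_nat; ring.
Qed.

(** A quadratic Gauss sum: its square follows from the vanishing of the sum of the
seventh roots of unity, and the imaginary part is positive because
sin(2 pi/7) > sin(pi/7). *)
Lemma seventh_sum : ex (1 / 7) + ex (2 / 7) + ex (4 / 7) = (-1 +i* Num.sqrt 7) / 2.
Proof.
have h7 : ex (1 / 7) ^+ 7 = 1 by rewrite expqX (_ : (1 / 7) *+ 7 = 1) ?expq1 //; field.
have n1 : ex (1 / 7) != 1 by exact: expq_neq1.
have := root_sum h7 n1; rewrite !big_ord_recl big_ord0 /= addr0 => h6.
suff E : 2 * (ex (1 / 7) + ex (2 / 7) + ex (4 / 7)) + 1 = 0 +i* Num.sqrt 7.
  have -> : -1 +i* Num.sqrt 7 = 0 +i* Num.sqrt 7 - 1 :> C.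
    by apply: cplx_eq; rewrite ?reB ?imB !(re_cplx, im_cplx, re1, im1) ?sub0r ?subr0.
  by rewrite -E; field.
have -> : ex (2 / 7) = ex (1 / 7) ^+ 2 by rewrite expqX; congr expq; field.
have e4 : ex (4 / 7) = ex (1 / 7) ^+ 4 by rewrite expqX; congr expq; field.
apply: sqrt_neg; rewrite ?ler0n //; last first.
  rewrite e4 ofR_nat; move: h6; move: (ex (1 / 7)) => z; rewrite /bump /= => h6.
  have {}h6 : z ^+ 6 = - (1 + z + z ^+ 2 + z ^+ 3 + z ^+ 4 + z ^+ 5).
    by apply/eqP; rewrite -subr_eq0 opprK -[X in _ == X]h6; apply/eqP; ring.
  by ring: h6.
rewrite imD im1 addr0 (_ : im (2 * _) = 2 * im (ex (1 / 7) + ex (1 / 7) ^+ 2 + ex (4 / 7))); last first.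
  by rewrite -ofR_nat imM re_ofR im_ofR mul0r addr0.
have -> : ex (4 / 7) = - ex (1 / 14) by apply: expq_opp; field.
have -> : ex (1 / 7) ^+ 2 = ex (2 / 7) by rewrite expqX; congr expq; field.
have p0 := pi_gt0 R.
rewrite imB imD !im_expi (_ : 2 * pi * ratr (1 / 7) = (pi / 7) *+ 2); last by ratr_field.
rewrite (_ : 2 * pi * ratr (2 / 7) = 4 / 7 * pi); last by ratr_field.
rewrite (_ : 2 * pi * ratr (1 / 14) = pi / 7); last by ratr_field.
have h1 : 0 < sin (4 / 7 * pi : R) by apply: sin_gt0_pi; apply/andP; split; lra.
have h2 : 0 < sin (pi / 7 : R) by apply: sin_gt0_pi; apply/andP; split; lra.
have h3 : 2^-1 < cos (pi / 7 : R) by apply: cos_gt_half; apply/andP; split; lra.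
rewrite sin_mulr2n; nra.
Qed.

End Trigonometry.

(** * Angles of the quadratic type, and the triple (3,4,4;4) *)

Section QuadraticType.
Variable R : realType.
Local Notation C := (Cplx R).
Local Notation ex := (expq R).
Variable p : int.

(** The sum of the eigenvalues of B is 1 - r and their product -1; the remaining coefficient is
again automatic. *)
Lemma class_quadratic_sum r s (b0 b1 b2 : rat) : s != 0 -> s^* = s -> r + r^* = s ^+ 2 ->
  b0 + b1 + b2 = - (1 / 2) ->
  window (square_angles p ++ [:: b0; b1; b2]) && uniq (square_angles p ++ [:: b0; b1; b2]) ->
  ex b0 + ex b1 + ex b2 = 1 - r -> param_class p r s s.
Proof.
move=> s0 sC rs b123 chk hr; apply: (class_quadratic_type s0 sC rs (erefl : size [:: b0; b1; b2] = 3) chk).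
have h : ex b0 * ex b1 * ex b2 = -1.
  by rewrite -!expqD b123 -(expq_half R); apply/esym/expq_period; field.
have hC : r^* - 1 = - ((ex b0)^-1 + (ex b1)^-1 + (ex b2)^-1).
  have -> : r = 1 - (ex b0 + ex b1 + ex b2) by rewrite hr subKr.
  by rewrite !(rmorphD, rmorphN, rmorph1) /= !expqC !expqN; ring.
have n0 := expq_neq0 R b0; have n1 := expq_neq0 R b1; have n2 := expq_neq0 R b2.
rewrite hC -hr => x; rewrite !inE.
suff H u0 u1 u2 u : u0 * u1 * u2 = -1 -> u0 != 0 -> u1 != 0 -> u2 != 0 -> [\/ u = u0, u = u1 | u = u2] ->
    u ^+ 3 = (u0 + u1 + u2) * u ^+ 2 - - (u0^-1 + u1^-1 + u2^-1) * u - 1 :> C.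
  by case/or3P => /eqP ->; apply: (H _ _ _ _ h n0 n1 n2); [exact: Or31 | exact: Or32 | exact: Or33].
move=> {}h {}n0 {}n1 {}n2 hu.
by rewrite inv_sum // h invrN1 mulrN1 opprK -h; case: hu => ->; ring.
Qed.

End QuadraticType.

Section Sporadic.
Variable R : realType.
Local Notation C := (Cplx R).
Local Notation ex := (expq R).

(** In terms of z = exp(pi i/6), T acts on e1 by z and on the span of e2 and e3 like R2 R3. So it
commutes with R1, conjugates R2 to R3, and T^3 = z^3. The relation A^4 = z^3 T for
A = R1 T recovers T from A. *)
Lemma class_3444 : param_class 4 (sq R 2) (ex (1 / 6)) (sq R 2).
Proof.
pose a : seq rat := [:: 1 / 12; 1 / 3; 5 / 12]; pose b : seq rat := [:: - (1 / 6); - (1 / 8); 3 / 8].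
have [q qE] : exists q, q = sq R 2 by exists (sq R 2).
have [z zE] : exists z, z = ex (1 / 12) by exists (ex (1 / 12)).
have hq : q ^+ 2 = 2 by rewrite qE sqK.
have qC : q^* = q by rewrite qE sqC.
have z2 : ex (1 / 6) = z ^+ 2 by rewrite zE expqX; congr expq; field.
have z3 : expi (2 * pi / 4%:~R) = z ^+ 3 :> C by rewrite e_expq zE expqX; congr expq; field.
have z4' : ex (1 / 3) = z ^+ 4 by rewrite zE expqX; congr expq; field.
have hz : z ^+ 4 = z ^+ 2 - 1 by rewrite -z4' -z2 -expq_sixth addrK.
have zC : (ex (1 / 6))^* = 1 - z ^+ 2.
  rewrite expqC -opprB -hz -z4' (@expq_opp R (- (1 / 6)) (1 / 3)) ?opprK //; field.
have q0 : q != 0 by apply/eqP => h; move: hq; rewrite h expr0n /= => /eqP; rewrite eq_sym pnatr_eq0.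
have zn0 : z != 0 by rewrite zE expq_neq0.
have [R1 R1E] : exists M : 'M[C]_3, M = mx3 [:: [:: z ^+ 3; q; - q]; [:: 0; 1; 0]; [:: 0; 0; 1]] by eexists.
have [R2 R2E] : exists M : 'M[C]_3, M = mx3 [:: [:: 1; 0; 0]; [:: - (z ^+ 3 * q); z ^+ 3; z ^+ 2]; [:: 0; 0; 1]] by eexists.
have [R3 R3E] : exists M : 'M[C]_3, M = mx3 [:: [:: 1; 0; 0]; [:: 0; 1; 0]; [:: z ^+ 3 * q; - z; z ^+ 3]] by eexists.
have r1 : refl1 4 (sq R 2) (sq R 2) = R1 by rewrite /refl1 z3 -qE qC R1E.
have r2 : refl2 4 (sq R 2) (ex (1 / 6)) = R2 by rewrite /refl2 z3 -qE qC z2 R2E.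
have r3 : refl3 4 (ex (1 / 6)) (sq R 2) = R3.
  by rewrite /refl3 z3 -qE zC R3E; apply: mx3_eq => //; ring: hz.
have [T TE] : exists M : 'M[C]_3, M = mx3 [:: [:: z; 0; 0]; [:: 0; 0; z ^+ 3 - z]; [:: 0; - z; z ^+ 3]].
  by eexists.
have E1 : T *m R1 = R1 *m T by rewrite TE R1E !mx3M; apply: mx3_eq; ring: hz hq.
have E2 : T *m R2 = R3 *m T by rewrite TE R2E R3E !mx3M; apply: mx3_eq; ring: hz hq.
have E3 : T *m (R2 *m R3) = R2 *m T *m R2 by rewrite TE R2E R3E !mx3M; apply: mx3_eq; ring: hz hq.
have T3 : T ^+ 3 = z ^+ 3 *: 1%:M.
  by rewrite -[T ^+ 3]/(T *m (T *m T)) TE !mx3M -mx3_1 mx3Z; apply: mx3_eq; ring: hz hq.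
have R14 : R1 ^+ 4 = 1%:M.
  by rewrite -[R1 ^+ 4]/(R1 *m (R1 *m (R1 *m R1))) R1E !mx3M -mx3_1; apply: mx3_eq; ring: hz hq.
have z30 : z ^+ 3 != 0 by rewrite expf_neq0.
have uT : T \in unitmx.
  apply: (@unit_right _ _ ((z ^+ 3)^-1 *: (T *m T))).
  by rewrite -scalemxAr -[T *m (T *m T)]/(T * (T * T)) -[T * (T * T)]/(T ^+ 3) T3 scalerA mulVf // scale1r.
have uS := @reflections_unit _ 4 (sq R 2) (ex (1 / 6)) (sq R 2).
have g1 := proj_sub (gen_refl1 4 (sq R 2) (ex (1 / 6)) (sq R 2)).
have g2 := proj_sub (gen_refl2 4 (sq R 2) (ex (1 / 6)) (sq R 2)).
have g3 := proj_sub (gen_refl3 4 (sq R 2) (ex (1 / 6)) (sq R 2)).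
have u1 := proj_unit uS g1; have u2 := proj_unit uS g2.
rewrite r1 in g1 u1; rewrite r2 in g2 u2; rewrite r3 in g3.
have [A AE] : exists M : 'M[C]_3, M = R1 *m T by eexists.
have uA : A \in unitmx by rewrite AE unitmx_mul u1.
have [uAB dA d2] := gens2_quotient uA u2.
have A4 : A ^+ 4 = z ^+ 3 *: T.
  rewrite AE -[R1 *m T]/(R1 * T) exprMn_comm; last by rewrite /GRing.comm -!mulmxE E1.
  by rewrite R14 mul1r exprS T3 -mulmxE -scalemxAr mulmx1.
have dT : projective (generated (gens2 A (R2 *m A))) T.
  by apply: (proj_scaler z30); rewrite -A4; exact: proj_exp.
have d1 : projective (generated (gens2 A (R2 *m A))) R1.
  have h := proj_mul uAB dA (proj_inv uAB dT).
  by have E : A *m invmx T = R1 by [rewrite AE mulmxK]; rewrite E in h.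
have d3 := intertwine_target uT E2 uAB dT d2.
apply: (class_angles uS uT (isT : (0 < 3)%N) (A := A) (B := R2 *m A) (w := R1) (w' := R2 *m R1)
  _ _ _ _ _ _ dT _ (erefl : size a = 3) (erefl : size b = 3)).
- have g4 := proj_mul uS (proj_mul uS g2 g3) (proj_inv uS g2).
  have E3' : T *m (R2 *m R3 *m invmx R2) = R2 *m T by rewrite mulmxA E3 mulmxK.
  move=> x [] ->; rewrite ?r1 ?r2 ?r3.
  + exact: intertwine_normal E1 g1.
  + exact: intertwine_normal E3' g4.
  + exact: intertwine_normal E2 g2.
- by rewrite T3; apply: proj_scale => //; exact: proj1.
- exact: AE.
- by rewrite AE mulmxA.
- exact: g1.
- by have h := proj_mul uS g2 g1; exact: h.
- by move=> x [] ->; rewrite ?r1 ?r2 ?r3.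
- by vm_compute.
- move=> x; rewrite !inE => hx.
  have [->|x3] := eqVneq x (1 / 3).
    apply: (@eigen_col _ A _ (\col_i [:: 1; 0; 0]`_i)).
      by apply/eqP => /matrixP/(_ 0 0); rewrite !mxE /= => /eqP; rewrite oner_eq0.
    by rewrite AE R1E TE mx3M z4'; apply: mx3_col; ring: hz.
  have un : ex x - z ^+ 4 != 0.
    rewrite -z4' subr_eq0; apply: contra_neq x3; apply: (expq_inj (s := a)) => //.
    by rewrite !inE.
  have hu : ex x ^+ 2 = z ^+ 3 * ex x + 1.
    case/or3P: hx => /eqP xE.
    - by rewrite xE -zE; ring: hz.
    - by rewrite xE eqxx in x3.
    rewrite xE; have -> : ex (5 / 12) = z ^+ 5 by rewrite zE expqX; congr expq; field.
    by ring: hz.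
  move: (ex x) un hu => u un hu.
  apply: (@eigen_col _ A _ (\col_i [:: q * u * (1 + z * u); u - z ^+ 4; - z * u * (u - z ^+ 4)]`_i)).
    by apply/eqP => /matrixP/(_ 1 0); rewrite !mxE /= => /eqP; rewrite (negbTE un).
  by rewrite AE R1E TE mx3M; apply: mx3_col; ring: hz hq hu.
- move=> x hx.
  have un : ex x - z ^+ 4 != 0.
    rewrite -z4' subr_eq0; apply/eqP => /(expq_inj (s := a ++ b) isT) h.
    have xab : x \in a ++ b by rewrite mem_cat hx orbT.
    have tab : 1 / 3 \in a ++ b by [].
    have nb : 1 / 3 \notin b by [].
    by move: nb; rewrite -(h xab tab) hx.
  move: hx; rewrite !inE => hx.
  have z3' : z ^+ 3 = ex (1 / 4) by rewrite zE expqX; congr expq; field.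
  have hu : (ex x - (1 - z ^+ 2)) * (ex x ^+ 2 + z ^+ 3) = 0.
    case/or3P: hx => /eqP ->.
    - by rewrite -zC expqC subrr mul0r.
    - rewrite z3' (@expq_opp R (- (1 / 8) *+ 2) (1 / 4)); last by field.
      by rewrite expqX subrr mulr0.
    - rewrite z3' expqX (@expq_opp R (1 / 4) (3 / 8 *+ 2)); last by field.
      by rewrite addNr mulr0.
  move: (ex x) un hu => u un hu.
  have {}hu : u ^+ 3 = (1 - z ^+ 2) * u ^+ 2 - z ^+ 3 * u + z.
    by apply/eqP; rewrite -subr_eq0 -[X in _ == X]hu; apply/eqP; ring: hz.
  apply: (@eigen_col _ _ _ (\col_i [:: q * z * (z ^+ 3 - u - z); (z ^+ 3 - u) * (u - z ^+ 4); z * (u - z ^+ 4)]`_i)).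
    by apply/eqP => /matrixP/(_ 2 0); rewrite !mxE /= => /eqP; rewrite mulf_eq0 (negbTE un) (negbTE zn0).
  rewrite AE R2E R1E TE !mx3M; apply: mx3_col.
  + ring: hz hq.
  + ring: hz hq hu.
  + ring: hz hq.
- have h : R2 - 1%:M = (\col_i (i == 1)%:R) *m (\row_i [:: - (z ^+ 3 * q); z ^+ 3 - 1; z ^+ 2]`_i).
    apply/matrixP => i j; rewrite R2E -mx3_1 mx3B [RHS]mxE big_ord1 !mxE.
    by move: i; apply: ord3P; move: j; apply: ord3P; rewrite /= ?mul1r ?mul0r ?subr0 ?subrr.
  exact: rank_mulmx_sub1 h.
Qed.

End Sporadic.

(** * Parameters in radicals *)

Section Values.
Variable R : realType.
Local Notation C := (Cplx R).
Local Notation ex := (expq R).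

Definition isq (n : nat) : C := 0 +i* Num.sqrt n%:R.

Lemma isqK n : isq n ^+ 2 = - n%:R.
Proof.
rewrite -ofR_nat; apply: cplx_eq; rewrite expr2 ?reM ?imM ?reN ?imN re_cplx im_cplx ?re_ofR ?im_ofR.
  by rewrite mul0r sub0r -expr2 sqr_sqrtr ?ler0n.
by rewrite mul0r mulr0 addr0 oppr0.
Qed.

Lemma isqC n : (isq n)^* = - isq n.
Proof. by rewrite conjcE; apply: cplx_eq; rewrite ?reN ?imN !(re_cplx, im_cplx) ?oppr0. Qed.

Lemma cplx_split (x y : R) : x +i* y = ofR x + (0 +i* y).
Proof. by apply: cplx_eq; rewrite ?reD ?imD !(re_cplx, im_cplx, re_ofR, im_ofR) ?addr0 ?add0r. Qed.

Lemma ofR_conj (x : R) : (ofR x)^* = ofR x.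
Proof. by rewrite conjcE; apply: cplx_eq; rewrite ?re_cplx ?im_cplx ?re_ofR ?im_ofR ?oppr0. Qed.

Lemma cplxN (y : R) : 0 +i* - y = - (0 +i* y).
Proof. by apply: cplx_eq; rewrite ?reN ?imN !(re_cplx, im_cplx) ?oppr0. Qed.

Lemma expq_sixthE : ex (1 / 6) = (1 + isq 3) / 2.
Proof.
have -> : ex (1 / 6) = expi (pi / 3) by to_expq.
have h2 : (2 : C) != 0 by rewrite pnatr_eq0.
apply: (mulIf h2); rewrite divfK // -[2]ofR_nat; apply: cplx_eq.
  by rewrite reD reM re1 re_expi im_expi re_ofR im_ofR re_cplx cos_pi3; field.
by rewrite imD imM im1 re_expi im_expi re_ofR im_ofR im_cplx sin_pi3; field.
Qed.

Lemma expq_thirdE : ex (1 / 3) = (isq 3 - 1) / 2.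
Proof. by rewrite -[LHS](addrK 1) expq_sixth expq_sixthE; field. Qed.

Lemma expq_quarter : ex (1 / 4) = 0 +i* 1.
Proof.
have -> : ex (1 / 4) = expi (pi / 2) by to_expq.
by apply: cplx_eq; rewrite ?re_expi ?im_expi ?re_cplx ?im_cplx ?cos_pihalf ?sin_pihalf.
Qed.

Lemma two_cos (n : nat) : (0 < n)%N ->
  ofR (2 * cos (pi / n%:R)) = ex (1 / (2 * n%:R)) + ex (- (1 / (2 * n%:R))).
Proof.
move=> n0; rewrite expq_sum_opp; congr (ofR (2 * cos _)).
have hn : (n%:R : R) != 0 by rewrite pnatr_eq0 -lt0n.
have hn' : (n%:R : rat) != 0 by rewrite pnatr_eq0 -lt0n.
by rewrite fmorph_div rmorph1 rmorphM /= !ratr_nat; field.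
Qed.

Lemma two_cos3 : ofR (2 * cos (pi / 3)) = 1 :> C.
Proof. by rewrite cos_pi3 mulfV ?pnatr_eq0. Qed.

Lemma two_cos4 : ofR (2 * cos (pi / 4)) ^+ 2 = 2 :> C.
Proof.
rewrite (@two_cos 4) // sqrrD !expqX -expqD.
rewrite (_ : 1 / (2 * 4%:R) *+ 2 = 1 / 4); last by field.
rewrite (_ : (- (1 / (2 * 4%:R))) *+ 2 = - (1 / 4)); last by field.
rewrite (_ : 1 / (2 * 4%:R) - 1 / (2 * 4%:R) = 0) ?subrr // expq0.
by rewrite (@expq_opp R (- (1 / 4)) (1 / 4)); [ring | field].
Qed.

Lemma golden_tenth : ex (1 / 10) + ex (- (1 / 10)) = (1 + sq R 5) / 2.
Proof.
have h := fifth_sum R; have g := golden R.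
rewrite (@expq_opp R (- (2 / 5)) (1 / 10)); last by field.
rewrite -[ex (- (1 / 10))]opprK -(@expq_opp R (- (1 / 10)) (2 / 5)); last by field.
have -> : ex (- (2 / 5)) = - (1 + ex (1 / 5) + ex (2 / 5) + ex (- (1 / 5))).
  by apply/eqP; rewrite -subr_eq0 opprK -[X in _ == X]h; apply/eqP; ring.
have -> : (1 + sq R 5) / 2 = 1 + (sq R 5 - 1) / 2 by field.
by rewrite -g; ring.
Qed.

Lemma two_cos5 : ofR (2 * cos (pi / 5)) = (1 + sq R 5) / 2.
Proof.
by rewrite (@two_cos 5) // -golden_tenth; congr (ex _ + ex _); field.
Qed.

End Values.

(** * The family (n,n,n;m) *)

Section Families.
Variable R : realType.
Local Notation C := (Cplx R).
Local Notation ex := (expq R).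
Implicit Types (p : int) (r s t : C).

(** Here t itself is an eigenvalue of B, and the two others are opposite. *)
Lemma class_333m (m : nat) p (b := [:: 1 / 2 - 1 / (3 * m%:R); 1 / (6 * m%:R); 1 / (6 * m%:R) - 1 / 2]) :
  (0 < m)%N -> window (cubic_angles p ++ b) && uniq (cubic_angles p ++ b) ->
  let t := - expi (- (2 * pi) / (3 * m%:R)) : C in param_class p t t t.
Proof.
move=> m0 chk t.
have hm : (m%:R : rat) != 0 by rewrite pnatr_eq0 -lt0n.
have hm' : (m%:R : R) != 0 by rewrite pnatr_eq0 -lt0n.
have E : t = ex (1 / 2 - 1 / (3 * m%:R)) + ex (1 / (6 * m%:R)) + ex (1 / (6 * m%:R) - 1 / 2).
  rewrite (@expq_opp R (1 / (6 * m%:R) - 1 / 2) (1 / (6 * m%:R))); last by field.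
  rewrite subrK (@expq_opp R (- (1 / (3 * m%:R)))); last by field.
  congr (- _); rewrite /expq; congr expi.
  by rewrite rmorphN fmorph_div rmorph1 rmorphM /= !ratr_nat; field.
rewrite E; apply: class_cubic_sum chk; by field.
Qed.

Lemma class_family_nnnm p t : family_nnnm p t -> param_class p t t t.
Proof.
case=> {p t}.
- move=> m p; rewrite !inE.
  by repeat (case/orP); move=> /eqP[-> ->]; apply: class_333m; vm_compute.
- move=> p hp.
  have -> : (-1 +i* - Num.sqrt 7) / 2 = ex (- (1 / 7)) + ex (- (2 / 7)) + ex (3 / 7).
    rewrite (@expq_period R (- (4 / 7)) (3 / 7)); last by field.
    rewrite -!expqC -!rmorphD /= seventh_sum rmorphM fmorphV /= -[2]ofR_nat ofR_conj conjcE.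
    by rewrite re_cplx im_cplx.
  apply: class_cubic_sum; first by field.
  by move: p hp; apply/allP; vm_compute.
- move=> p hp.
  have -> : expi (pi / 3) + expi (- pi / 6) = ex (- (1 / 4)) + ex (1 / 12) + ex (1 / 6).
    rewrite addrC [ex (- _) + _]addrC (@expq_triple R (1 / 12) (- (1 / 4)) (- (1 / 12))); [|by field..].
    by congr (_ + _); to_expq.
  apply: class_cubic_sum; first by field.
  by move: p hp; apply/allP; vm_compute.
- move=> p hp.
  have -> : expi (- pi / 9) * (Num.sqrt 5 +i* Num.sqrt 3) / 2 =
      ex (- (23 / 90)) + ex (1 / 9) + ex (13 / 90).
    have -> : expi (- pi / 9) = ex (- (1 / 18)) by to_expq.
    have -> : ex (- (23 / 90)) = ex (- (1 / 18)) * ex (- (1 / 5)) by rewrite -expqD; congr expq; field.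
    have -> : ex (1 / 9) = ex (- (1 / 18)) * ex (1 / 6) by rewrite -expqD; congr expq; field.
    have -> : ex (13 / 90) = ex (- (1 / 18)) * ex (1 / 5) by rewrite -expqD; congr expq; field.
    have -> : Num.sqrt 5 +i* Num.sqrt 3 = sq R 5 + isq R 3 by exact: cplx_split.
    rewrite -!mulrDr -mulrA; congr (_ * _); rewrite addrAC [ex (- _) + _]addrC golden expq_sixthE.
    by field.
  apply: class_cubic_sum; first by field.
  by move: p hp; apply/allP; vm_compute.
- move=> p ->.
  have -> : expi (4 * pi / 15) + expi (- (2 * pi) / 15) = ex (- (7 / 30)) + ex (1 / 10) + ex (2 / 15).
    rewrite addrC [ex (- _) + _]addrC (@expq_triple R (1 / 10) (- (7 / 30)) (- (1 / 15))); [|by field..].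
    by congr (_ + _); to_expq.
  by apply: class_cubic_sum; [field | vm_compute].
- move=> p hp.
  have -> : -1 +i* Num.sqrt 2 = ex (- (1 / 2)) + ex (1 / 8) + ex (3 / 8).
    rewrite -addrA eighth_sum -(@expq_period R (- (1 / 2)) (1 / 2)) ?expq_half; last by field.
    by rewrite cplx_split ofRN ofR1.
  apply: class_cubic_sum; first by field.
  by move: p hp; apply/allP; vm_compute.
Qed.

End Families.

(** * The family (n,n,m;m) *)

Section Families2.
Variable R : realType.
Local Notation C := (Cplx R).
Local Notation ex := (expq R).
Implicit Types (p : int) (r s t : C).

Lemma expq_opp' (x y : rat) : x - y = 1 / 2 -> ex y = - ex x.
Proof. by move=> /(@expq_opp R) ->; rewrite opprK. Qed.

Lemma conj_half (x y : C) : ((x + y) / 2)^* = (x^* + y^*) / 2.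
Proof. by rewrite rmorphM rmorphD fmorphV /= -[2]ofR_nat ofR_conj. Qed.

Lemma sq_neq0 (s : C) n : s ^+ 2 = n.+1%:R -> s != 0.
Proof. by move=> h; apply/eqP => s0; move/eqP: h; rewrite s0 expr0n /= eq_sym pnatr_eq0. Qed.

(** The quadratic type with s = 2 cos(pi/3) = 1. *)
Lemma class_quadratic_3 p r b0 b1 b2 : r + r^* = 1 -> b0 + b1 + b2 = - (1 / 2) ->
  window (square_angles p ++ [:: b0; b1; b2]) && uniq (square_angles p ++ [:: b0; b1; b2]) ->
  ex b0 + ex b1 + ex b2 = 1 - r -> param_class p r 1 1.
Proof.
by move=> hr; apply: class_quadratic_sum; rewrite ?oner_neq0 ?rmorph1 ?expr1n.
Qed.

Definition tau7 : C := (1 +i* Num.sqrt 7) / 2.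

Lemma class_334_7 p : p \in [:: 4; 5; 6; 8; 12] -> param_class p tau7 1 1.
Proof.
move=> hp; have tE : tau7 = (1 + isq R 7) / 2 by rewrite /tau7 cplx_split.
apply: (@class_quadratic_3 _ _ (- (3 / 14)) (- (5 / 14)) (1 / 14)); last 1 first.
- rewrite (@expq_opp' (2 / 7) (- (3 / 14))); last by field.
  rewrite (@expq_opp' (1 / 7) (- (5 / 14))); last by field.
  rewrite (@expq_opp' (4 / 7) (1 / 14)); last by field.
  rewrite -!opprD [ex (2 / 7) + _]addrC seventh_sum cplx_split ofRN ofR1 -/(isq R 7) tE; by field.
- by rewrite tE conj_half rmorph1 isqC; field.
- by field.
- by move: p hp; apply/allP; vm_compute.
Qed.

Definition gold : C := (1 + sq R 5) / 2.

Lemma sq5_gt0 : 0 < Num.sqrt 5 :> R. Proof. by rewrite sqrtr_gt0 ltr0n. Qed.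

Lemma gold_neq0 : gold != 0.
Proof.
have h : gold = ofR ((1 + Num.sqrt 5) / 2) by rewrite /gold /sq ofRM ofRD ofRV ofR1 ofR_nat.
rewrite h -ofR0 (inj_eq (@ofR_inj R)); apply: lt0r_neq0.
by rewrite divr_gt0 // addr_gt0 ?ltr01 ?sq5_gt0.
Qed.

Lemma gold_conj : gold^* = gold. Proof. by rewrite /gold conj_half rmorph1 sqC. Qed.

(** The quadratic type with s = 2 cos(pi/5). *)
Lemma class_quadratic_5 p r b0 b1 b2 : r + r^* = (3 + sq R 5) / 2 -> b0 + b1 + b2 = - (1 / 2) ->
  window (square_angles p ++ [:: b0; b1; b2]) && uniq (square_angles p ++ [:: b0; b1; b2]) ->
  ex b0 + ex b1 + ex b2 = 1 - r -> param_class p r gold gold.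
Proof.
move=> hr; apply: class_quadratic_sum; rewrite ?gold_neq0 ?gold_conj // hr /gold.
have h := sqK R 5; by field: h.
Qed.

Lemma class_554 p : p \in [:: 4; 5] ->
  param_class p (expi (pi / 3) * (Num.sqrt 5 +i* - Num.sqrt 3) / 2) gold gold.
Proof.
move=> hp; have -> : expi (pi / 3) = ex (1 / 6) by to_expq.
rewrite expq_sixthE cplx_split cplxN -/(sq R 5) -/(isq R 3).
have h3 := isqK R 3; have h5 := sqK R 5.
apply: (@class_quadratic_5 _ _ (- (13 / 30)) (- (7 / 30)) (1 / 6)).
- by rewrite !(rmorphM, rmorphD, rmorphN, rmorph1, fmorphV, rmorph_nat) /= isqC sqC; field: h3 h5.
- by field.
- by move: p hp; apply/allP; vm_compute.
have -> : ex (- (13 / 30)) = ex (- (1 / 3)) * ex (- (1 / 10)) by rewrite -expqD; congr expq; field.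
have -> : ex (- (7 / 30)) = ex (- (1 / 3)) * ex (1 / 10) by rewrite -expqD; congr expq; field.
rewrite -mulrDr [ex (- (1 / 10)) + _]addrC golden_tenth -expqC expq_thirdE expq_sixthE conj_half rmorphN rmorph1 isqC.
by field: h3 h5.
Qed.

Lemma class_family_nnmm n p r (s := ofR (2 * cos (pi / n%:R)) : C) : family_nnmm n p r ->
  param_class p r s s.
Proof.
rewrite /s => {s}; case=> {n p r} p hp; rewrite ?two_cos3 ?two_cos5.
- have -> : expi (pi / 3) = ex (1 / 6) by to_expq.
  apply: (@class_quadratic_3 _ _ (- (1 / 6)) (- (5 / 12)) (1 / 12)).
  + by rewrite expq_sixthE conj_half rmorph1 isqC; field.
  + by field.
  + by move: p hp; apply/allP; vm_compute.
  + rewrite (@expq_opp R (- (5 / 12)) (1 / 12)); last by field.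
    by rewrite addrK -expqC expq_sixthE conj_half rmorph1 isqC; field.
- exact: class_334_7.
- have -> : - expi (- (2 * pi) / 5) - expi (- (4 * pi) / 5) = - (ex (- (1 / 5)) + ex (- (2 / 5))) :> C.
    by rewrite opprD; congr (- _ - _); to_expq.
  have h := fifth_sum R.
  apply: (@class_quadratic_3 _ _ (- (3 / 10)) (- (4 / 15)) (1 / 15)).
  + rewrite rmorphN rmorphD /= !expqC !opprK; apply/eqP; rewrite eq_sym -subr_eq0 -[X in _ == X]h.
    by apply/eqP; ring.
  + by field.
  + by rewrite hp; vm_compute.
  + rewrite -addrA [ex (- (4 / 15)) + _]addrC (@expq_triple R (1 / 15) (- (4 / 15)) (- (1 / 10))); [|by field..].
    rewrite (@expq_opp' (1 / 5) (- (3 / 10))); last by field.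
    rewrite (@expq_opp' (2 / 5) (- (1 / 10))); last by field.
    by apply/eqP; rewrite eq_sym -subr_eq0 -[X in _ == X]h; apply/eqP; ring.
- have s2 := two_cos4 R; have rE : 1 +i* 1 = 1 + ex (1 / 4) :> C by rewrite expq_quarter cplx_split.
  have q : (ex (1 / 4))^* = - ex (1 / 4).
    by rewrite expqC (@expq_opp R (- (1 / 4)) (1 / 4)) ?opprK //; field.
  apply: (@class_quadratic_sum _ _ _ _ (- (1 / 4)) (- (3 / 8)) (1 / 8)).
  + exact: sq_neq0 s2.
  + exact: ofR_conj.
  + by rewrite s2 rE rmorphD rmorph1 /= q; ring.
  + by field.
  + by move: p hp; apply/allP; vm_compute.
  + rewrite (@expq_opp R (- (3 / 8)) (1 / 8)); last by field.
    by rewrite addrK -expqC q rE; ring.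
- exact: class_554.
- have h := fifth_sum R; have g := golden R.
  have -> : expi (2 * pi / 5) = ex (1 / 5) by to_expq.
  apply: (@class_quadratic_5 _ _ (- (3 / 10)) (- (7 / 20)) (3 / 20)).
  + rewrite rmorphD rmorph1 /= expqC; have -> : (3 + sq R 5) / 2 = (sq R 5 - 1) / 2 + 2 by field.
    by rewrite -g; ring.
  + by field.
  + by rewrite hp; vm_compute.
  + rewrite (@expq_opp R (- (7 / 20)) (3 / 20)); last by field.
    rewrite (@expq_opp' (1 / 5) (- (3 / 10))); last by field.
    by ring.
Qed.

(** The Hurwitz move applied to another pair of reflections. *)
Lemma param_hurwitz_cyclic p r s t : param_class p (- r^*) (- t^*) (t * r - s^*) -> param_class p r s t.
Proof. by move=> h; apply: param_cyclic; apply: param_hurwitz. Qed.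

End Families2.

(** * The remaining families *)

Section Families3.
Variable R : realType.
Local Notation C := (Cplx R).
Local Notation ex := (expq R).
Implicit Types (p : int) (r s t : C).

(** A triple is of cubic type when its parameters have the same modulus as u and the
product u^3. *)
Lemma param_rescale_diagonal p u r s t : r != 0 -> t != 0 -> u * u^* = r * r^* -> u * u^* = t * t^* ->
  u * u * u = r * s * t -> param_class p u u u -> param_class p r s t.
Proof. by move=> r0 t0 hr ht h; exact: param_rescale. Qed.

(** One Hurwitz move gives a triple of modulus one with product i, which is that of
(3,3,3;4). *)
Lemma class_334_3 p : p \in [:: 5; 6] -> param_class p (1 +i* 1 : C) 1 1.
Proof.
move=> hp; have rE : 1 +i* 1 = 1 + ex (1 / 4) :> C by rewrite expq_quarter cplx_split.
have q : (ex (1 / 4))^* = - ex (1 / 4).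
  by rewrite expqC (@expq_opp R (- (1 / 4)) (1 / 4)) ?opprK //; field.
apply: param_hurwitz; rewrite rE rmorphD /= !conjC1 q mulr1 opprD opprK addrA subrr add0r.
pose u : C := - expi (- (2 * pi) / (3 * 4%:R)).
have uE : u = ex (5 / 12).
  rewrite (@expq_opp R (- (1 / 12)) (5 / 12)); last by field.
  by congr (- _); to_expq.
have uC : u * u^* = 1 by rewrite uE phase_conj.
apply: (@param_rescale_diagonal _ u).
- by rewrite oppr_eq0 oner_neq0.
- exact: expq_neq0.
- by rewrite uC rmorphN /= conjC1 mulrNN mulr1.
- by rewrite uC phase_conj.
- rewrite uE mulrNN mulr1 mul1r -!expqD; apply: expq_period; by field.
apply: class_family_nnnm; apply: nnnm_3.
by move: hp; rewrite !inE; repeat (case/orP); move=> /eqP ->.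
Qed.

(** Three Hurwitz moves lead to the triple of (6,6,6;4): they increase the squared moduli of the
parameters from (2,1,1) to (3,3,3). *)
Lemma class_334_6 p : p \in [:: 3; 4; 6] -> param_class p (0 +i* Num.sqrt 2 : C) 1 1.
Proof.
move=> hp; have [w wE] : exists w, w = isq R 2 by exists (isq R 2).
have w2 : w ^+ 2 = -2 by rewrite wE isqK.
have wC : w^* = - w by rewrite wE isqC.
rewrite -[_ +i* _]/(isq R 2) -wE.
have n1 : w - 1 != 0.
  apply/eqP => h; move: w2; have -> : w = 1 by rewrite -[w](subrK 1) h add0r.
  by rewrite expr1n => /eqP; rewrite -subr_eq0 opprK -natr1 -[1]/(1%:R) -!natrD pnatr_eq0.
apply: param_hurwitz_cyclic; rewrite wC !opprK conjC1 mul1r.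
apply: param_hurwitz_cyclic; rewrite wC !opprK rmorphB rmorphN /= !conjC1 wC.
have -> : (w - 1) * w - -1 = - (w + 1) by ring: w2.
have -> : - (- w - 1) = w + 1 by ring.
have cw : (w + 1)^* = 1 - w by rewrite rmorphD /= conjC1 wC addrC.
have cw' : (1 - w)^* = 1 + w by rewrite rmorphB /= conjC1 wC opprK.
apply: param_hurwitz; rewrite rmorphN /= cw wC !opprK opprB.
have -> : (w + 1) * - (w + 1) + w = 1 - w by ring: w2.
have cn : (w - 1)^* = - (1 + w) by rewrite -opprB rmorphN /= cw'.
apply: (@param_rescale_diagonal _ (w - 1)).
- by rewrite -opprB oppr_eq0.
- by rewrite -opprB oppr_eq0.
- by rewrite cn cw'; ring.
- by rewrite cn cw'; ring.
- by ring.
have -> : w - 1 = -1 +i* Num.sqrt 2.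
  by rewrite cplx_split ofRN ofR1 addrC wE.
apply: class_family_nnnm; exact: nnnm_64.
Qed.

(** Two Hurwitz moves lead, up to rescaling, to the triple of (5,5,4;4): the squared
moduli become (2, g^2, g^2) with g the golden ratio. *)
Lemma class_334_5 p : p \in [:: 4; 5] ->
  param_class p (expi (2 * pi / 3) * (Num.sqrt 5 +i* - Num.sqrt 3) / 2 : C) 1 1.
Proof.
move=> hp; have hc := class_554 R hp; move: hc.
have -> : expi (pi / 3) = ex (1 / 6) by to_expq.
have -> : expi (2 * pi / 3) = ex (1 / 3) by to_expq.
rewrite expq_sixthE expq_thirdE cplx_split cplxN -/(sq R 5) -/(isq R 3).
have h3 := isqK R 3; have h5 := sqK R 5; have C3 := isqC R 3; have C5 := sqC R 5.
have gC := gold_conj R; have g0 := gold_neq0 R; move: gC g0; rewrite /gold.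
move: (isq R 3) (sq R 5) h3 h5 C3 C5 => w v h3 h5 C3 C5 gC g0 hc.
pose cj := (rmorphM, rmorphD, rmorphN, rmorph1, fmorphV, rmorph_nat).
have [r rE] : exists r, r = (w - 1) / 2 * (v - w) / 2 by eexists.
have [q qE] : exists q, q = (3 - v - (v + 1) * w) / 4%:R by eexists.
have rC : r^* = q by rewrite rE qE !cj /= C3 C5; field: h3 h5.
have qC : q^* = r by rewrite -rC conjCK.
have rq : r * q = 2 by rewrite rE qE; field: h3 h5.
have r0 : r != 0 by apply/eqP => r0; move/eqP: rq; rewrite r0 mul0r eq_sym pnatr_eq0.
have rDq : r + q = (3 - v) / 2 by rewrite rE qE; field: h3 h5.
have [g gE] : exists g, g = (1 + v) / 2 by eexists.
have g2 : g * g = (q - 1) * (r - 1).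
  have -> : (q - 1) * (r - 1) = r * q - (r + q) + 1 by ring.
  by rewrite rq rDq gE; field: h5.
rewrite -gE in hc gC g0; rewrite -rE.
have t0 : q - 1 != 0.
  by apply/eqP => t0; move/eqP: g2; rewrite t0 mul0r mulf_eq0 (negbTE g0).
apply: param_hurwitz_cyclic; rewrite rC conjC1 mul1r.
apply: param_hurwitz_cyclic; rewrite rmorphB !rmorphN /= !conjC1 rC qC !opprK.
have -> : (r - 1) * - q + 1 = q - 1 by rewrite mulrN mulrBl rq mul1r; ring.
have tC : (q - 1)^* = r - 1 by rewrite rmorphB /= conjC1 qC.
apply: param_rescale hc; rewrite ?r0 ?t0 ?rC ?rq ?gC ?tC ?g2 //.
- by rewrite !cj /= C3 C5; field: h3 h5.
- by rewrite -mulrA g2 rE qE; field: h3 h5.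
Qed.

Lemma class_family_334n p r : family_334n p r -> param_class p r 1 1.
Proof.
case=> {p r}; [exact: class_334_3 | exact: class_334_7 | exact: class_334_5 | exact: class_334_6].
Qed.

(** A Hurwitz move gives a triple of modulus one with product 1, which is that of
(3,3,3;2). *)
Lemma class_239 : param_class 9 (1 : C) 0 1.
Proof.
apply: param_hurwitz_cyclic; rewrite conjC0 conjC1 mulr1 subr0.
pose u : C := - expi (- (2 * pi) / (3 * 2%:R)).
have uE : u = ex (1 / 3).
  rewrite (@expq_opp R (- (1 / 6)) (1 / 3)); last by field.
  by congr (- _); to_expq.
have uC : u * u^* = 1 by rewrite uE phase_conj.
apply: (@param_rescale_diagonal _ u).
- by rewrite oppr_eq0 oner_neq0.
- exact: oner_neq0.
- by rewrite uC rmorphN /= conjC1 mulrNN mulr1.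
- by rewrite uC conjC1 mulr1.
- by rewrite uE mulrNN !mulr1 -!expqD (_ : _ + _ = 1) ?expq1 //; field.
by apply: class_family_nnnm; apply: nnnm_3.
Qed.

End Families3.

Theorem corollary1p2 (R : realType) (p : int) (rho sigma tau : Cplx R)
    (hknown : known_lattice p rho sigma tau) :
  exists alpha beta : 'I_3 -> Cplx R,
    (forall j k, exp2pi (alpha j) != exp2pi (beta k)) /\
    exists2 G : set 'M[Cplx R]_3,
      monodromy_group alpha beta G &
      commensurable (refl_group p rho sigma tau) G.
Proof.
suff : param_class p rho sigma tau by [].
case: hknown => {p rho sigma tau}.
- exact: class_family_nnnm.
- exact: class_family_nnmm.
- exact: class_family_334n.
- by rewrite two_cos3; exact: class_239.
- have -> : expi (pi / 3) = expq R (1 / 6) by to_expq.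
  exact: class_3444.
Qed.
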